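(* Let $\eta_0>0$ and let real coefficients $\{b_{n,m}^{\nu,\mu}\}$ be such that the series $$h(\theta,\varphi)=\sqrt{\cosh\eta_0-\cos\theta}\sum_{n,m,\nu,\mu}b_{n,m}^{\nu,\mu}\Phi_n^\nu(\theta)\Phi_m^\mu(\varphi)$$ converges absolutely, defining $h\colon\partial\Omega_{\eta_0}\to\mathbb{R}$. Assume that $h$ satisfies the compatibility condition $\int_{\partial\Omega_{\eta_0}}h\,dS=0$. Suppose further that the continuous solution $f\colon\partial\Omega_{\eta_0}\to\mathbb{R}$ of $\Lambda f=h$ (which exists and is unique up to an additive constant) has a double Fourier series which converges absolutely. Then: (i) for every value of $a_{0,0}^{+,+}\in\mathbb{R}$, the resulting algebraic solution $\{a_{n,0}^{+,+}\}_{n\ge0}$ for the indices $(m,\nu,\mu)=(0,+1,+1)$ produces an absolutely convergent series $\sum_n a_{n,0}^{+,+}I_{n,0}^{+,+}(\eta_0,\theta,\varphi)$ whose value is $f_0^{+,+}$ plus a constant; (ii) for each $(m,\nu,\mu)\ne(0,+1,+1)$, there exists a unique value of $a_{0,m}^{\nu,\mu}$ (when $\nu=1$) or of $a_{1,m}^{\nu,\mu}$ (when $\nu=-1$) for which the resulting algebraic solution gives a convergent series $\sum_n a_{n,m}^{\nu,\mu}I_{n,m}^{\nu,\mu}(\eta_0,\theta,\varphi)$. The sum of this series is $f_m^{\nu,\mu}$.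
   Context: Toroidal coordinates $(\eta,\theta,\varphi)$, $\eta\in(0,\infty)$, $\theta\in[-\pi,\pi]$, $\varphi\in(-\pi,\pi]$, on $\mathbb{R}^3$: $x_0=\frac{\sin\theta}{\cosh\eta-\cos\theta}$, $x_1=\frac{\sinh\eta\cos\varphi}{\cosh\eta-\cos\theta}$, $x_2=\frac{\sinh\eta\sin\varphi}{\cosh\eta-\cos\theta}$. $\Omega_{\eta_0}=\{\eta>\eta_0\}\cup\{x_0=0,\ x_1^2+x_2^2=1\}$ is an open solid torus, with boundary $\partial\Omega_{\eta_0}=\{\eta=\eta_0\}$ parametrized by $(\theta,\varphi)$; $dS$ is surface area. Dirichlet-to-Neumann map: $\Lambda f=\operatorname{nor}u$, where $u$ is the harmonic function in $\Omega_{\eta_0}$ with boundary values $f$ and $\operatorname{nor}u=(\cosh\eta_0-\cos\theta)\,\partial u/\partial\eta|_{\eta=\eta_0^+}$ is the inward unit normal derivative ($\Lambda\colon H^{1/2}(\partial\Omega_{\eta_0})\to H^{-1/2}(\partial\Omega_{\eta_0})$). It is a known fact that if $h$ is continuous with $\int_{\partial\Omega_{\eta_0}} h\,dS=0$, then $\Lambda f=h$ has a continuous solution $f$, unique up to an additive constant. $\Phi_n^{\nu}(\theta)=\cos n\theta$ if $\nu=+1$ and $\sin n\theta$ if $\nu=-1$; superscripts $\pm1$ are abbreviated $\pm$. All indices are integers $n,m\ge0$ and $\nu,\mu\in\{1,-1\}$, excluding the cases $(n,\nu)=(0,-1)$ and $(m,\mu)=(0,-1)$. Legendre functions of the second kind,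 for $t>1$, real $k>-1$, integer $m\ge0$: $$Q_k^m(t)=\frac{(-1)^m}{2^{k+1}}\frac{\Gamma(k+m+1)}{\Gamma(k+1)}(t^2-1)^{m/2}\int_{-1}^1\frac{(1-s^2)^k}{(t-s)^{k+m+1}}\,ds.$$ $I_{n,m}^{\nu,\mu}(\eta,\theta,\varphi)=\sqrt{\cosh\eta-\cos\theta}\,\frac{Q_{n-1/2}^m(\cosh\eta)}{Q_{n-1/2}^m(\cosh\eta_0)}\Phi_n^\nu(\theta)\Phi_m^\mu(\varphi)$, so $I_{n,m}^{\nu,\mu}(\eta_0,\theta,\varphi)=\sqrt{\cosh\eta_0-\cos\theta}\,\Phi_n^\nu(\theta)\Phi_m^\mu(\varphi)$. Expanding $f(\theta,\varphi)=\sum_{n,m,\nu,\mu}\alpha_{n,m}^{\nu,\mu}I_{n,m}^{\nu,\mu}(\eta_0,\theta,\varphi)$ (i.e. $\alpha_{n,m}^{\nu,\mu}$ are the Fourier coefficients of $f/\sqrt{\cosh\eta_0-\cos\theta}$), $f_{m}^{\nu,\mu}$ denotes the sum over $n$ of the terms with the given fixed $(m,\nu,\mu)$. Put $t_0=\cosh\eta_0$, $s_0=\sinh\eta_0$, $q_{n,m}=Q_{n-1/2}^m(t_0)$, and for $m\ge0$ $$\begin{aligned} \rho_{1,m}&=\tfrac{1}{2s_0}\Big(t_0+(2m-1)\tfrac{q_{1,m}}{q_{0,m}}\Big),\\ \rho_{n,m}&=\tfrac{1}{4s_0}\Big((2n-1)t_0+(2(m-n)+1)\tfrac{q_{n,m}}{q_{n-1,m}}\Big)\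 (n\ge2),\\ \sigma_{n,m}&=\tfrac{-1}{2s_0}\Big(2nt_0^2+1+(2(m-n)-1)t_0\tfrac{q_{n+1,m}}{q_{n,m}}\Big)\ (n\ge0),\\ \tau_{n,m}&=\tfrac{1}{4s_0}\Big((2n+3)t_0+(2(m-n)-3)\tfrac{q_{n+2,m}}{q_{n+1,m}}\Big)\ (n\ge0). \end{aligned}$$ The $\tau_{n,m}$ are all nonzero. An algebraic solution of the Neumann problem for $h$ is a collection of real numbers $\{a_{n,m}^{\nu,\mu}\}$ satisfying $$\begin{aligned} b_{0,m}^{+,\mu}&=\sigma_{0,m}a_{0,m}^{+,\mu}+\tau_{0,m}a_{1,m}^{+,\mu},\\ b_{n,m}^{+,\mu}&=\rho_{n,m}a_{n-1,m}^{+,\mu}+\sigma_{n,m}a_{n,m}^{+,\mu}+\tau_{n,m}a_{n+1,m}^{+,\mu}\ (n\ge1),\\ b_{1,m}^{-,\mu}&=\sigma_{1,m}a_{1,m}^{-,\mu}+\tau_{1,m}a_{2,m}^{-,\mu},\\ b_{n,m}^{-,\mu}&=\rho_{n,m}a_{n-1,m}^{-,\mu}+\sigma_{n,m}a_{n,m}^{-,\mu}+\tau_{n,m}a_{n+1,m}^{-,\mu}\ (n\ge2). \end{aligned}$$ The equations for different $(m,\nu,\mu)$ are independent; for fixed $(m,\nu,\mu)$, the initial value $a_{0,m}^{+,\mu}$ (if $\nu=1$) or $a_{1,m}^{-,\mu}$ (if $\nu=-1$) determines the rest of the sequence $\{a_{n,m}^{\nu,\mu}\}_n$ recursively; this sequence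 is ''the resulting algebraic solution''. *)

(* Defs.v *)
From HB Require Import structures.
From mathcomp Require Import all_boot all_order all_algebra.
From mathcomp Require Import all_classical all_reals all_analysis.

Set Implicit Arguments.
Unset Strict Implicit.
Unset Printing Implicit Defensive.

Import Order.TTheory GRing.Theory Num.Theory.
Import numFieldNormedType.Exports.

Local Open Scope classical_set_scope.
Local Open Scope ring_scope.

Definition cosh {R : realType} (x : R) : R := (expR x + expR (- x)) / 2.
Definition sinh {R : realType} (x : R) : R := (expR x - expR (- x)) / 2.

(* The point (x_0, x_1, x_2); for eta > 0 the denominator is positive. *)
Definition toroidal {R : realType} (eta theta phi : R) : 'rV[R]_3 :=
  let d := cosh eta - cos theta in
  \row_(i < 3) nth 0 [:: sin theta / d;
                         sinh eta * cos phi / d;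
                         sinh eta * sin phi / d] i.

Definition angles {R : realType} (theta phi : R) : Prop :=
  - pi <= theta <= pi /\ - pi < phi <= pi.

Definition solid_torus {R : realType} (eta0 : R) : set 'rV[R]_3 :=
  [set x | (exists eta theta phi,
              [/\ eta0 < eta, angles theta phi & x = toroidal eta theta phi])
           \/ (x 0 (inord 0) = 0 /\
               x 0 (inord 1) ^+ 2 + x 0 (inord 2) ^+ 2 = 1)].

Definition torus {R : realType} (eta0 : R) : set 'rV[R]_3 :=
  [set x | exists theta phi, angles theta phi /\ x = toroidal eta0 theta phi].

(* Area element of the parametrization (theta, phi) |-> toroidal eta0 theta phi,
   i.e. the square root of the Gram determinant of its two tangent vectors. *)
Definition dot {R : realType} (v w : 'rV[R]_3) : R := \sum_i v 0 i * w 0 i.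

Definition tangent_theta {R : realType} (eta theta phi : R) : 'rV[R]_3 :=
  \row_i derive1 (fun t => toroidal eta t phi 0 i) theta.

Definition tangent_phi {R : realType} (eta theta phi : R) : 'rV[R]_3 :=
  \row_i derive1 (fun t => toroidal eta theta t 0 i) phi.

Definition area_element {R : realType} (eta theta phi : R) : R :=
  let v := tangent_theta eta theta phi in
  let w := tangent_phi eta theta phi in
  Num.sqrt (dot v v * dot w w - dot v w ^+ 2).

Definition angle_integral {R : realType} (g : R -> R -> R) : R :=
  \int[lebesgue_measure]_(theta in `[- pi, pi])
    \int[lebesgue_measure]_(phi in `[- pi, pi]) g theta phi.

(* Integral with respect to dS over [torus eta0] of a function given in the
   coordinates (theta, phi). *)
Definition surface_integral {R : realType} (eta0 : R) (g : R -> R -> R) : R :=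
  angle_integral (fun theta phi => g theta phi * area_element eta0 theta phi).

Definition partial {R : realType} (i : 'I_3) (u : 'rV[R]_3 -> R)
    (x : 'rV[R]_3) : R :=
  'D_(delta_mx 0 i) u x.

(* [U] is meant to be open. *)
Definition C2_on {R : realType} (U : set 'rV[R]_3) (u : 'rV[R]_3 -> R) : Prop :=
  forall x, U x ->
    [/\ {for x, continuous u},
        forall i, derivable u x (delta_mx 0 i) /\
                  {for x, continuous (partial i u)}
      & forall i j, derivable (partial i u) x (delta_mx 0 j) /\
                    {for x, continuous (partial j (partial i u))}].

Definition harmonic_on {R : realType} (U : set 'rV[R]_3)
    (u : 'rV[R]_3 -> R) : Prop :=
  C2_on U u /\ forall x, U x -> \sum_i partial i (partial i u) x = 0.

Definition d_eta {R : realType} (u : 'rV[R]_3 -> R) (eta theta phi : R) : R :=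
  derive1 (fun e => u (toroidal e theta phi)) eta.

Fixpoint Ck {R : realType} (k : nat) (g : R -> R -> R) : Prop :=
  continuous (fun p : R * R => g p.1 p.2) /\
  if k is k'.+1 then
    [/\ forall x y, derivable (fun t => g t y) x 1,
        forall x y, derivable (fun t => g x t) y 1,
        Ck k' (fun x y => derive1 (fun t => g t y) x)
      & Ck k' (fun x y => derive1 (fun t => g x t) y)]
  else True.

(* Smooth functions on the torus, written in the coordinates (theta, phi). *)
Definition test_function {R : realType} (psi : R -> R -> R) : Prop :=
  [/\ forall k, Ck k psi,
      forall theta phi, psi (theta + 2 * pi) phi = psi theta phi
    & forall theta phi, psi theta (phi + 2 * pi) = psi theta phi].

(* nor u = h.  The values of the Dirichlet-to-Neumann map lie in H^(-1/2), so the
   boundary value at eta = eta0^+ in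
     nor u = (cosh eta0 - cos theta) * du/deta at eta = eta0^+
   is the limit in the sense of distributions on the torus.  A uniform
   limit on the torus is a particular case. *)
Definition normal_derivative {R : realType} (eta0 : R)
    (u h : 'rV[R]_3 -> R) : Prop :=
  forall psi, test_function psi ->
    surface_integral eta0 (fun theta phi =>
      (cosh eta0 - cos theta) * d_eta u eta theta phi * psi theta phi)
    @[eta --> eta0^'+] -->
    surface_integral eta0 (fun theta phi =>
      h (toroidal eta0 theta phi) * psi theta phi).

(* Lambda f = h, for f continuous on the torus; only the values of f and h on
   [torus eta0] matter. *)
Definition DtN {R : realType} (eta0 : R) (f h : 'rV[R]_3 -> R) : Prop :=
  exists u : 'rV[R]_3 -> R,
    [/\ harmonic_on (solid_torus eta0) u,
        {within solid_torus eta0 `|` torus eta0, continuous u},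
        forall x, torus eta0 x -> u x = f x
      & normal_derivative eta0 u h].

Definition Gamma {R : realType} (z : R) : R :=
  \int[lebesgue_measure]_(x in `]0, +oo[) (x `^ (z - 1) * expR (- x)).

Definition legendreQ {R : realType} (k : R) (m : nat) (t : R) : R :=
  (-1) ^+ m / 2 `^ (k + 1) * (Gamma (k + m%:R + 1) / Gamma (k + 1)) *
  (t ^+ 2 - 1) `^ (m%:R / 2) *
  \int[lebesgue_measure]_(s in `[-1, 1])
    ((1 - s ^+ 2) `^ k / (t - s) `^ (k + m%:R + 1)).

(* A superscript nu in {1, -1} is a boolean: [true] is +1 and [false] is -1. *)
Definition Phi {R : realType} (n : nat) (nu : bool) (x : R) : R :=
  if nu then cos (n%:R * x) else sin (n%:R * x).

(* The pairs (n, nu) other than (0, -1), and the least n for a given nu. *)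
Definition admissible (n : nat) (nu : bool) : bool := nu || (0 < n)%N.
Definition first_index (nu : bool) : nat := if nu then 0%N else 1%N.

Definition toroidal_harmonic {R : realType} (eta0 : R) (n m : nat)
    (nu mu : bool) (eta theta phi : R) : R :=
  Num.sqrt (cosh eta - cos theta) *
  (legendreQ (n%:R - 2^-1) m (cosh eta) /
   legendreQ (n%:R - 2^-1) m (cosh eta0)) *
  Phi n nu theta * Phi m mu phi.

(* The index (n, m, nu, mu). *)
Definition index : choiceType := (nat * nat * bool * bool)%type.

Definition indices : set index :=
  [set i | let '(n, m, nu, mu) := i in admissible n nu && admissible m mu].

Definition trig_term {R : realType} (c : nat -> nat -> bool -> bool -> R)
    (theta phi : R) (i : index) : R :=
  let '(n, m, nu, mu) := i in c n m nu mu * Phi n nu theta * Phi m mu phi.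

Definition abs_convergent {R : realType}
    (c : nat -> nat -> bool -> bool -> R) : Prop :=
  forall theta phi,
    summable indices (fun i => (trig_term c theta phi i)%:E).

(* The sum of an absolutely convergent double trigonometric series; [esum] is
   meant for nonnegative terms, hence the two parts. *)
Definition trig_sum {R : realType} (c : nat -> nat -> bool -> bool -> R)
    (theta phi : R) : R :=
  fine (\esum_(i in indices) (Num.max (trig_term c theta phi i) 0)%:E)
  - fine (\esum_(i in indices) (Num.max (- trig_term c theta phi i) 0)%:E).

(* The function cos (0 * x) = 1 has squared norm 2 * pi on [-pi, pi]; the other
   Phi n nu have squared norm pi. *)
Definition Phi_sqnorm {R : realType} (n : nat) : R :=
  if n == 0%N then 2 * pi else pi.

Definition fourier_coef {R : realType} (g : R -> R -> R)
    (n m : nat) (nu mu : bool) : R :=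
  angle_integral (fun theta phi => g theta phi * Phi n nu theta * Phi m mu phi)
  / (Phi_sqnorm n * Phi_sqnorm m).

(* The coefficients alpha in the expansion f = sum of alpha * I(eta0, -, -). *)
Definition alpha {R : realType} (eta0 : R) (f : 'rV[R]_3 -> R)
    : nat -> nat -> bool -> bool -> R :=
  fourier_coef (fun theta phi =>
    f (toroidal eta0 theta phi) / Num.sqrt (cosh eta0 - cos theta)).

(* Terms and partial sums, over n, of the series of a_n * I_{n,m}(eta0, -, -);
   the index n starts at [first_index nu]. *)
Definition mode_term {R : realType} (eta0 : R) (m : nat) (nu mu : bool)
    (a : nat -> R) (theta phi : R) (n : nat) : R :=
  a n * toroidal_harmonic eta0 n m nu mu eta0 theta phi.

Definition mode_series {R : realType} (eta0 : R) (m : nat) (nu mu : bool)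
    (a : nat -> R) (theta phi : R) : nat -> R :=
  fun N => \sum_(first_index nu <= n < N) mode_term eta0 m nu mu a theta phi n.

Definition mode_abs_series {R : realType} (eta0 : R) (m : nat) (nu mu : bool)
    (a : nat -> R) (theta phi : R) : nat -> R :=
  fun N => \sum_(first_index nu <= n < N)
    `|mode_term eta0 m nu mu a theta phi n|.

Definition mode_convergent {R : realType} (eta0 : R) (m : nat) (nu mu : bool)
    (a : nat -> R) : Prop :=
  forall theta phi, cvgn (mode_series eta0 m nu mu a theta phi).

(* f_m^{nu,mu} in the decomposition of f into the sums over n for fixed (m, nu, mu). *)
Definition mode {R : realType} (eta0 : R) (f : 'rV[R]_3 -> R) (m : nat)
    (nu mu : bool) (theta phi : R) : R :=
  limn (mode_series eta0 m nu mu (fun n => alpha eta0 f n m nu mu) theta phi).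

Definition qv {R : realType} (eta0 : R) (n m : nat) : R :=
  legendreQ (n%:R - 2^-1) m (cosh eta0).

Definition rho {R : realType} (eta0 : R) (n m : nat) : R :=
  match n with
  | 0 => 0 (* unused *)
  | 1 => (2 * sinh eta0)^-1 *
         (cosh eta0 + (2 * m%:R - 1) * (qv eta0 1 m / qv eta0 0 m))
  | _ => (4 * sinh eta0)^-1 *
         ((2 * n%:R - 1) * cosh eta0
          + (2 * (m%:R - n%:R) + 1) * (qv eta0 n m / qv eta0 n.-1 m))
  end.

Definition sigma {R : realType} (eta0 : R) (n m : nat) : R :=
  -1 / (2 * sinh eta0) *
  (2 * n%:R * cosh eta0 ^+ 2 + 1
   + (2 * (m%:R - n%:R) - 1) * cosh eta0 * (qv eta0 n.+1 m / qv eta0 n m)).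

Definition tau {R : realType} (eta0 : R) (n m : nat) : R :=
  (4 * sinh eta0)^-1 *
  ((2 * n%:R + 3) * cosh eta0
   + (2 * (m%:R - n%:R) - 3) * (qv eta0 n.+2 m / qv eta0 n.+1 m)).

(* The equations for fixed (m, nu, mu), with [b n] standing for b_{n,m}^{nu,mu};
   values at indices below [first_index nu] are ignored. *)
Definition algebraic_solution {R : realType} (eta0 : R) (m : nat) (nu : bool)
    (b a : nat -> R) : Prop :=
  let n0 := first_index nu in
  b n0 = sigma eta0 n0 m * a n0 + tau eta0 n0 m * a n0.+1 /\
  forall n, (n0 < n)%N ->
    b n = rho eta0 n m * a n.-1 + sigma eta0 n m * a n + tau eta0 n m * a n.+1.

Definition resulting_solution {R : realType} (eta0 : R) (m : nat) (nu : bool)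
    (b : nat -> R) (c : R) (a : nat -> R) : Prop :=
  a (first_index nu) = c /\ algebraic_solution eta0 m nu b a.

(* Main.v *)
(* Divided by sqrt (cosh eta - cos theta), a harmonic function u in the torus solves a
   separable equation, so each of its double Fourier modes in (theta, phi) solves a
   Legendre equation in eta; being bounded near the core circle, it is a multiple of
   Q_{n-1/2}^m(cosh eta).  Comparing the modes of u sqrt (cosh eta0 - cos theta), whose
   eta-derivatives tend to the Fourier coefficients b of the Neumann data, with those of
   u sqrt (cosh eta - cos theta), one finds that the coefficients alpha of f solve the
   three-term system with right-hand side b.  In terms of x_n = L_n a_n, where
   L_n = - q_{n,m}' / q_{n,m} grows linearly, this system is close to
   (x_{n-1} + x_{n+1}) / 2 - t0 x_n = b_n with t0 > 1: a bounded solution is absolutely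
   summable as soon as sum |b_n| is finite, and the latter follows from the absolute
   convergence of h by the theorem of Denjoy and Luzin.
   A homogeneous solution is compared with the explicit decreasing solution for m = 0:
   as L_{n,m} > L_{n,0} for m > 0, their Casoratian increases, and the solution stays
   away from zero unless its initial value vanishes.  For (m, nu, mu) = (0, +, +) the
   homogeneous solutions are the multiples of the explicit one, whose series sums to a
   constant. *)
Require Import Defs.
From HB Require Import structures.
From mathcomp Require Import all_boot all_order all_algebra.
From mathcomp Require Import all_classical all_reals all_analysis.
From mathcomp Require Import zify ring lra measurable_realfun.

Set Implicit Arguments.
Unset Strict Implicit.
Unset Printing Implicit Defensive.

Import Order.TTheory GRing.Theory Num.Theory.
Import numFieldNormedType.Exports.

Local Open Scope classical_set_scope.
Local Open Scope ring_scope.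

(** * Hyperbolic functions and integrals over the square of angles *)

(** The Neumann datum is attained only in the sense of distributions, so u has no boundary
    derivative that could be expanded mode by mode. Two facts get around this. The modes of u / sqrt
    (cosh eta - cos theta) are multiples of Legendre functions, which are smooth across eta0. And a
    test function can absorb the area element and freeze the other weight at eta0, so that the
    eta-derivative falls on u alone. The factor cosh eta - cos theta between the two weightings
    shifts each mode to its neighbours, whence three terms.

    Neither for the Legendre equation nor for the recurrence are asymptotics of a second solution
    used: a Wronskian with one known positive solution decides. For the differential equation, a
    nonzero Wronskian of two solutions of the size allowed by boundedness would make their quotient
    blow up at a finite eta. For the recurrence, a Casoratian that starts positive stays so; when nu
    = -1 it does so for every m, because the comparison sequence has an entry of index 0 that a sine
    sequence lacks. *)

Section hyperbolic.
Context {R : realType}.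
Implicit Types x : R.

Lemma cosh_gt0 x : 0 < cosh x.
Proof. by rewrite /cosh divr_gt0 // addr_gt0 ?expR_gt0. Qed.

Lemma cosh2B x : cosh x ^+ 2 - sinh x ^+ 2 = 1.
Proof.
have h : expR x * expR (- x) = 1 by rewrite -expRD subrr expR0.
by rewrite /cosh /sinh -[RHS]h; field.
Qed.

Lemma sinh_gt0 x : 0 < x -> 0 < sinh x.
Proof. by move=> x0; rewrite /sinh divr_gt0 // subr_gt0 ltr_expR gtrN. Qed.

Lemma cosh_gt1 x : 0 < x -> 1 < cosh x.
Proof.
move=> x0; have s0 := sinh_gt0 x0.
rewrite -(ltr_pXn2r (_ : (0 < 2)%N)) ?nnegrE ?ltW ?cosh_gt0 //.
by rewrite expr1n -(cosh2B x) ltrBlDr ltrDl exprn_gt0.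
Qed.

Global Instance is_derive_cosh x : is_derive x 1 (@cosh R) (sinh x).
Proof.
rewrite /cosh; apply: is_derive_eq.
by rewrite /sinh /GRing.scale /=; ring.
Qed.

Global Instance is_derive_sinh x : is_derive x 1 (@sinh R) (cosh x).
Proof.
rewrite /sinh; apply: is_derive_eq.
by rewrite /cosh /GRing.scale /=; ring.
Qed.

Lemma ltr_cosh x y : 0 <= x -> x < y -> cosh x < cosh y.
Proof.
move=> x0 xy.
have h : expR x * expR (- x) = 1 by rewrite -expRD subrr expR0.
have h' : expR y * expR (- y) = 1 by rewrite -expRD subrr expR0.
have e1 : expR x < expR y by rewrite ltr_expR.
have e2 : 1 <= expR x by rewrite -expR0 ler_expR.
have e3 : 0 < expR (- y) by apply: expR_gt0.
rewrite /cosh ltr_pM2r ?invr_gt0 // -subr_gt0.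
have -> : expR y + expR (- y) - (expR x + expR (- x)) =
  (expR y - expR x) * (1 - expR (- x) * expR (- y)).
  have -> : (expR y - expR x) * (1 - expR (- x) * expR (- y)) =
    expR y - expR x - (expR y * expR (- y)) * expR (- x)
    + (expR x * expR (- x)) * expR (- y) by ring.
  rewrite h h'; ring.
rewrite mulr_gt0 ?subr_gt0 // -expRD -expR0 ltr_expR.
by rewrite -opprD oppr_lt0; lra.
Qed.

Lemma sinh_le_cosh x : sinh x <= cosh x.
Proof. by rewrite /sinh /cosh ler_pM2r ?invr_gt0 // lerD2l ge0_cp // expR_ge0. Qed.

Lemma cosh_ge2 : exists2 e1 : R, 0 < e1 & forall x, e1 <= x -> 2 <= cosh x.
Proof.
exists 3 => // e e3; rewrite /cosh ler_pdivlMr //.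
have := expR_ge1Dx e; have := expR_ge0 (- e); lra.
Qed.

End hyperbolic.

(** On a set of finite measure a constant is integrable, so the single bound [C] dominates both the
    functions and their derivatives. *)
Lemma is_derive_Rintegral d (Y : measurableType d) (R : realType)
    (mu : {measure set Y -> \bar R}) (B : set Y) (f f' : R -> Y -> R) (u v a C : R) :
  measurable B -> (mu B < +oo)%E -> 0 <= C -> u < a < v ->
  (forall x, u < x < v -> measurable_fun B (f x)) ->
  (forall x y, u < x < v -> B y -> `|f x y| <= C) ->
  (forall x y, u < x < v -> B y -> is_derive x 1 (f^~ y) (f' x y)) ->
  (forall x y, u < x < v -> B y -> `|f' x y| <= C) ->
  is_derive a 1 (fun x => \int[mu]_(y in B) f x y) (\int[mu]_(y in B) f' a y).
Proof.
move=> mB fB C0 uav mf fC df f'C.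
have Ia : `]u, v[%classic a by rewrite /= in_itv.
have intf x : `]u, v[%classic x -> mu.-integrable B (EFin \o f x).
  rewrite /= in_itv /= => uxv; apply: measurable_bounded_integrable => //; first exact: mf.
  exists C; split; first exact: num_real.
  by move=> M CM y By /=; rewrite (le_trans (fC x y uxv By)) // ltW.
have derf x y : `]u, v[%classic x -> B y -> derivable (f^~ y) x 1.
  by rewrite /= in_itv /= => uxv By; case: (df x y uxv By).
have intG : mu.-integrable B (EFin \o (fun=> C)).
  apply: measurable_bounded_integrable => //.
  exists C; split; first exact: num_real.
  by move=> M CM y By /=; rewrite ger0_norm // ltW.
have partE x y : u < x < v -> B y -> partial1of2 f x y = f' x y.
  by move=> uxv By; rewrite partial1of2E; case: (df x y uxv By).
have GC x y : `]u, v[%classic x -> B y -> `|partial1of2 f x y| <= C.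
  by rewrite /= in_itv /= => uxv By; rewrite partE // f'C.
apply: DeriveDef.
  exact: (derivable_under_integral mB Ia intf derf _ intG GC).
rewrite -derive1E.
rewrite (differentiation_under_integral mB Ia intf derf _ intG GC) //.
by apply: eq_Rintegral => y; rewrite inE => By; rewrite -partE.
Qed.

Lemma continuous_bounded_compact (T : topologicalType) (R : realType) (g : T -> R)
    (K : set T) : compact K -> (forall z, K z -> {for z, continuous g}) ->
  exists2 C, 0 <= C & forall z, K z -> `|g z| <= C.
Proof.
move=> cK cg.
have [|M [_ HM]] := @compact_bounded R R^o (g @` K).
  apply: continuous_compact => //; apply: continuous_in_subspaceT => z.
  by rewrite inE => /cg.
exists (`|M| + 1); first by rewrite addr_ge0.
move=> z Kz; apply: (HM (`|M| + 1)); last by exists z.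
by rewrite (le_lt_trans (ler_norm _)) // ltrDl.
Qed.

(** Measurability refers to the product sigma-algebra: an open set of the plane belongs to it as the
    countable union of the boxes with rational corners that it contains. *)
Lemma continuous_measurable_prod (R : realType) (g : R * R -> R) :
  continuous g -> measurable_fun setT g.
Proof.
move=> cg.
have boxm (a b c e : R) : measurable (`]a, b[%classic `*` `]c, e[%classic : set (R * R)).
  by apply: measurableX; exact: measurable_itv.
have openm (O : set (R * R)) : open O -> measurable O.
  move=> oO.
  pose box (q : rat * rat * (rat * rat)) : set (R * R) :=
    `]ratr q.1.1, ratr q.1.2[%classic `*` `]ratr q.2.1, ratr q.2.2[%classic.
  have -> : O = \bigcup_q (if `[< box q `<=` O >] then box q else set0).
    apply/seteqP; split => [[x y] Oxy|z [q _]]; last by case: asboolP => // + bz; apply.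
    have /nbhs_ballP[e /= e0 eO] := open_nbhs_nbhs (conj oO Oxy).
    have xe z : z - e < z by rewrite ltrBlDr ltrDl.
    have ex z : z < z + e by rewrite ltrDl.
    have [a] := rat_in_itvoo (xe x); rewrite in_itv /= => /andP[a1 a2].
    have [b] := rat_in_itvoo (ex x); rewrite in_itv /= => /andP[b1 b2].
    have [c] := rat_in_itvoo (xe y); rewrite in_itv /= => /andP[c1 c2].
    have [k] := rat_in_itvoo (ex y); rewrite in_itv /= => /andP[k1 k2].
    exists ((a, b), (c, k)) => //; rewrite asboolT.
      by split; rewrite /= in_itv /= ?a2 ?b1 ?c2 ?k1.
    move=> [x' y'] [/=]; rewrite !in_itv /= => /andP[x1 x2] /andP[y1 y2].
    apply: eO; split => /=; rewrite /ball /= ltr_distlC.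
      by rewrite (lt_trans a1 x1) (lt_trans x2 b2).
    by rewrite (lt_trans c1 y1) (lt_trans y2 k2).
  apply: countable_bigcupT_measurable; last by move=> q; case: asboolP => // _; exact: boxm.
  exact: countableP.
apply: (measurability _ (RGenOInfty.measurableE R)) => /= _ [_ [x ->] <-].
rewrite setTI; apply: openm; apply: open_comp => // z _; exact: cg.
Qed.

Lemma continuous_pair (T U V : topologicalType) (f : T -> U) (g : T -> V) (x : T) :
  {for x, continuous f} -> {for x, continuous g} ->
  {for x, continuous (fun t => (f t, g t))}.
Proof. by move=> cf cg; apply: cvg_pair. Qed.

Definition square {R : realType} : set (R * R) :=
  `[- pi, pi]%classic `*` `[- pi, pi]%classic.

Definition continuous2 {R : realType} (g : R -> R -> R) : Prop :=
  continuous (fun p : R * R => g p.1 p.2).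

Section square_integral.
Context {R : realType}.
Notation mu := (@lebesgue_measure R).
Notation mu2 := (mu \x mu)%E.
Implicit Types g : R -> R -> R.

Lemma measurable_square : measurable (@square R).
Proof. by apply: measurableX; exact: measurable_itv. Qed.

Lemma square_measure : mu2 (@square R) = ((2 * pi) ^+ 2)%:E.
Proof.
transitivity (mu `[(- pi)%R, pi]%classic * mu `[(- pi)%R, pi]%classic)%E.
  by apply: product_measure1E; exact: measurable_itv.
rewrite !lebesgue_measure_itv /= lte_fin gtrN ?pi_gt0 //.
by rewrite -EFinB opprK -EFinM; congr EFin; ring.
Qed.

Lemma compact_square : compact (@square R).
Proof. by apply: compact_setX; exact: segment_compact. Qed.

Lemma square_integrable (f : R * R -> R) :
  continuous f -> mu2.-integrable square (EFin \o f).
Proof.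
move=> cf; apply: measurable_bounded_integrable.
- exact: measurable_square.
- by rewrite [X in (X < _)%E]square_measure ltry.
- by apply: measurable_funTS; exact: continuous_measurable_prod.
- have [C C0 fC] := continuous_bounded_compact compact_square (fun z _ => cf z).
  exists C; split; first exact: num_real.
  by move=> M CM z sz /=; rewrite (le_trans (fC z sz)) // ltW.
Qed.

Lemma square_integrableT (f : R * R -> R) :
  continuous f -> mu2.-integrable setT (EFin \o (f \_ square)).
Proof.
move=> /square_integrable; rewrite -restrict_EFin => h.
by apply/integrable_restrict; [exact: measurable_square|by []|rewrite setTI].
Qed.

Lemma continuous2_r g x : continuous2 g -> continuous (g x).
Proof.
move=> cg y; apply: (@continuous_comp _ _ _ (fun y => (x, y)) (fun p => g p.1 p.2)).
  by apply: continuous_pair; [exact: cvg_cst|exact: cvg_id].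
exact: cg.
Qed.

Lemma continuous2_l g y : continuous2 g -> continuous (g^~ y).
Proof.
move=> cg x; apply: (@continuous_comp _ _ _ (fun x => (x, y)) (fun p => g p.1 p.2)).
  by apply: continuous_pair; [exact: cvg_id|exact: cvg_cst].
exact: cg.
Qed.

Lemma segment_integrable (f : R -> R) (a b : R) :
  continuous f -> mu.-integrable `[a, b] (EFin \o f).
Proof.
move=> cf; apply: continuous_compact_integrable; first exact: segment_compact.
exact: continuous_subspaceT.
Qed.

(** Fubini; the product measure gives linearity, domination and differentiation under the integral
    in one step instead of twice. *)
Lemma angle_integralE g : continuous2 g ->
  angle_integral g = (\int[mu2]_(z in square) g z.1 z.2)%R.
Proof.
move=> cg; have h := square_integrableT cg.
rewrite [RHS]Rintegral_mkcond /Rintegral -(integral12_prod_meas1 h).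
rewrite /angle_integral {1}/Rintegral integral_mkcond; congr fine.
apply: eq_integral => x _; rewrite patchE /fubini_F.
case: ifPn => xI; last first.
  rewrite integral0_eq // => y _.
  by rewrite /= patchE in_setX /= (negbTE xI).
rewrite [in RHS](_ : (fun y => _) = (fun y => (((g x) \_ `[- pi, pi]) y)%:E)); last first.
  by apply/funext => y /=; rewrite !patchE in_setX /= xI.
rewrite /Rintegral fineK; last first.
  by apply: integrable_fin_num => //; apply: segment_integrable; exact: continuous2_r.
by rewrite integral_mkcond; apply: eq_integral => y _; rewrite !patchE; case: ifP.
Qed.

Lemma continuous2_swap g : continuous2 g -> continuous2 (fun x y => g y x).
Proof.
move=> cg p; apply: (@continuous_comp _ _ _ (fun p : R * R => (p.2, p.1)) (fun p => g p.1 p.2)).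
  by apply: continuous_pair; [exact: cvg_snd|exact: cvg_fst].
exact: cg.
Qed.

Lemma continuous2M g1 g2 : continuous2 g1 -> continuous2 g2 ->
  continuous2 (fun x y => g1 x y * g2 x y).
Proof. by move=> c1 c2 p; apply: continuousM; [exact: c1|exact: c2]. Qed.

Lemma continuous2D g1 g2 : continuous2 g1 -> continuous2 g2 ->
  continuous2 (fun x y => g1 x y + g2 x y).
Proof. by move=> c1 c2 p; apply: continuousD; [exact: c1|exact: c2]. Qed.

Lemma continuous2_fst (f : R -> R) : continuous f -> continuous2 (fun x _ => f x).
Proof.
move=> cf p; apply: (@continuous_comp _ _ _ fst f); first exact: cvg_fst.
exact: cf.
Qed.

Lemma continuous2_snd (f : R -> R) : continuous f -> continuous2 (fun _ y => f y).
Proof.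
move=> cf p; apply: (@continuous_comp _ _ _ snd f); first exact: cvg_snd.
exact: cf.
Qed.

Lemma continuous2_cst c : continuous2 (fun _ _ => c : R).
Proof. by move=> p; exact: cvg_cst. Qed.

Lemma angle_integral_swap g : continuous2 g ->
  angle_integral g = angle_integral (fun x y => g y x).
Proof.
move=> cg; rewrite !angle_integralE //; last exact: continuous2_swap.
have h := square_integrableT cg.
have h' := square_integrableT (continuous2_swap cg).
rewrite [LHS]Rintegral_mkcond [RHS]Rintegral_mkcond /Rintegral.
congr fine; apply: etrans (esym (integral12_prod_meas1 h)) _.
apply: etrans (integral21_prod_meas1 h').
apply: eq_integral => x _; apply: eq_integral => y _ /=.
by rewrite !patchE !in_setX /= andbC.
Qed.

Lemma eq_angle_integral g1 g2 : (forall x y, g1 x y = g2 x y) ->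
  angle_integral g1 = angle_integral g2.
Proof. by move=> e; congr angle_integral; apply/funext => x; apply/funext => y. Qed.

Lemma angle_integralD g1 g2 : continuous2 g1 -> continuous2 g2 ->
  angle_integral (fun x y => g1 x y + g2 x y) = angle_integral g1 + angle_integral g2.
Proof.
move=> c1 c2; rewrite !angle_integralE //; last exact: continuous2D.
by rewrite RintegralD //; [exact: measurable_square|exact: square_integrable..].
Qed.

Lemma angle_integralZ c g : continuous2 g ->
  angle_integral (fun x y => c * g x y) = c * angle_integral g.
Proof.
move=> cg; rewrite !angle_integralE //; last first.
  by apply: continuous2M => //; exact: continuous2_cst.
by rewrite RintegralZl //; [exact: measurable_square|exact: square_integrable].
Qed.

Lemma angle_integral_le g C : continuous2 g ->
  (forall x y, square (x, y) -> `|g x y| <= C) ->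
  `|angle_integral g| <= C * (2 * pi) ^+ 2.
Proof.
move=> cg gC; rewrite angle_integralE //.
apply: le_trans.
  apply: le_normr_Rintegral; [exact: measurable_square|exact: square_integrable].
have -> : C * (2 * pi) ^+ 2 = (\int[mu2]_(z in square) C)%R.
  by rewrite Rintegral_cst ?[X in fine X]square_measure //; exact: measurable_square.
have cn : continuous (fun z : R * R => `|g z.1 z.2|).
  by move=> z; apply: (@continuous_comp _ _ _ (fun z : R * R => g z.1 z.2) (@Num.norm R R^o));
    [exact: cg|exact: norm_continuous].
apply: le_Rintegral; [exact: measurable_square|exact: (square_integrable cn)| |].
  by apply: (@square_integrable (fun=> C)) => z; exact: cvg_cst.
by move=> [x y] sz; exact: gC.
Qed.

Lemma is_derive_angle_integral (f f' : R -> R -> R -> R) (u v a C : R) :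
  0 <= C -> u < a < v ->
  (forall t, u < t < v -> continuous2 (f t)) -> continuous2 (f' a) ->
  (forall t x y, u < t < v -> square (x, y) -> `|f t x y| <= C) ->
  (forall t x y, u < t < v -> square (x, y) -> is_derive t 1 (fun t => f t x y) (f' t x y)) ->
  (forall t x y, u < t < v -> square (x, y) -> `|f' t x y| <= C) ->
  is_derive a 1 (fun t => angle_integral (f t)) (angle_integral (f' a)).
Proof.
move=> C0 uav cf cf' fC df f'C; rewrite angle_integralE //.
have h : is_derive a 1 (fun t => (\int[mu2]_(z in square) f t z.1 z.2)%R)
   (\int[mu2]_(z in square) f' a z.1 z.2)%R.
  apply: (@is_derive_Rintegral _ _ R mu2 square (fun t z => f t z.1 z.2)
     (fun t z => f' t z.1 z.2) u v a C) => //.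
  - exact: measurable_square.
  - by rewrite [X in (X < _)%E]square_measure ltry.
  - by move=> t h; apply: measurable_funTS; apply: continuous_measurable_prod; exact: cf.
  - by move=> t [x y] h s; exact: fC.
  - by move=> t [x y] h s; exact: f'C.
apply: near_eq_is_derive h => //.
have /near_in_itvoo : a \in `]u, v[ by rewrite in_itv.
by apply: filterS => t; rewrite in_itv /= => /cf /angle_integralE.
Qed.

Lemma cvg_angle_integral_right (g : R -> R -> R -> R) (l : R -> R -> R) (a b C : R) :
  a < b -> (forall t, a < t < b -> continuous2 (g t)) -> continuous2 l ->
  (forall t x y, a < t < b -> square (x, y) -> `|g t x y| <= C) ->
  (forall x y, square (x, y) -> g t x y @[t --> a^'+] --> l x y) ->
  angle_integral (g t) @[t --> a^'+] --> angle_integral l.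
Proof.
move=> ab cg cl gC gl.
apply/cvg_at_rightP => p [pa /= pcvg].
(* Dominated convergence is for sequences: a sequence tending to a from the right is shifted by N so
   as to lie in ]a, b[. *)
have [N _ Nb] : \forall n \near \oo, p n < b by exact: (cvgr_lt a).
rewrite -(cvg_shiftn N).
have pab n : a < p (n + N)%N < b by rewrite pa /= Nb //= leq_addl.
rewrite angle_integralE //.
rewrite [X in X @ _ --> _](_ : _ = fun n =>
    (\int[mu2]_(z in square) g (p (n + N)%N) z.1 z.2)%R); last first.
  by apply/funext => n /=; rewrite angle_integralE //; exact: cg.
have C0 : 0 <= C.
  apply: le_trans (gC (p (0 + N)%N) 0 0 (pab _) _); first exact: normr_ge0.
  by split; rewrite /= in_itv /= pi_ge0 andbT oppr_le0 pi_ge0.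
apply: fine_cvg; rewrite fineK; last first.
  apply: integrable_fin_num; [exact: measurable_square|exact: square_integrable].
apply: (@dominated_cvg _ _ _ mu2 _ _ (fun n z => (g (p (n + N)%N) z.1 z.2)%:E) _
   (fun=> C%:E)) => //=.
- exact: measurable_square.
- move=> n; apply/measurable_EFinP; apply: measurable_funTS.
  by apply: continuous_measurable_prod; exact: cg.
- move=> [x y] sz; apply: cvg_EFin; first exact: nearW.
  have := gl x y sz; move/cvg_at_rightP; apply; split; first by move=> n; exact: pa.
  by rewrite (cvg_shiftn N).
- by apply: (@square_integrable (fun=> C)) => z; exact: cvg_cst.
- by move=> n [x y] sz; rewrite lee_fin gC.
Qed.

End square_integral.

(** * Three-term recurrences *)

(** If D M0 were positive, D would grow geometrically. Bernoulli's inequality, cubed, already makes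
    it grow like n^3, against the bound of order n^2. *)
Lemma poly_growth_contra (R : realType) (D : nat -> R) (d C : R) (M0 : nat) :
  0 < d -> (forall n, (M0 <= n)%N -> (1 + d) * D n <= D n.+1) ->
  (forall n, D n <= C * n.+1%:R ^+ 2) -> D M0 <= 0.
Proof.
move=> d0 Dg DC; rewrite leNgt; apply/negP => D0.
have grow n : (1 + d) ^+ n * D M0 <= D (M0 + n)%N.
  elim: n => [|n IH]; first by rewrite expr0 mul1r addn0.
  rewrite exprS -mulrA addnS (le_trans _ (Dg _ _)) ?leq_addr//.
  by rewrite ler_pM2l // addr_gt0.
have bern n : 1 + n%:R * d <= (1 + d) ^+ n.
  elim: n => [|n IH]; first by rewrite expr0 mul0r addr0.
  have h : (1 + d) * (1 + n%:R * d) <= (1 + d) ^+ n.+1.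
    by rewrite exprS ler_wpM2l // addr_ge0 // ltW.
  apply: le_trans h; have : 0 <= d * (n%:R * d).
    by rewrite !mulr_ge0 ?(ltW d0).
  rewrite -natr1; lra.
have C0 : 0 < C.
  have := lt_le_trans D0 (DC M0).
  by rewrite pmulr_lgt0 // exprn_gt0.
have key n : n.+1%:R * (d ^+ 3 * D M0) <= C * (M0%:R + 4) ^+ 2.
  have h1 := le_trans (grow (n.+1 * 3)%N) (DC _).
  have h2 : (n.+1%:R * d) ^+ 3 <= (1 + d) ^+ (n.+1 * 3).
    rewrite exprM lerXn2r ?nnegrE ?mulr_ge0 ?exprn_ge0 ?addr_ge0 ?ler0n ?(ltW d0) //.
    by apply: le_trans (bern _); rewrite lerDr.
  have h3 : (M0 + n.+1 * 3).+1%:R <= n.+1%:R * (M0%:R + 4) :> R.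
    rewrite -[4]/(4%:R) -natrD -natrM ler_nat; nia.
  have h4 : (n.+1%:R * d) ^+ 3 * D M0 <= C * (n.+1%:R * (M0%:R + 4)) ^+ 2.
    apply: le_trans (ler_wpM2r (ltW D0) h2) _; apply: le_trans h1 _.
    by rewrite ler_wpM2l ?(ltW C0) // lerXn2r ?nnegrE ?mulr_ge0 ?addr_ge0 ?ler0n.
  have n2 : 0 < n.+1%:R ^+ 2 :> R by rewrite exprn_gt0.
  rewrite -(ler_pM2l n2); apply: le_trans (_ : _ <= (n.+1%:R * d) ^+ 3 * D M0) _.
    by rewrite le_eqVlt; apply/orP; left; apply/eqP; ring.
  by apply: le_trans h4 _; rewrite le_eqVlt; apply/orP; left; apply/eqP; ring.
have p0 : 0 < d ^+ 3 * D M0 by rewrite mulr_gt0 // exprn_gt0.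
have [n nP] : exists n : nat, C * (M0%:R + 4) ^+ 2 / (d ^+ 3 * D M0) < n%:R.
  by eexists; exact: truncnS_gt.
have := key n; rewrite leNgt => /negP; apply.
rewrite -ltr_pdivrMr //; apply: lt_trans nP _; by rewrite ltr_nat.
Qed.

(** The right-hand sides telescope when summed: for the partial sums S of y, the excess (t - 1) (S -
    K) is at most half of the next term of y. So S - K would grow by a factor 1 + 2 (t - 1) at each
    step once positive, while S is at most quadratic. *)
Lemma summable_of_diag_dominance (R : realType) (y be : nat -> R) (t C B : R)
    (N : nat) :
  1 < t -> (forall n, 0 <= y n) -> (forall n, y n <= C * n.+1%:R) ->
  (forall n, 0 <= be n) -> (forall n, \sum_(0 <= i < n) be i <= B) ->
  (forall n, (N <= n)%N -> t * y n.+1 <= (y n + y n.+2) / 2 + be n.+1) ->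
  exists K, forall n, \sum_(0 <= i < n) y i <= K.
Proof.
move=> t1 y0 yC be0 beB rec.
pose S n := \sum_(0 <= i < n) y i.
have SS n : S n.+1 = S n + y n by rewrite /S big_nat_recr.
have Sm n k : S n <= S (n + k)%N.
  elim: k => [|k IH]; first by rewrite addn0.
  by rewrite addnS SS (le_trans IH) // lerDl.
have B0 : 0 <= B by have := beB 0%N; rewrite big_geq.
have C0 : 0 <= C by have := le_trans (y0 0%N) (yC 0%N); rewrite mulr1.
have Ssum k : (t - 1) * (S (N + k).+1 - S N.+1) <= (y N + y (N + k).+1 - y (N + k)%N) / 2
   + \sum_(N.+1 <= i < (N + k).+1) be i.
  elim: k => [|k IH].
    by rewrite addn0 subrr mulr0 big_geq // addr0 divr_ge0 // addrAC subrr add0r.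
  rewrite addnS SS big_nat_recr /=; last by rewrite ltnS leq_addr.
  have := rec (N + k)%N (leq_addr _ _).
  move: IH; set s := \sum_(_ <= _ < _) _.
  set a := S _; set b := S _; move: (y _) (y _) (y _) (y _) (be _) => p q r u v.
  lra.
have Ssum' k : (t - 1) * (S (N + k).+1 - S N.+1) <= (y N + y (N + k).+1) / 2 + B.
  apply: le_trans (Ssum k) _; apply: lerD.
    by rewrite ler_pM2r ?invr_gt0 // gerBl.
  rewrite (le_trans _ (beB (N + k).+1)) //.
  rewrite [leRHS](big_cat_nat (n := N.+1)) //= ?ltnS ?leq_addr // lerDr.
  by apply: sumr_ge0 => i _; exact: be0.
(* Chosen so that [Ssum'] reads (t - 1) (S n.+1 - K) <= y n.+1 / 2. *)
pose K := S N.+1 + (y N / 2 + B) / (t - 1).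
exists K => n; suff : S (n + N).+1 - K <= 0.
  rewrite subr_le0 => h; apply: le_trans h; rewrite -addnS; exact: Sm.
have t10 : 0 < t - 1 by rewrite subr_gt0.
apply: (@poly_growth_contra R (fun n => S n.+1 - K) (2 * (t - 1))
   (C + `|K|) (n + N)%N).
- by rewrite mulr_gt0.
- move=> k /(leq_trans (leq_addl _ _)) Nk.
  have := Ssum' (k - N)%N; rewrite subnKC // => h.
  have E : (t - 1) * (S k.+1 - K) =
     (t - 1) * (S k.+1 - S N.+1) - (y N / 2 + B).
    by rewrite /K; field; rewrite gt_eqF.
  rewrite (SS k.+1); clearbody K; lra.
- move=> k.
  have Sb : forall j, S j <= C * j%:R ^+ 2.
    elim=> [|j IH]; first by rewrite /S big_geq // expr0n mulr0.
    rewrite SS; apply: le_trans (lerD IH (yC j)) _.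
    rewrite -mulrDr ler_wpM2l // -!natrX -natrD ler_nat; nia.
  apply: le_trans (_ : C * k.+1%:R ^+ 2 + `|K| <= _).
    by rewrite lerD // (le_trans (ler_norm _)) // normrN.
  rewrite mulrDl lerD2l ler_peMr // -natrX ler1n; nia.
Qed.

(** The squared norm of cos (n x) on [-pi, pi], divided by pi. *)
Definition neumann_weight (R : realType) (n : nat) : R := if n is 0%N then 2 else 1.

(* The system [algebraic_solution] rewritten with L n = - q_{n,m}' / q_{n,m},
   so that rho, sigma and tau are affine in L. *)
Definition three_term (R : realType) (t s : R) (L : nat -> R) (n0 : nat)
    (b a : nat -> R) : Prop :=
  b n0 = s / 2 * a n0 - t * (L n0 * a n0) + (L n0.+1 * a n0.+1) / 2 /\
  forall n, (n0 < n)%N -> b n = s / 2 * a n - t * (L n * a n) +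
    (neumann_weight R n.-1 * (L n.-1 * a n.-1) + L n.+1 * a n.+1) / 2.

Lemma three_term_lin (R : realType) (t s : R) L n0 (b1 b2 a1 a2 : nat -> R) (c : R) :
  three_term t s L n0 b1 a1 -> three_term t s L n0 b2 a2 ->
  three_term t s L n0 (fun n => b1 n + c * b2 n) (fun n => a1 n + c * a2 n).
Proof.
move=> [e1 r1] [e2 r2]; split; first by rewrite e1 e2; ring.
by move=> n h; rewrite (r1 n h) (r2 n h); ring.
Qed.

Lemma three_term_unique (R : realType) (t s : R) L n0 (b a1 a2 : nat -> R) :
  (forall n, 0 < L n) ->
  three_term t s L n0 b a1 -> three_term t s L n0 b a2 -> a1 n0 = a2 n0 ->
  forall n, (n0 <= n)%N -> a1 n = a2 n.
Proof.
move=> L0 [e1 r1] [e2 r2] e0.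
have cancel n (x y z : R) : z + L n * x / 2 = z + L n * y / 2 -> x = y.
  move/addrI => h; apply: (@mulfI _ (L n / 2)).
    by rewrite mulf_neq0 ?gt_eqF // invr_gt0.
  by rewrite mulrAC h mulrAC.
suff h n : a1 (n0 + n)%N = a2 (n0 + n)%N /\ a1 (n0 + n).+1 = a2 (n0 + n).+1.
  by move=> n /subnKC <-; exact: (h _).1.
elim: n => [|n [h1 h2]].
  rewrite addn0; split => //.
  by move: e1 e2; rewrite e0 => -> /cancel.
rewrite addnS; split => //.
have lt0 : (n0 < (n0 + n).+1)%N by rewrite ltnS leq_addr.
have := r1 _ lt0; rewrite (r2 _ lt0) /= h1 h2 !mulrDl !addrA => /cancel h; exact/esym.
Qed.

(** The Casoratian satisfies W (n+1) = w W n + D (n+1) Y (n+1) P (n+1) with w >= 1 and D >= 0.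
    Positivity of Y and monotonicity of W are proved together, each giving the next instance of the
    other. *)
Lemma homogeneous_growth (R : realType) (t s : R) (L L0 y p : nat -> R) (n0 : nat)
    (K : R) :
  0 < s -> (n0 <= 1)%N -> (forall n, 0 < L0 n) -> (forall n, L0 n <= L n) ->
  (n0 = 1%N \/ L0 0%N < L 0%N) ->
  (forall n, 0 < p n) -> three_term t s L0 0 (fun=> 0) p ->
  three_term t s L n0 (fun=> 0) y -> 0 < y n0 ->
  (forall n, L n.+1 * (L0 n * p n) <= K) ->
  exists2 c, 0 < c & forall n, (n0 < n)%N -> c <= y n.
Proof.
move=> s0 n01 L00 LL hn0 p0 [p1 pr] [y1 yr] yn0 LK.
have Lp n : 0 < L n by apply: lt_le_trans (LL n).
pose Y n := L n * y n; pose P n := L0 n * p n.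
have P0 n : 0 < P n by rewrite mulr_gt0.
(* For the products Y = L y and P = L0 p the recurrences have leading coefficient 1 and differ only
   through s / L and s / L0. *)
pose W n := Y n.+1 * P n - Y n * P n.+1.
pose D n := s / L0 n - s / L n.
have D0 n : 0 <= D n.
  by rewrite subr_ge0 ler_pM2l // lef_pV2 ?posrE.
have aE (M : nat -> R) (z : nat -> R) n : 0 < M n -> z n = (M n * z n) / M n.
  by move=> h; rewrite mulrAC divff ?mul1r // gt_eqF.
have Y1 : Y n0.+1 = (2 * t - s / L n0) * Y n0.
  move: y1; rewrite {1}(aE L y n0) // -/(Y n0) -/(Y n0.+1) => /(congr1 ( *%R 2)).
  rewrite mulr0 => h; apply/eqP; rewrite -subr_eq0; apply/eqP.
  by rewrite [RHS]h; field; rewrite gt_eqF.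
have Yr n : (n0 < n)%N ->
   Y n.+1 = (2 * t - s / L n) * Y n - neumann_weight R n.-1 * Y n.-1.
  move=> /yr; rewrite {1}(aE L y n) // -/(Y n) -/(Y n.+1) -/(Y n.-1).
  move=> /(congr1 ( *%R 2)).
  rewrite mulr0 => h; apply/eqP; rewrite -subr_eq0; apply/eqP.
  by rewrite [RHS]h; field; rewrite gt_eqF.
have P1 : P 1%N = (2 * t - s / L0 0%N) * P 0%N.
  move: p1; rewrite {1}(aE L0 p 0%N) // -/(P 0%N) -/(P 1%N) => /(congr1 ( *%R 2)).
  rewrite mulr0 => h; apply/eqP; rewrite -subr_eq0; apply/eqP.
  by rewrite [RHS]h; field; rewrite gt_eqF.
have Pr n : (0 < n)%N ->
   P n.+1 = (2 * t - s / L0 n) * P n - neumann_weight R n.-1 * P n.-1.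
  move=> /pr; rewrite {1}(aE L0 p n) // -/(P n) -/(P n.+1) -/(P n.-1).
  move=> /(congr1 ( *%R 2)).
  rewrite mulr0 => h; apply/eqP; rewrite -subr_eq0; apply/eqP.
  by rewrite [RHS]h; field; rewrite gt_eqF.
have Yn0 : 0 < Y n0 by rewrite mulr_gt0.
(* For n0 = 0 strictness comes from L0 0 < L 0; for n0 = 1 it comes from the term 2 P 0, which has
   no counterpart in the recurrence of Y at its first index. *)
have Wn0 : 0 < W n0.
  rewrite /W Y1; case: n0 n01 hn0 {yn0 y1 yr Y1 Yr} Yn0 => [|[|//]] _ h Yn0.
    case: h => // h; rewrite P1.
    have -> : (2 * t - s / L 0%N) * Y 0%N * P 0%N -
      Y 0%N * ((2 * t - s / L0 0%N) * P 0%N) = D 0%N * (Y 0%N * P 0%N).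
      by rewrite /D; ring.
    rewrite mulr_gt0 //; last by rewrite mulr_gt0.
    by rewrite subr_gt0 ltr_pM2l // ltf_pV2 ?posrE.
  rewrite (Pr 1%N) //=.
  have -> : (2 * t - s / L 1%N) * Y 1%N * P 1%N -
      Y 1%N * ((2 * t - s / L0 1%N) * P 1%N - 2 * P 0%N) =
      D 1%N * (Y 1%N * P 1%N) + Y 1%N * (2 * P 0%N).
    by rewrite /D; ring.
  apply: ltr_wpDl; first by rewrite mulr_ge0 // mulr_ge0 // ltW.
  by rewrite mulr_gt0 // mulr_gt0.
have ind n : 0 < Y (n0 + n)%N /\ W n0 <= W (n0 + n)%N.
  elim: n => [|n [IY IW]]; first by rewrite addn0.
  have W0 := lt_le_trans Wn0 IW.
  have Y0 : 0 < Y (n0 + n).+1.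
    rewrite -(pmulr_lgt0 _ (P0 (n0 + n)%N)).
    have -> : Y (n0 + n).+1 * P (n0 + n)%N =
      W (n0 + n)%N + Y (n0 + n)%N * P (n0 + n).+1 by rewrite /W; ring.
    by rewrite addr_gt0 // mulr_gt0.
  rewrite addnS; split => //; apply: (le_trans IW).
  rewrite {2}/W Yr ?ltnS ?leq_addr // (Pr (n0 + n).+1) //=.
  set k := (n0 + n)%N.
  have -> : ((2 * t - s / L k.+1) * Y k.+1 - neumann_weight R k * Y k) * P k.+1 -
    Y k.+1 * ((2 * t - s / L0 k.+1) * P k.+1 - neumann_weight R k * P k) =
    D k.+1 * (Y k.+1 * P k.+1) + neumann_weight R k * W k by rewrite /D /W; ring.
  apply: (@le_trans _ _ (neumann_weight R k * W k)).
    by rewrite ler_peMl ?(ltW W0) // /neumann_weight; case: (k) => //; rewrite ler1n.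
  by rewrite lerDr mulr_ge0 // mulr_ge0 // ltW.
have K0 : 0 < K by apply: lt_le_trans (LK 0%N); apply: mulr_gt0 => //; exact: mulr_gt0.
(* W n0 <= Y k.+1 * P k = y k.+1 * (L k.+1 * P k) <= K * y k.+1. *)
exists (W n0 / K); first by rewrite divr_gt0.
case=> // n; rewrite ltnS => /subnKC <-.
have [IY IW] := ind (n - n0)%N; set k := (n0 + _)%N in IY IW *.
have h : W n0 <= Y k.+1 * P k.
  apply: le_trans IW _; rewrite /W gerBl.
  by rewrite mulr_ge0 // ltW.
have y0 : 0 <= y k.+1.
  have : 0 < Y k.+1 * P k by apply: lt_le_trans h.
  by rewrite pmulr_lgt0 // pmulr_rgt0 // => /ltW.
rewrite ler_pdivrMr //; apply: le_trans h _.
rewrite /Y /P [L _ * y _]mulrC -mulrA; exact: ler_wpM2l.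
Qed.

(** Absolute values in the recurrence give, for y = L |a|, the inequality of
    [summable_of_diag_dominance] with t lowered to (1 + t) / 2; the margin absorbs the term s / 2 *
    a because L tends to infinity. [M] is at once a bound of [a] and the offset in the lower bound
    of [L]. *)
Lemma three_term_summable (R : realType) (t s : R) (L b a : nat -> R) (n0 : nat)
    (C c M B : R) :
  1 < t -> 0 < s -> (forall n, 0 < L n) -> (forall n, L n <= C * n.+1%:R) ->
  0 < c -> (forall n, c * n%:R - M <= L n) ->
  (forall n, `|a n| <= M) -> three_term t s L n0 b a ->
  (forall n, \sum_(n0 <= i < n) `|b i| <= B) ->
  exists K, forall n, \sum_(n0 <= i < n) `|a i| <= K.
Proof.
move=> t1 s0 L0 LC c0 cL aM [_ rec] bB.
pose y n := if (n0 <= n)%N then L n * `|a n| else 0.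
have y0 n : 0 <= y n by rewrite /y; case: ifP => // _; rewrite mulr_ge0 // ltW.
have M0 : 0 <= M by apply: le_trans (aM 0%N).
have C0 : 0 <= C by have := ltW (lt_le_trans (L0 0%N) (LC 0%N)); rewrite mulr1.
pose t' := (1 + t) / 2.
have t'1 : 1 < t' by rewrite /t'; lra.
(* beyond N the perturbation s / (2 L n) is below t - t' *)
have [N NP] : exists N : nat, (M + s / (t - 1) + 1) / c < N%:R.
  by eexists; exact: truncnS_gt.
have LN n : (N <= n)%N -> s / (t - 1) < L n.
  move=> Nn; apply: lt_le_trans (cL n).
  rewrite ltrBrDr; apply: (@lt_le_trans _ _ (M + s / (t - 1) + 1)); first by lra.
  rewrite [c * _]mulrC -ler_pdivrMr //; apply: ltW; apply: (lt_le_trans NP).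
  by rewrite ler_nat.
have [K KP] : exists K, forall n, \sum_(0 <= i < n) y i <= K.
  apply: (@summable_of_diag_dominance R y
     (fun n => if (n0 <= n)%N then `|b n| else 0) t' (C * M) B (maxn n0 N.+1)) => //.
  - move=> n; rewrite /y; case: ifP => _; last by rewrite !mulr_ge0.
    rewrite [leRHS]mulrAC ler_pM // ltW //.
  - by move=> n; case: ifP.
  - move=> n; rewrite -big_mkcond /=; apply: le_trans (bB n).
    have [n0n|/ltnW nn0] := leqP n0 n.
      rewrite (big_cat_nat (n := n0)) //= big_nat_cond big1 ?add0r; last first.
        by move=> i /andP[/andP[_]]; rewrite ltnNge => /negbTE ->.
      by rewrite big_mkcond /= ler_sum // => i _; case: ifP.
    rewrite big_nat_cond big1 ?sumr_ge0 // => i /andP[/andP[_ h1]] h2.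
    by move: (leq_trans h1 nn0); rewrite ltnNge h2.
  - case=> [|n]; rewrite geq_max => /andP[n0n Nn] //.
    have n0n1 : (n0 <= n.+2)%N by apply: leqW.
    rewrite /y n0n n0n1 leqW //.
    have /= bE := rec n.+2 n0n; rewrite mul1r in bE.
    have LNn : s / (t - 1) < L n.+2 by apply: LN; rewrite !leqW.
    have e : t * (L n.+2 * a n.+2) - s / 2 * a n.+2 =
       (L n.+1 * a n.+1 + L n.+3 * a n.+3) / 2 - b n.+2 by rewrite bE; ring.
    have : `|t * (L n.+2 * a n.+2) - s / 2 * a n.+2| <=
       (L n.+1 * `|a n.+1| + L n.+3 * `|a n.+3|) / 2 + `|b n.+2|.
      rewrite e; apply: (le_trans (ler_normB _ _)); rewrite lerD2r.
      rewrite normrM (gtr0_norm (_ : 0 < 2^-1)) ?invr_gt0 // ler_pM2r ?invr_gt0 //.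
      by apply: (le_trans (ler_normD _ _)); rewrite !normrM !(gtr0_norm (L0 _)).
    apply: le_trans.
    have -> : t * (L n.+2 * a n.+2) - s / 2 * a n.+2 = (t * L n.+2 - s / 2) * a n.+2.
      by ring.
    rewrite normrM mulrA; apply: ler_wpM2r => //; apply: le_trans (ler_norm _).
    move: LNn; rewrite ltr_pdivrMr ?subr_gt0 // /t' => LNn.
    lra.
have c'0 : 0 < s / (t - 1) by rewrite divr_gt0 // subr_gt0.
(* Beyond N, L i > s / (t - 1), hence |a i| <= y i / (s / (t - 1)). *)
exists (\sum_(n0 <= i < maxn n0 N) `|a i| + K / (s / (t - 1))) => n.
have [nN|/ltnW Nn] := leqP n (maxn n0 N).
  apply: (@le_trans _ _ (\sum_(n0 <= i < maxn n0 N) `|a i|)).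
    have [n0n|/ltnW nn0] := leqP n0 n; last by rewrite big_geq // sumr_ge0.
    by rewrite [leRHS](big_cat_nat (n := n)) //= lerDl sumr_ge0.
  rewrite lerDl divr_ge0 // ?(ltW c'0) //.
  by apply: le_trans (KP 0%N); rewrite big_geq.
rewrite (big_cat_nat (n := maxn n0 N)) ?leq_maxl //= lerD2l.
rewrite ler_pdivlMr // mulr_suml; apply: le_trans (KP n).
rewrite [leRHS](big_cat_nat (n := maxn n0 N)) //=.
apply: ler_wpDl; first exact: sumr_ge0.
apply: ler_sum_nat => i; rewrite geq_max => /andP[/andP[h1 h2] _].
rewrite /y h1 mulrC ler_wpM2r // ltW // LN //.
Qed.

(** * Legendre functions of the second kind *)

(* The integrand of [legendreQ] after the substitution s = sin x. *)
HB.lock Definition jterm {R : realType} (n : nat) (a t x : R) : R :=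
  cos x ^+ n.*2 * (t - sin x) `^ (- a).

(** For k = n - 1/2 the substitution turns (1 - s^2)^k ds into the even power cos x ^ 2n dx: the
    endpoint singularity present for n = 0 disappears, and derivatives and integrations by parts
    take place on a closed segment with continuous integrands. *)
HB.lock Definition legendreJ {R : realType} (n : nat) (a t : R) : R :=
  \int[lebesgue_measure]_(x in `[- (pi / 2), pi / 2]) jterm n a t x.

Section legendre_integral.
Context {R : realType}.
Notation mu := (@lebesgue_measure R).
Implicit Types (n m : nat) (a t x : R).

Let jtermE n a t x : jterm n a t x = cos x ^+ n.*2 * (t - sin x) `^ (- a).
Proof. by rewrite jterm.unlock. Qed.

Let legendreJ_def n a t : legendreJ n a t =
  \int[mu]_(x in `[- (pi / 2), pi / 2]) jterm n a t x.
Proof. by rewrite legendreJ.unlock. Qed.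

Lemma segment_measure (a b : R) : a < b -> mu `[a, b]%classic = (b - a)%:E.
Proof. by move=> ab; rewrite lebesgue_measure_itv /= lte_fin ab EFinB. Qed.

Lemma segment_measure_lty (a b : R) : (mu `[a, b]%classic < +oo)%E.
Proof.
by rewrite lebesgue_measure_itv /=; case: ifP => _; rewrite ?ltry // -EFinB ltry.
Qed.

Lemma subr_sin_gt0 t x : 1 < t -> 0 < t - sin x.
Proof. by move=> t1; rewrite subr_gt0 (le_lt_trans (sin_le1 x)). Qed.

Lemma is_derive_expr (f : R -> R) n x df : is_derive x 1 f df ->
  is_derive x 1 (fun y => f y ^+ n) (n%:R * f x ^+ n.-1 * df).
Proof.
move=> h; have -> : (fun y => f y ^+ n) = f ^+ n.
  by apply/funext => y; rewrite exprfctE.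
by apply: is_derive_eq.
Qed.

Lemma is_derive_powR_comp (f : R -> R) (df p x : R) : 0 < f x -> is_derive x 1 f df ->
  is_derive x 1 (fun y => f y `^ p) (p * f x `^ (p - 1) * df).
Proof.
move=> f0 hf.
have hp := is_derive1_powR p f0.
exact: (@is_derive1_comp R (fun y => y `^ p) f x).
Qed.

Lemma is_derive_continuous (f : R -> R) (x df : R) :
  is_derive x 1 f df -> {for x, continuous f}.
Proof. by case=> h _; apply/differentiable_continuous/derivable1_diffP. Qed.

Lemma is_derive_jterm_var n a t x : 1 < t ->
  is_derive t 1 (fun t => jterm n a t x) (- a * jterm n (a + 1) t x).
Proof.
move=> t1.
have h : is_derive t 1 (fun t => t - sin x) 1.
  by apply: is_derive_eq; rewrite subr0.
have h' := @is_derive_powR_comp (fun t => t - sin x) 1 (- a) t (subr_sin_gt0 x t1) h.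
rewrite jterm.unlock; apply: is_derive_eq.
by rewrite mulr1 opprD /GRing.scale /=; ring.
Qed.

Lemma is_derive_powR_sin a t x : 1 < t ->
  is_derive x 1 (fun x => (t - sin x) `^ a) (- a * cos x * (t - sin x) `^ (a - 1)).
Proof.
move=> t1.
have h : is_derive x 1 (fun x => t - sin x) (- cos x).
  by apply: is_derive_eq; rewrite /GRing.scale /=; ring.
have h' := @is_derive_powR_comp (fun x => t - sin x) _ a x (subr_sin_gt0 x t1) h.
by apply: is_derive_eq; ring.
Qed.

Lemma continuous_jterm n a t : 1 < t -> continuous (jterm n a t).
Proof.
move=> t1 x; rewrite jterm.unlock; apply: (@continuousM _ _ (fun x => cos x ^+ n.*2)).
  by apply: (@continuous_comp _ _ _ cos (fun y => y ^+ n.*2));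
    [exact: continuous_cos|exact: exprn_continuous].
exact: (is_derive_continuous (is_derive_powR_sin _ x t1)).
Qed.

Lemma jterm_ge0 n a t x : 0 <= jterm n a t x.
Proof. by rewrite jtermE mulr_ge0 ?powR_ge0 // -mul2n exprM exprn_ge0 // sqr_ge0. Qed.

Lemma jterm_shift n a t x : 1 < t -> jterm n a t x = (t - sin x) * jterm n (a + 1) t x.
Proof.
move=> t1; have h := subr_sin_gt0 x t1.
rewrite !jtermE mulrCA; congr (_ * _).
have -> : - a = 1 + - (a + 1) by ring.
by rewrite powRD ?(gt_eqF h) ?implybT // powRr1 // ltW.
Qed.

Lemma jterm_integrable n a t : 1 < t ->
  mu.-integrable `[- (pi / 2), pi / 2] (EFin \o jterm n a t).
Proof. by move=> t1; apply: segment_integrable; exact: continuous_jterm. Qed.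

Lemma powR_neg_le (p y z : R) : 0 <= p -> 0 < y -> y <= z -> z `^ (- p) <= y `^ (- p).
Proof.
move=> p0 y0 yz; rewrite !powRN lef_pV2 ?posrE ?powR_gt0 ?(lt_le_trans y0 yz) //.
by apply: ge0_ler_powR => //; rewrite nnegrE ltW // (lt_le_trans y0 yz).
Qed.

(** The sign of p is left open, so the larger of the two end values is replaced by their sum. *)
Lemma powR_between (p x y z : R) : 0 < x -> x <= y -> y <= z ->
  y `^ p <= x `^ p + z `^ p.
Proof.
move=> x0 xy yz; have y0 := lt_le_trans x0 xy; have z0 := lt_le_trans y0 yz.
have [p0|p0] := leP 0 p.
  apply: (@le_trans _ _ (z `^ p)); last by rewrite lerDr powR_ge0.
  by apply: ge0_ler_powR; rewrite ?nnegrE // ltW.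
apply: (@le_trans _ _ (x `^ p)); last by rewrite lerDl powR_ge0.
by rewrite -[p]opprK; apply: powR_neg_le; rewrite // oppr_ge0 ltW.
Qed.

Lemma is_derive_legendreJ n a t : 1 < t ->
  is_derive t 1 (legendreJ n a) (- a * legendreJ n (a + 1) t).
Proof.
move=> t1; rewrite legendreJ.unlock.
have -> : - a * \int[mu]_(x in `[- (pi / 2), pi / 2]) jterm n (a + 1) t x =
   \int[mu]_(x in `[- (pi / 2), pi / 2]) (- a * jterm n (a + 1) t x).
  by rewrite RintegralZl // jterm_integrable.
(* On ]u, t + 1[ the base s - sin x stays in [u - 1, t + 2], away from 0. *)
pose u := (1 + t) / 2.
have u1 : 1 < u by rewrite /u; lra.
have ut : u < t < t + 1 by rewrite /u ltrDl ltr01 andbT; lra.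
pose B a := (u - 1) `^ (- a) + (t + 2) `^ (- a).
have B0 c : 0 <= B c by rewrite addr_ge0 ?powR_ge0.
have jB c s x : u < s < t + 1 -> `|jterm n c s x| <= B c.
  move=> /andP[us st]; rewrite ger0_norm ?jterm_ge0 // jtermE.
  have h : (s - sin x) `^ (- c) <= B c.
    have h1 := sin_le1 x; have h2 := sin_geN1 x.
    by apply: powR_between; lra.
  rewrite -[leRHS]mul1r; apply: ler_pM; rewrite ?powR_ge0 //.
  by rewrite -mul2n exprM exprn_ge0 // sqr_ge0.
pose C := B a + `|a| * B (a + 1).
have C0 : 0 <= C by rewrite addr_ge0 ?mulr_ge0.
apply: (@is_derive_Rintegral _ _ R mu `[- (pi / 2), pi / 2] (jterm n a)
  (fun t x => - a * jterm n (a + 1) t x) u (t + 1) t C) => //.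
- exact: segment_measure_lty.
- move=> s /andP[us _]; apply: measurable_funTS; apply: continuous_measurable_fun.
  by apply: continuous_jterm; exact: lt_trans us.
- by move=> s x us _; rewrite (le_trans (jB _ _ _ us)) // lerDl mulr_ge0.
- by move=> s x /andP[us _] _; apply: is_derive_jterm_var; exact: lt_trans us.
- move=> s x us _; rewrite normrM normrN.
  apply: (@le_trans _ _ (`|a| * B (a + 1))); last by rewrite lerDr.
  by apply: ler_wpM2l => //; exact: jB.
Qed.

(** 1 - sin^2 expanded in powers of r = t - sin x: it equals (1 - t^2) + 2 t r - r^2. *)
Lemma legendreJ_cos2 n a t : 1 < t ->
  legendreJ n.+1 a t = (1 - t ^+ 2) * legendreJ n a t + 2 * t * legendreJ n (a - 1) t
    - legendreJ n (a - 2) t.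
Proof.
move=> t1; rewrite !legendreJ_def.
rewrite -!RintegralZl ?jterm_integrable //.
have cZ c b : continuous (fun x => c * jterm n b t x).
  by move=> x; apply: cvgM; [exact: cvg_cst|exact: continuous_jterm].
rewrite -RintegralD //; [|exact: segment_integrable..].
have cD : continuous (fun x => (1 - t ^+ 2) * jterm n a t x + 2 * t * jterm n (a - 1) t x).
  by move=> x; apply: cvgD; exact: cZ.
rewrite -RintegralB //; [|apply: segment_integrable; exact: cD|exact: jterm_integrable].
apply: eq_Rintegral => x _.
have e1 := jterm_shift n (a - 1) x t1; rewrite subrK in e1.
have e2 := jterm_shift n (a - 2) x t1.
rewrite (_ : a - 2 + 1 = a - 1) ?e1 in e2; last by ring.
rewrite e2 e1 !jtermE doubleS 2!exprS.
have -> : cos x * (cos x * cos x ^+ n.*2) = cos x ^+ 2 * cos x ^+ n.*2 by ring.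
rewrite cos2sin2; ring.
Qed.

(** The function cos x ^ (2n+1) * (t - sin x) ^ (-a) vanishes at both ends, so its derivative has
    integral zero. *)
Lemma legendreJ_by_parts n a t : 1 < t ->
  (n.*2.+1)%:R * (t * legendreJ n a t - legendreJ n (a - 1) t) =
  a * legendreJ n.+1 (a + 1) t.
Proof.
move=> t1.
pose F x := cos x ^+ n.*2.+1 * (t - sin x) `^ (- a).
pose f x := a * jterm n.+1 (a + 1) t x -
   (n.*2.+1)%:R * (t * jterm n a t x - jterm n (a - 1) t x).
have dF x : is_derive x 1 F (f x).
  have h := is_derive_powR_sin (- a) x t1.
  have h' : is_derive x 1 (fun x => cos x ^+ n.*2.+1)
      (n.*2.+1%:R * cos x ^+ n.*2 * - sin x).
    exact: is_derive_expr (is_derive_cos x).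
  rewrite /F; apply: is_derive_eq.
  have e := jterm_shift n (a - 1) x t1; rewrite subrK in e.
  by rewrite /f e !jtermE doubleS !exprS /GRing.scale /= !opprD opprK; ring.
have cf : continuous f.
  move=> x; apply: cvgB; first by apply: cvgM; [exact: cvg_cst|exact: continuous_jterm].
  apply: cvgM; first exact: cvg_cst.
  apply: cvgB; last exact: continuous_jterm.
  by apply: cvgM; [exact: cvg_cst|exact: continuous_jterm].
have p0 : - (pi / 2) < pi / 2 :> R by rewrite gtrN // divr_gt0 // pi_gt0.
have : (\int[mu]_(x in `[(- (pi / 2))%R, (pi / 2)%R]) (f x)%:E = 0)%E.
  rewrite (continuous_FTC2 (F := F) p0).
  - by rewrite /F cosN cos_pihalf expr0n !mul0r subee.
  - exact: continuous_subspaceT.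
  - split.
    + by move=> x _; case: (dF x).
    + by apply: cvg_at_right_filter; exact: (is_derive_continuous (dF _)).
    + by apply: cvg_at_left_filter; exact: (is_derive_continuous (dF _)).
  - by move=> x _; rewrite derive1E; case: (dF x).
move=> /(congr1 fine) /=; rewrite -/(Rintegral mu _ f).
rewrite !legendreJ_def.
rewrite /f RintegralB //; last 2 first.
- by apply: segment_integrable => x; apply: cvgM; [exact: cvg_cst|exact: continuous_jterm].
- apply: segment_integrable => x; apply: cvgM; first exact: cvg_cst.
  apply: cvgB; last exact: continuous_jterm.
  by apply: cvgM; [exact: cvg_cst|exact: continuous_jterm].
rewrite !RintegralZl //; last 2 first.
- apply: segment_integrable => x.
  apply: cvgB; last exact: continuous_jterm.
  by apply: cvgM; [exact: cvg_cst|exact: continuous_jterm].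
- exact: jterm_integrable.
rewrite RintegralB //; last 2 first.
- by apply: segment_integrable => x; apply: cvgM; [exact: cvg_cst|exact: continuous_jterm].
- exact: jterm_integrable.
rewrite RintegralZl ?jterm_integrable // => /eqP.
by rewrite subr_eq0 => /eqP ->.
Qed.

Lemma legendreJ_le n n' a a' t c : 1 < t ->
  (forall x, jterm n a t x <= c * jterm n' a' t x) ->
  legendreJ n a t <= c * legendreJ n' a' t.
Proof.
move=> t1 h; rewrite !legendreJ_def -RintegralZl ?jterm_integrable //.
apply: le_Rintegral => //; first exact: jterm_integrable.
apply: segment_integrable => x.
by apply: cvgM; [exact: cvg_cst|exact: continuous_jterm].
Qed.

Lemma legendreJ_gt0 n a t : 0 <= a -> 1 < t -> 0 < legendreJ n a t.
Proof.
move=> a0 t1.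
(* On [-1, 1], a part of [-pi/2, pi/2], one has cos x >= cos 1 and t - sin x <= t + 1. *)
pose c : R := cos 1 ^+ n.*2 * (t + 1) `^ (- a).
have c0 : 0 < c.
  rewrite mulr_gt0 ?exprn_gt0 ?cos1_gt0 ?powR_gt0 //.
  by rewrite addr_gt0 // (lt_trans ltr01).
have p1 := @pihalf_ge1 R.
have sub : `[(-1)%R, 1%R]%classic `<=` (`[(- (pi / 2))%R, (pi / 2)%R]%classic : set R).
  move=> x /=; rewrite !in_itv /= => /andP[x1 x2].
  by rewrite (le_trans x2 p1) andbT (le_trans _ x1) // lerN2.
have e : \int[mu]_(x in `[-1, 1]) c = c * 2.
  rewrite Rintegral_cst //; congr (_ * _).
  by rewrite [X in fine X]segment_measure ?gtrN //= opprK.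
apply: (@lt_le_trans _ _ (c * 2)); first by rewrite mulr_gt0.
rewrite -e legendreJ_def; have -> : `[(-1)%R, 1%R]%classic =
   (`[(- (pi / 2))%R, (pi / 2)%R]%classic `&` `[(-1)%R, 1%R]%classic : set R).
  by rewrite setIC; apply/esym/setIidPl.
rewrite Rintegral_mkcondr; apply: le_Rintegral => //.
- rewrite -restrict_EFin; apply/integrable_restrict => //.
  rewrite setIC (setIidl sub).
  by apply: segment_integrable => x; exact: cvg_cst.
- exact: jterm_integrable.
- move=> x _; rewrite patchE; case: ifPn => [|_]; last exact: jterm_ge0.
  rewrite inE /= in_itv /= => /andP[x1 x2].
  have c10 := ltW (@cos1_gt0 R).
  rewrite jtermE; apply: ler_pM; [exact: exprn_ge0|exact: powR_ge0| |]; last first.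
    apply: powR_neg_le => //; first exact: subr_sin_gt0.
    by rewrite lerD2l lerNl sin_geN1.
  have x0 : 0 <= cos x.
    apply: cos_ge0_pihalf; rewrite (le_trans x2 p1) andbT.
    by rewrite (le_trans _ x1) // lerN2.
  apply: lerXn2r; rewrite ?nnegrE // -(cos_norm x) leNgt ltr_cos.
  + by rewrite -leNgt ler_norml x1.
  + by rewrite in_itv /= ler01 (le_trans _ (@pi_ge2 R)) // ler1n.
  + rewrite in_itv /= normr_ge0 (le_trans _ (@pi_ge2 R)) //.
    by rewrite (le_trans (_ : _ <= 1)) ?ler1n // ler_norml x1.
Qed.

Lemma legendreJ_shift_le n a t : 1 < t -> legendreJ n (a + 1) t <= (t - 1)^-1 * legendreJ n a t.
Proof.
move=> t1; apply: legendreJ_le => // x.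
rewrite [in leRHS](jterm_shift _ _ _ t1) mulrA ler_peMl ?jterm_ge0 //.
by rewrite mulrC ler_pdivlMr ?subr_gt0 // mul1r lerD2l lerN2 sin_le1.
Qed.

Lemma legendreJ_shift_ge n a t : 1 < t -> legendreJ n a t <= (t + 1) * legendreJ n (a + 1) t.
Proof.
move=> t1; apply: legendreJ_le => // x.
rewrite (jterm_shift _ _ _ t1) ler_wpM2r ?jterm_ge0 //.
by rewrite lerD2l lerNl sin_geN1.
Qed.

(** Pointwise this is (1 - s^2) (t + 1) <= 4 (t - s) for |s| <= 1: the difference is increasing in t
    and equals 2 (1 - s)^2 at t = 1. It is the source of the geometric decay in n. *)
Lemma legendreJ_contract n a t : 1 < t ->
  legendreJ n.+1 (a + 1) t <= 4 / (t + 1) * legendreJ n a t.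
Proof.
move=> t1; apply: legendreJ_le => // x.
rewrite (jterm_shift _ a _ t1) !jtermE doubleS !exprS.
have -> : cos x * (cos x * cos x ^+ n.*2) = cos x ^+ 2 * cos x ^+ n.*2 by ring.
rewrite cos2sin2 -mulrA [leRHS]mulrA; apply: ler_wpM2r.
  by rewrite mulr_ge0 ?powR_ge0 // -mul2n exprM exprn_ge0 // sqr_ge0.
rewrite mulrAC ler_pdivlMr; last lra.
have := sin_le1 x; have := sin_geN1 x; set s := sin x => h1 h2.
nra.
Qed.

Definition legendre_kernel n a t (s : R) : R :=
  (1 - s ^+ 2) `^ (n%:R - 2^-1) / (t - s) `^ a.

Lemma measurable_legendre_kernel n a t :
  measurable_fun setT (legendre_kernel n a t).
Proof.
rewrite /legendre_kernel; under eq_fun do rewrite -powRN.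
apply: measurable_funM.
  apply: (measurableT_comp (measurable_powR (n%:R - 2^-1))).
  by apply: measurable_funB => //; exact: measurable_funX.
by apply: (measurableT_comp (measurable_powR (- a))); exact: measurable_funB.
Qed.

Lemma legendre_kernel_sin n a t x : 1 < t -> - (pi / 2) < x < pi / 2 ->
  legendre_kernel n a t (sin x) * cos x = jterm n a t x.
Proof.
move=> t1 xp; have c0 := cos_gt0_pihalf xp.
rewrite /legendre_kernel jtermE powRN -cos2sin2 mulrAC; congr (_ / _).
rewrite -(powR_mulrn 2 (ltW c0)) -powRrM -{2}(powRr1 (ltW c0)).
rewrite -powRD ?(gt_eqF c0) ?implybT // -(powR_mulrn n.*2 (ltW c0)).
by congr (_ `^ _); rewrite -muln2 natrM; field.
Qed.

Let bound k : R := pi / 2 * (k.+1%:R / k.+2%:R).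

Let bound_lt k : 0 < bound k < pi / 2.
Proof.
have p0 : 0 < pi / 2 :> R by rewrite divr_gt0 // pi_gt0.
rewrite /bound; apply/andP; split; first by rewrite mulr_gt0 // divr_gt0.
by rewrite gtr_pMr // ltr_pdivrMr // mul1r ltr_nat.
Qed.

Let bound_le j k : (j <= k)%N -> bound j <= bound k.
Proof.
move=> jk; have p0 : 0 < pi / 2 :> R by rewrite divr_gt0 // pi_gt0.
rewrite /bound ler_pM2l // ler_pdivrMr // mulrAC ler_pdivlMr // -!natrM ler_nat.
nia.
Qed.

Let bound_cofinal x : - (pi / 2) < x < pi / 2 -> exists k, - bound k <= x <= bound k.
Proof.
rewrite -ltr_norml => xp.
have p0 : 0 < pi / 2 :> R by rewrite divr_gt0 // pi_gt0.
have [k kP] : exists k : nat, (pi / 2) / (pi / 2 - `|x|) < k%:R.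
  by eexists; exact: truncnS_gt.
exists k; rewrite -ler_norml /bound.
rewrite ltr_pdivrMr ?subr_gt0 // in kP.
rewrite mulrA ler_pdivlMr // -[k.+2%:R]natr1 -[k.+1%:R]natr1.
move: (pi / 2) p0 xp kP => p p0 xp kP.
have := normr_ge0 x; nra.
Qed.

(** For n = 0 the left integrand is unbounded at s = -1 and s = 1, so the substitution s = sin x is
    made on the segments [-bound k, bound k], which exhaust the open interval, and both sides pass
    to the limit by monotone convergence. *)
Lemma legendreJE n a t : 1 < t ->
  \int[mu]_(s in `[-1, 1]) ((1 - s ^+ 2) `^ (n%:R - 2^-1) / (t - s) `^ a) =
  legendreJ n a t.
Proof.
move=> t1; rewrite legendreJ_def /Rintegral; congr fine.
have mk (D : set R) : measurable_fun D (fun s => (legendre_kernel n a t s)%:E).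
  by apply/measurable_EFinP; apply: measurable_funTS; exact: measurable_legendre_kernel.
have mj (D : set R) : measurable_fun D (fun s => (jterm n a t s)%:E).
  apply/measurable_EFinP; apply: measurable_funTS; apply: continuous_measurable_fun.
  exact: continuous_jterm.
rewrite -[LHS]integral_itv_obnd_cbnd; last exact: mk.
rewrite -[LHS]integral_itv_bndo_bndc; last exact: mk.
rewrite -[RHS]integral_itv_obnd_cbnd; last exact: mj.
rewrite -[RHS]integral_itv_bndo_bndc; last exact: mj.
have sin_mono k x : - bound k <= x <= bound k -> x \in `[- (pi / 2), pi / 2]%R.
  have /andP[_ bk] := bound_lt k.
  by rewrite in_itv /= => /andP[h1 h2]; rewrite (le_trans h2 (ltW bk)) andbT
    (le_trans _ h1) // lerN2 ltW.
have sin_le x y : x \in `[- (pi / 2), pi / 2]%R -> y \in `[- (pi / 2), pi / 2]%R ->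
    x <= y -> sin x <= sin y :> R.
  by move=> xI yI xy; rewrite leNgt ltr_sin // -leNgt.
pose S1 k : set R := `[sin (- bound k), sin (bound k)]%classic.
pose S2 k : set R := `[- bound k, bound k]%classic.
have E1 : `](-1)%R, 1%R[%classic = \bigcup_k S1 k :> set R.
  apply/seteqP; split => s /=.
    rewrite in_itv /= => /andP[s1 s2].
    have s12 : -1 <= s <= 1 by rewrite !ltW.
    have [k /andP[k1 k2]] : exists k, - bound k <= asin s <= bound k.
      by apply: bound_cofinal; rewrite asin_gtNpi2 ?s1 ?(ltW s2) // asin_ltpi2 ?(ltW s1).
    have E : sin (asin s) = s by rewrite asinK // in_itv.
    have aI : asin s \in `[- (pi / 2), pi / 2]%R by apply: (sin_mono k); rewrite k1.
    exists k => //=; rewrite /S1 /= in_itv /=; apply/andP; split.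
      by rewrite -[leRHS]E; apply: sin_le => //; apply: (sin_mono k); rewrite lexx; lra.
    by rewrite -[leLHS]E; apply: sin_le => //; apply: (sin_mono k); rewrite lexx andbT; lra.
  move=> [k _]; rewrite /S1 /S2 /= !in_itv /= => /andP[h1 h2].
  have /andP[b0 bp] := bound_lt k.
  have s1 : sin (bound k) < 1.
    by rewrite -sin_pihalf ltr_sin ?in_itv /= ?lexx ?(ltW bp) ?gerN; lra.
  by rewrite (le_lt_trans h2 s1) andbT (lt_le_trans _ h1) // sinN ltrN2.
have E2 : `](- (pi / 2))%R, (pi / 2)%R[%classic =
\bigcup_k S2 k :> set R.
  apply/seteqP; split => x /=.
    by rewrite in_itv /= => /bound_cofinal[k kx]; exists k => //=; rewrite /S2 /= in_itv.
  move=> [k _]; rewrite /S1 /S2 /= !in_itv /= => /andP[h1 h2].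
  have /andP[b0 bp] := bound_lt k.
  by rewrite (le_lt_trans h2 bp) andbT (lt_le_trans _ h1) // ltrN2.
rewrite E1 E2.
have L1 : (\int[mu]_(x in S1 k) (legendre_kernel n a t x)%:E
    @[k --> \oo] --> \int[mu]_(x in \bigcup_k S1 k) (legendre_kernel n a t x)%:E)%E.
  apply: ge0_nondecreasing_set_cvg_integral => //.
  - move=> j k jk; apply/subsetPset => x /=; rewrite /S1 /= !in_itv /= => /andP[h1 h2].
    have := bound_le jk => bjk.
    have bb i : bound i \in `[- (pi / 2), pi / 2]%R.
      by apply: (sin_mono i); rewrite lexx andbT; have := bound_lt i; lra.
    have hs : sin (bound j) <= sin (bound k) by exact: sin_le.
    by rewrite (le_trans h2 hs) andbT (le_trans _ h1) // !sinN lerN2.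
  - by move=> k; exact: measurable_itv.
  - by move=> k; exact: mk.
  - by move=> k s _; rewrite lee_fin divr_ge0 ?powR_ge0.
have L2 : (\int[mu]_(x in S2 k) (jterm n a t x)%:E
    @[k --> \oo] --> \int[mu]_(x in \bigcup_k S2 k) (jterm n a t x)%:E)%E.
  apply: ge0_nondecreasing_set_cvg_integral => //.
  - move=> j k jk; apply/subsetPset => x /=; rewrite /S2 /= !in_itv /= => /andP[h1 h2].
    have := bound_le jk => bjk.
    by rewrite (le_trans h2 bjk) andbT (le_trans _ h1) // lerN2.
  - by move=> k; exact: measurable_itv.
  - by move=> k; exact: mj.
  - by move=> k s _; rewrite lee_fin jterm_ge0.
suff E : (fun k => \int[mu]_(x in S1 k) (legendre_kernel n a t x)%:E)%E =
    (fun k => \int[mu]_(x in S2 k) (jterm n a t x)%:E)%E.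
  by rewrite E in L1; exact: (cvg_unique _ L1 L2).
apply/funext => k.
have /andP[b0 bp] := bound_lt k.
have bsub x : x \in `[- bound k, bound k]%R -> - (pi / 2) < x < pi / 2.
  by rewrite in_itv /= => /andP[h1 h2]; rewrite (le_lt_trans h2 bp) andbT
    (lt_le_trans _ h1) // ltrN2.
have D : derive1 (@sin R) = cos.
  by apply/funext => x; rewrite derive1E; case: (is_derive_sin x).
rewrite (@integration_by_substitution_increasing R sin) //.
- apply: eq_integral => x; rewrite inE /= => /bsub xp.
  congr EFin.
  rewrite -[LHS]/(legendre_kernel n a t (sin x) * (derive1 (@sin R) x)) D.
  exact: legendre_kernel_sin.
- by lra.
- move=> x y /bsub /andP[x1 x2] /bsub /andP[y1 y2] xy.
  by rewrite ltr_sin // in_itv /= !ltW.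
- by rewrite D => x _; exact: continuous_cos.
- rewrite D; apply/cvg_ex; exists (cos (- bound k)).
  by apply: cvg_at_right_filter; exact: continuous_cos.
- rewrite D; apply/cvg_ex; exists (cos (bound k)).
  by apply: cvg_at_left_filter; exact: continuous_cos.
- split.
  + by move=> x _; exact: derivable_sin.
  + by apply: cvg_at_right_filter; exact: continuous_sin.
  + by apply: cvg_at_left_filter; exact: continuous_sin.
- apply: continuous_in_subspaceT => s; rewrite inE /= in_itv /= => /andP[h1 h2].
  have s1 : sin (bound k) < 1.
    by rewrite -sin_pihalf ltr_sin ?in_itv /= ?lexx; lra.
  have s2 : - 1 < s by rewrite (lt_le_trans _ h1) // sinN ltrN2.
  have s3 : s < 1 by exact: le_lt_trans s1.
  have d1 : is_derive s 1 (fun s : R => 1 - s ^+ 2) (- (2 * s)).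
    by apply: is_derive_eq; rewrite /GRing.scale /=; ring.
  have d2 : is_derive s 1 (fun s : R => t - s) (- 1).
    by apply: is_derive_eq; rewrite /GRing.scale /=; ring.
  rewrite /legendre_kernel; under eq_fun do rewrite -powRN.
  apply: cvgM.
    have p1 : 0 < 1 - s ^+ 2 :> R by nra.
    exact: (is_derive_continuous (@is_derive_powR_comp (fun s => 1 - s ^+ 2) _ _ s p1 d1)).
  have p2 : 0 < t - s :> R by rewrite subr_gt0 (lt_trans s3).
  exact: (is_derive_continuous (@is_derive_powR_comp (fun s => t - s) _ _ s p2 d2)).
Qed.

End legendre_integral.

(** * The Gamma function at half-integers *)

Section gamma.
Context {R : realType}.
Notation mu := (@lebesgue_measure R).
Implicit Types (z x : R).

Let gint z x : R := x `^ (z - 1) * expR (- x).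
Let low k : R := k.+2%:R^-1.
Let dom k : set R := `[low k, k.+2%:R]%classic.

Let measurable_dom k : measurable (dom k). Proof. exact: measurable_itv. Qed.

Let low_gt0 k : 0 < low k. Proof. by rewrite invr_gt0. Qed.

Let low_lt k : low k < k.+2%:R.
Proof.
apply: (@lt_trans _ _ 1); last by rewrite ltr1n.
by rewrite invf_lt1 // ltr1n.
Qed.

Let is_derive_gint z x : 0 < x ->
  is_derive x 1 (fun x => - (x `^ z * expR (- x))) (gint (z + 1) x - z * gint z x).
Proof.
move=> x0; have h := is_derive1_powR z x0.
apply: is_derive_eq.
by rewrite /gint addrK /GRing.scale /=; ring.
Qed.

Let continuous_gint z x : 0 < x -> {for x, continuous (gint z)}.
Proof.
move=> x0; have h := is_derive1_powR (z - 1) x0.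
apply: (@cvgM _ _ _ _ (fun x => x `^ (z - 1)) (fun x => expR (- x))).
  exact: (is_derive_continuous h).
apply: (@continuous_comp _ _ _ -%R expR); first exact: opp_continuous.
exact: continuous_expR.
Qed.

Let within_gint z k : {within dom k, continuous (gint z)}.
Proof.
apply: continuous_in_subspaceT => x; rewrite inE /dom /= in_itv /= => /andP[h _].
by apply: continuous_gint; exact: lt_le_trans (low_gt0 k) h.
Qed.

Let gint_ge0 z x : 0 <= gint z x.
Proof. by rewrite mulr_ge0 ?powR_ge0 ?expR_ge0. Qed.

Let measurable_gint z (D : set R) : measurable_fun D (fun x => (gint z x)%:E).
Proof.
apply/measurable_EFinP; apply: measurable_funTS; apply: measurable_funM.
  exact: measurable_powR.
by apply: measurableT_comp => //; exact: measurable_funB.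
Qed.

Let gint_integrable z k : mu.-integrable (dom k) (EFin \o gint z).
Proof. by apply: continuous_compact_integrable; [exact: segment_compact|exact: within_gint]. Qed.

Let part z k : R := \int[mu]_(x in dom k) gint z x.

Let part_rec z k : part (z + 1) k = z * part z k +
  (low k `^ z * expR (- low k) - k.+2%:R `^ z * expR (- k.+2%:R)).
Proof.
rewrite /part -RintegralZl; [|exact: measurable_dom|exact: gint_integrable].
have e : (\int[mu]_(x in dom k) (gint (z + 1) x - z * gint z x)%:E)%E =
    (low k `^ z * expR (- low k) - k.+2%:R `^ z * expR (- k.+2%:R))%:E.
  rewrite (continuous_FTC2 (F := fun x => - (x `^ z * expR (- x))) (low_lt k)).
  - by rewrite -EFinB opprK addrC.
  - apply: continuous_in_subspaceT => x; rewrite inE /dom /= in_itv /= => /andP[h _].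
    have x0 := lt_le_trans (low_gt0 k) h.
    by apply: cvgB; [|apply: cvgM; first exact: cvg_cst]; exact: continuous_gint.
  - have h x : 0 < x -> {for x, continuous (fun x => - (x `^ z * expR (- x)))}.
      by move=> x0; exact: (is_derive_continuous (is_derive_gint z x0)).
    split.
    + move=> x; rewrite in_itv /= => /andP[h1 _].
      by case: (is_derive_gint z (lt_trans (low_gt0 k) h1)).
    + by apply: cvg_at_right_filter; exact: h.
    + by apply: cvg_at_left_filter; exact: h.
  - move=> x; rewrite in_itv /= => /andP[h1 _]; rewrite derive1E.
    by case: (is_derive_gint z (lt_trans (low_gt0 k) h1)).
move: e => /(congr1 fine) /=; rewrite -/(Rintegral mu (dom k) _) RintegralB; last 3 first.
- exact: measurable_dom.
- exact: gint_integrable.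
- apply: continuous_compact_integrable; first exact: segment_compact.
  apply: continuous_in_subspaceT => x; rewrite inE /dom /= in_itv /= => /andP[h _].
  have x0 := lt_le_trans (low_gt0 k) h.
  by apply: cvgM; [exact: cvg_cst|exact: continuous_gint].
by move=> <-; ring.
Qed.

Let boundary_cvg0 z : 0 < z ->
  low k `^ z * expR (- low k) - k.+2%:R `^ z * expR (- k.+2%:R) @[k --> \oo] --> 0.
Proof.
(* With z + 1 <= p one has x^z x <= x^p <= p^p e^x for x >= 1, by x / p <= e^(x/p); so the boundary
   term at the upper end is O(1 / x). *)
move=> z0; pose p := (Num.truncn z).+2.
have zp : z + 1 <= p%:R.
  by rewrite -[p]addn1 natrD lerD2r ltW // truncnS_gt.
have lowc : low k @[k --> \oo] --> 0.
  have := @cvg_harmonic R; rewrite -(cvg_shiftn 1%N).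
  by under eq_fun do rewrite addn1.
rewrite -[X in _ --> X]subr0; apply: cvgB.
  apply: (@squeeze_cvgr _ _ _ _ (cst 0) (fun k => low k `^ z)).
  - near=> k; rewrite mulr_ge0 ?powR_ge0 ?expR_ge0 //=.
    by rewrite ler_piMr ?powR_ge0 // -expR0 ler_expR oppr_le0 ltW.
  - exact: cvg_cst.
  - have := powR_cvg0 z0 => /cvg_at_rightP; apply; split => //.
apply: (@squeeze_cvgr _ _ _ _ (cst 0) (fun k => p%:R ^+ p * low k)).
- near=> k; rewrite mulr_ge0 ?powR_ge0 ?expR_ge0 //=.
  rewrite expRN -/(low k).
  set x : R := k.+2%:R.
  have x1 : 1 <= x by rewrite ler1n.
  have x0 : 0 < x by exact: lt_le_trans x1.
  have h1 : x `^ z * x <= x ^+ p.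
    rewrite -{2}(powRr1 (ltW x0)) -powRD ?(gt_eqF x0) ?implybT //.
    by rewrite -(powR_mulrn p (ltW x0)) ler_powR.
  have h2 : x ^+ p <= p%:R ^+ p * expR x.
    have -> : expR x = expR (x / p%:R) ^+ p.
      by rewrite -expRM_natl mulrC divfK // gt_eqF.
    rewrite -exprMn lerXn2r ?nnegrE ?mulr_ge0 ?expR_ge0 ?(ltW x0) //.
    apply: (@le_trans _ _ (p%:R * (x / p%:R))); first by rewrite mulrC divfK // gt_eqF.
    rewrite ler_pM2l //; apply: le_trans (expR_ge1Dx _).
    by rewrite lerDr.
  rewrite ler_pdivrMr ?expR_gt0 // mulrAC /low ler_pdivlMr //.
  exact: le_trans h2.
- exact: cvg_cst.
- rewrite -[X in _ --> X](mulr0 (p%:R ^+ p)); apply: cvgM => //; exact: cvg_cst.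
Unshelve. all: by end_near. Qed.

Let dom_bigcup : `]0, +oo[%classic = \bigcup_k dom k.
Proof.
apply/seteqP; split => x /=; last first.
  by move=> [k _]; rewrite /dom /= !in_itv /= andbT => /andP[h _];
    exact: lt_le_trans h.
rewrite in_itv /= andbT => x0.
have [k kP] : exists k : nat, x + x^-1 < k%:R by eexists; exact: truncnS_gt.
have k2 : k%:R < k.+2%:R :> R by rewrite ltr_nat.
have xi : 0 < x^-1 by rewrite invr_gt0.
exists k => //=; rewrite /dom /= in_itv /=; apply/andP; split; last by lra.
by rewrite /low -[leRHS]invrK lef_pV2 ?posrE //; lra.
Qed.

Let part_cvg z : ((part z k)%:E @[k --> \oo] -->
  \int[mu]_(x in `]0%R, +oo[) (gint z x)%:E)%E.
Proof.
rewrite dom_bigcup.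
rewrite (_ : (fun k => (part z k)%:E) = (fun k => \int[mu]_(x in dom k) (gint z x)%:E)%E).
  apply: ge0_nondecreasing_set_cvg_integral => //.
  - move=> j k jk; apply/subsetPset => x; rewrite /dom /= !in_itv /= => /andP[h1 h2].
    apply/andP; split.
      by apply: le_trans h1; rewrite lef_pV2 ?posrE // ler_nat.
    by apply: (le_trans h2); rewrite ler_nat.
  - by move=> k; exact: measurable_gint.
  - by move=> k x _; rewrite lee_fin.
by apply/funext => k; rewrite /part /Rintegral fineK //; apply: integrable_fin_num; [exact: measurable_dom|exact: gint_integrable].
Qed.

Let gamma_from_part z g : part z k @[k --> \oo] --> g -> Gamma z = g.
Proof.
move=> h; rewrite /Gamma /Rintegral.
have h' : ((part z k)%:E @[k --> \oo] --> g%:E)%E.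
  by apply: cvg_EFin => //; exact: nearW.
have h0 := part_cvg (z := z).
by have := cvg_unique _ h0 h' => ->.
Qed.

(** From e^(-x) <= 1 / (1 + x): the majorant x^(-1/2) / (1 + x) has the primitive 2 atan (sqrt x),
    whose total variation is pi. *)
Let part_half k : part (2^-1) k <= pi.
Proof.
pose f x : R := x `^ (- 2^-1) / (1 + x).
have df x : 0 < x -> is_derive x 1 (fun x : R => 2 * atan (x `^ 2^-1)) (f x).
  move=> x0; have h := is_derive1_powR (2^-1) x0.
  have h' := @is_derive1_comp R atan (fun x => x `^ 2^-1) x _ _ (is_derive1_atan _) h.
  apply: (@is_derive_eq _ _ _ _ _ _ _ _ (is_deriveZ 2 h')).
  rewrite -powR_mulrn ?powR_ge0 // -powRrM mulVf // powRr1 ?(ltW x0) //.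
  rewrite /f /GRing.scale /= (_ : 2^-1 - 1 = - 2^-1); last by field.
  by field; rewrite gt_eqF // addr_gt0.
have cf : {within dom k, continuous f}.
  apply: continuous_in_subspaceT => x; rewrite inE /dom /= in_itv /= => /andP[h _].
  have x0 := lt_le_trans (low_gt0 k) h.
  apply: cvgM; first exact: (is_derive_continuous (is_derive1_powR _ x0)).
  by apply: cvgV; [rewrite gt_eqF // addr_gt0|apply: cvgD; [exact: cvg_cst|exact: cvg_id]].
have fi : mu.-integrable (dom k) (EFin \o f).
  by apply: continuous_compact_integrable => //; exact: segment_compact.
apply: (@le_trans _ _ (\int[mu]_(x in dom k) f x)).
  apply: le_Rintegral; [exact: measurable_dom|exact: gint_integrable|by []|].
  move=> x; rewrite /dom /= in_itv /= => /andP[h _].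
  have x0 := lt_le_trans (low_gt0 k) h.
  rewrite /gint /f (_ : 2^-1 - 1 = - 2^-1); last by field.
  by rewrite ler_wpM2l ?powR_ge0 // expRN lef_pV2 ?posrE ?expR_gt0 ?addr_gt0 // expR_ge1Dx.
rewrite /Rintegral (continuous_FTC2 (F := fun x : R => 2 * atan (x `^ 2^-1)) (low_lt k)) //.
- rewrite -EFinB /=.
  have := @atan_ltpi2 R (k.+2%:R `^ 2^-1).
  have : atan 0 <= atan (low k `^ 2^-1) by apply: le_atan; exact: powR_ge0.
  by rewrite atan0; lra.
- have h x : 0 < x -> {for x, continuous (fun x : R => 2 * atan (x `^ 2^-1))}.
    by move=> x0; exact: (is_derive_continuous (df x x0)).
  split.
  + move=> x; rewrite in_itv /= => /andP[h1 _].
    by case: (df x (lt_trans (low_gt0 k) h1)).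
  + by apply: cvg_at_right_filter; exact: h.
  + by apply: cvg_at_left_filter; exact: h.
- move=> x; rewrite in_itv /= => /andP[h1 _]; rewrite derive1E.
  by case: (df x (lt_trans (low_gt0 k) h1)).
Qed.

Let part_mono z j k : (j <= k)%N -> part z j <= part z k.
Proof.
move=> jk; rewrite -lee_fin /part /Rintegral !fineK;
  [|by apply: integrable_fin_num; [exact: measurable_dom|exact: gint_integrable]..].
apply: ge0_subset_integral; [exact: measurable_dom..|exact: measurable_gint| |].
- by move=> x _; rewrite lee_fin.
- move=> x; rewrite /dom /= !in_itv /= => /andP[h1 h2]; apply/andP; split.
    by apply: le_trans h1; rewrite lef_pV2 ?posrE // ler_nat.
  by apply: (le_trans h2); rewrite ler_nat.
Qed.

Let gamma_half : exists2 g : R, 0 < g & part (2^-1) k @[k --> \oo] --> g.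
Proof.
have ub : has_ubound (range (part (2^-1))).
  by exists pi => _ [k _ <-]; exact: part_half.
have nd : nondecreasing_seq (part (2^-1)).
  by move=> j k jk; exact: part_mono.
have c := nondecreasing_cvgn nd ub.
exists (sup (range (part (2^-1)))) => //.
apply: (@lt_le_trans _ _ (part (2^-1) 0%N)); last first.
  by apply: ub_le_sup => //; exists 0%N.
pose c0 : R := 2 `^ (- 2^-1) * expR (- 2).
have cp : 0 < c0 by rewrite mulr_gt0 ?powR_gt0 ?expR_gt0.
apply: (@lt_le_trans _ _ (\int[mu]_(x in dom 0%N) c0)).
  rewrite Rintegral_cst; last exact: measurable_itv.
  rewrite [X in fine X]segment_measure ?low_lt //= mulr_gt0 // subr_gt0.
  exact: low_lt.
apply: le_Rintegral; [exact: measurable_dom| | |].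
- by apply: segment_integrable => x; exact: cvg_cst.
- exact: gint_integrable.
- move=> x; rewrite /dom /= in_itv /= => /andP[h1 h2].
  have x0 := lt_le_trans (low_gt0 0) h1.
  rewrite /gint (_ : 2^-1 - 1 = - 2^-1); last by field.
  apply: ler_pM; rewrite ?powR_ge0 ?expR_ge0 ?ler_expR ?lerN2 //.
  by apply: powR_neg_le.
Qed.

(** [Gamma] is the [fine] part of an integral that might be infinite a priori. Convergence of the
    truncated integrals, by induction from 1/2, excludes this and yields positivity as well. *)
Let gamma_cvg n : exists2 g : R, 0 < g & part (n%:R + 2^-1) k @[k --> \oo] --> g.
Proof.
elim: n => [|n [g g0 gP]]; first by rewrite add0r; exact: gamma_half.
have z0 : 0 < n%:R + 2^-1 :> R by rewrite ltr_wpDl.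
exists ((n%:R + 2^-1) * g); first by rewrite mulr_gt0.
have -> : n.+1%:R + 2^-1 = n%:R + 2^-1 + 1 :> R by rewrite -natr1; ring.
rewrite (_ : part _ = fun k => (n%:R + 2^-1) * part (n%:R + 2^-1) k +
  (low k `^ (n%:R + 2^-1) * expR (- low k) -
   k.+2%:R `^ (n%:R + 2^-1) * expR (- k.+2%:R))); last first.
  by apply/funext => k; exact: part_rec.
rewrite -[X in _ --> X]addr0; apply: cvgD; last exact: boundary_cvg0.
by apply: cvgM => //; exact: cvg_cst.
Qed.

Lemma Gamma_half_gt0 n : 0 < Gamma (n%:R + 2^-1 : R).
Proof. by have [g g0 /gamma_from_part ->] := gamma_cvg n. Qed.

Lemma Gamma_half_rec n :
  Gamma (n.+1%:R + 2^-1) = (n%:R + 2^-1) * Gamma (n%:R + 2^-1) :> R.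
Proof.
have z0 : 0 < n%:R + 2^-1 :> R by rewrite ltr_wpDl.
have [g g0 gP] := gamma_cvg n; rewrite (gamma_from_part gP).
apply: gamma_from_part.
have -> : n.+1%:R + 2^-1 = n%:R + 2^-1 + 1 :> R by rewrite -natr1; ring.
rewrite (_ : part _ = fun k => (n%:R + 2^-1) * part (n%:R + 2^-1) k +
  (low k `^ (n%:R + 2^-1) * expR (- low k) -
   k.+2%:R `^ (n%:R + 2^-1) * expR (- k.+2%:R))); last first.
  by apply/funext => k; exact: part_rec.
rewrite -[X in _ --> X]addr0; apply: cvgD; last exact: boundary_cvg0.
by apply: cvgM => //; exact: cvg_cst.
Qed.

End gamma.

(** With s = sinh and c = cosh in mind: sqrt s * s^m <= c^(m + 1/2) <= c^h, and c / (c - 1) <= 2. *)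
Lemma powR_half_bound {R : realType} (s c h : R) m : 0 < s -> s <= c -> 2 <= c ->
  m%:R + 2^-1 <= h -> Num.sqrt s * (s ^+ m * (c - 1) `^ (- h)) <= 2 `^ h.
Proof.
move=> s0 sc c2 mh; have c0 := lt_le_trans s0 sc.
have h0 : 0 <= h by apply: le_trans mh; rewrite addr_ge0.
have c10 : 0 < c - 1 by lra.
rewrite mulrA powRN ler_pdivrMr ?powR_gt0 // -powRM //; last exact: ltW.
apply: (@le_trans _ _ (c `^ h)); last by apply: ge0_ler_powR; rewrite ?nnegrE; lra.
rewrite -powR12_sqrt ?(ltW s0) // -powR_mulrn ?(ltW s0) // -powRD ?(gt_eqF s0) ?implybT //.
rewrite addrC; apply: (@le_trans _ _ (c `^ (m%:R + 2^-1))).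
  by apply: ge0_ler_powR; rewrite ?nnegrE // ?addr_ge0 // ltW.
by apply: ler_powR => //; lra.
Qed.

HB.lock Definition torQ {R : realType} (n m : nat) (e : R) : R :=
  legendreQ (n%:R - 2^-1) m (cosh e).

HB.lock Definition torQ_const {R : realType} (n m : nat) : R :=
  (-1) ^+ m / 2 `^ (n%:R + 2^-1) *
  (Gamma ((n + m)%:R + 2^-1) / Gamma (n%:R + 2^-1)).

(** * Legendre functions at half-integer degree, in the variable eta *)

Section toroidalQ.
Context {R : realType}.
Implicit Types (n m : nat) (e : R).
Notation cst := (@torQ_const R).

Let hf n m : R := (n + m)%:R + 2^-1.

Let torQE n m e : 0 < e ->
  torQ n m e = cst n m * sinh e ^+ m * legendreJ n (hf n m) (cosh e).
Proof.
move=> e0; rewrite torQ.unlock torQ_const.unlock /legendreQ legendreJE; last exact: cosh_gt1.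
have -> : n%:R - 2^-1 + 1 = n%:R + 2^-1 :> R by field.
have -> : n%:R - 2^-1 + m%:R + 1 = (n + m)%:R + 2^-1 :> R by rewrite natrD; field.
congr (_ * _ * _).
have -> : cosh e ^+ 2 - 1 = sinh e ^+ 2 by rewrite -(cosh2B e); ring.
have s0 := ltW (sinh_gt0 e0).
by rewrite -powR_mulrn // -powRrM mulrCA divff // mulr1 powR_mulrn.
Qed.

Let cst_rec n m : cst n.+1 m = cst n m * (hf n m / n.*2.+1%:R).
Proof.
rewrite torQ_const.unlock addSn !Gamma_half_rec -/(hf n m).
have -> : n.+1%:R + 2^-1 = (n%:R + 2^-1) + 1 :> R by rewrite -natr1; ring.
rewrite powRD ?pnatr_eq0 ?implybT // powRr1 //.
have g0 : Gamma (n%:R + 2^-1) != 0 :> R by rewrite gt_eqF // Gamma_half_gt0.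
have p0 : 2 `^ (n%:R + 2^-1) != 0 :> R by rewrite gt_eqF // powR_gt0.
have n0 : 2 * n%:R + 1 != 0 :> R by rewrite gt_eqF // ltr_wpDl // mulr_ge0.
have -> : n.*2.+1%:R = 2 * n%:R + 1 :> R by rewrite -natr1 -mul2n natrM.
move: (2 `^ _) (Gamma _) (Gamma _) g0 p0 => p G H G0 p0.
by field; rewrite G0 p0 n0 /=.
Qed.

Let cst_sign n m : 0 < (-1) ^+ m * cst n m.
Proof.
have -> : (-1) ^+ m * cst n m = ((-1) ^+ m * (-1) ^+ m) * ((2 `^ (n%:R + 2^-1))^-1 *
  (Gamma ((n + m)%:R + 2^-1) / Gamma (n%:R + 2^-1))) by rewrite torQ_const.unlock; ring.
by rewrite -expr2 sqrr_sign mul1r !mulr_gt0 ?invr_gt0 ?powR_gt0 ?Gamma_half_gt0.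
Qed.

Let hf_gt0 n m : 0 < hf n m. Proof. by rewrite ltr_wpDl. Qed.

Lemma torQ_sign n m e : 0 < e -> 0 < (-1) ^+ m * torQ n m e.
Proof.
move=> e0; have J0 : 0 < legendreJ n (hf n m) (cosh e).
  by rewrite legendreJ_gt0 ?cosh_gt1 ?(ltW (hf_gt0 _ _)).
have -> : (-1) ^+ m * torQ n m e = ((-1) ^+ m * cst n m) *
    (sinh e ^+ m * legendreJ n (hf n m) (cosh e)) by rewrite torQE //; ring.
by rewrite mulr_gt0 // mulr_gt0 // exprn_gt0 // sinh_gt0.
Qed.

Lemma torQ_neq0 n m e : 0 < e -> torQ n m e != 0.
Proof.
by move=> /(torQ_sign n m); apply: contraTneq => ->; rewrite mulr0 ltxx.
Qed.

(** The eta-derivative of [torQ] by the relation that raises the degree. In this form the ratios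
    q_{n+1} / q_n of the algebraic system are logarithmic derivatives. *)
Definition dtorQ n m e : R :=
  ((n%:R - m%:R + 2^-1) * torQ n.+1 m e - (n%:R + 2^-1) * cosh e * torQ n m e) / sinh e.

(** Expressing degree n + 1 by integrals [legendreJ n] keeps everything within one family, in which
    only the exponent a is shifted. *)
Let by_parts n m e : 0 < e ->
  torQ n.+1 m e = cst n m * sinh e ^+ m *
    (cosh e * legendreJ n (hf n m) (cosh e) - legendreJ n (hf n m - 1) (cosh e)).
Proof.
move=> e0; rewrite torQE // cst_rec.
have -> : hf n.+1 m = hf n m + 1 by rewrite /hf addSn -natr1; ring.
have h := legendreJ_by_parts n (hf n m) (cosh_gt1 e0).
have n0 : n.*2.+1%:R != 0 :> R by [].
apply: (mulfI n0); rewrite [RHS]mulrCA h; field.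
by have := n0; rewrite -natr1.
Qed.

(** A linear relation between three consecutive exponents, obtained by eliminating [legendreJ n.+1]
    between [legendreJ_by_parts] and [legendreJ_cos2]. *)
Let three_J n m e : 0 < e -> hf n m * ((1 - cosh e ^+ 2) * legendreJ n (hf n m + 1) (cosh e)) =
  n.*2.+1%:R * (cosh e * legendreJ n (hf n m) (cosh e) - legendreJ n (hf n m - 1) (cosh e))
  - hf n m * (2 * cosh e * legendreJ n (hf n m) (cosh e) - legendreJ n (hf n m - 1) (cosh e)).
Proof.
move=> e0; rewrite legendreJ_by_parts ?cosh_gt1 // legendreJ_cos2 ?cosh_gt1 //.
have -> : hf n m + 1 - 1 = hf n m by ring.
have -> : hf n m + 1 - 2 = hf n m - 1 by ring.
ring.
Qed.

Let is_derive_sinhX m e : is_derive e 1 (fun e : R => sinh e ^+ m)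
  (m%:R * sinh e ^+ m.-1 * cosh e).
Proof. exact: is_derive_expr. Qed.

Let is_derive_J n a e : 0 < e -> is_derive e 1 (fun e => legendreJ n a (cosh e))
  (- a * legendreJ n (a + 1) (cosh e) * sinh e).
Proof.
move=> e0; have h := is_derive_legendreJ n a (cosh_gt1 e0).
exact: (@is_derive1_comp R (legendreJ n a) (@cosh R) e).
Qed.

Let near_gt0 (e : R) : 0 < e -> \near e, 0 < e.
Proof. exact: lt_nbhsr. Qed.

Let dblE n : n.*2.+1%:R = 2 * n%:R + 1 :> R.
Proof. by rewrite -natr1 -mul2n natrM. Qed.

Let mulX m (x : R) : x != 0 -> m%:R * x ^+ m.-1 = m%:R * x ^+ m / x.
Proof.
by move=> x0; case: m => [|m]; [rewrite !mul0r|rewrite exprSr /= mulrA mulfK].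
Qed.

Let derive_torQ_J n m e : 0 < e -> is_derive e 1 (torQ n m)
  (cst n m * sinh e ^+ m / sinh e * (m%:R * cosh e * legendreJ n (hf n m) (cosh e) +
     hf n m * ((1 - cosh e ^+ 2) * legendreJ n (hf n m + 1) (cosh e)))).
Proof.
move=> e0; have s0 := sinh_gt0 e0.
have h1 := is_derive_sinhX m e; have h2 := is_derive_J n (hf n m) e0.
have h : is_derive e 1 (fun e => cst n m * sinh e ^+ m * legendreJ n (hf n m) (cosh e))
  (cst n m * sinh e ^+ m / sinh e * (m%:R * cosh e * legendreJ n (hf n m) (cosh e) +
     hf n m * ((1 - cosh e ^+ 2) * legendreJ n (hf n m + 1) (cosh e)))).
  apply: is_derive_eq; rewrite mulX ?gt_eqF // /GRing.scale /=.
  have -> : 1 - cosh e ^+ 2 = - sinh e ^+ 2 by rewrite -(cosh2B e); ring.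
  by field; rewrite gt_eqF.
apply: near_eq_is_derive h => //.
by apply: filterS (near_gt0 e0) => x x0; rewrite torQE.
Qed.

Lemma is_derive_torQ n m e : 0 < e -> is_derive e 1 (torQ n m) (dtorQ n m e).
Proof.
move=> e0; have s0 := sinh_gt0 e0.
have := derive_torQ_J n m e0; congr is_derive.
rewrite /dtorQ by_parts // torQE // three_J // dblE /hf natrD.
move: (legendreJ _ _ _) (legendreJ _ _ _) => J0 J1.
by field; rewrite gt_eqF.
Qed.

(** The companion relation, lowering the degree: the formula of [by_parts] is differentiated and
    compared with the derivative already known. *)
Lemma dtorQ_succ n m e : 0 < e -> sinh e * dtorQ n.+1 m e =
  (n%:R + 2^-1) * cosh e * torQ n.+1 m e - (n%:R + m%:R + 2^-1) * torQ n m e.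
Proof.
move=> e0; have s0 := sinh_gt0 e0.
have h1 := is_derive_sinhX m e; have h2 := is_derive_J n (hf n m) e0.
have h3 := is_derive_J n (hf n m - 1) e0; rewrite subrK in h3.
have h : is_derive e 1 (fun e => cst n m * sinh e ^+ m *
    (cosh e * legendreJ n (hf n m) (cosh e) - legendreJ n (hf n m - 1) (cosh e)))
  (((n%:R + 2^-1) * cosh e * torQ n.+1 m e - (n%:R + m%:R + 2^-1) * torQ n m e) / sinh e).
  apply: is_derive_eq; rewrite by_parts // torQE // mulX ?gt_eqF // /GRing.scale /=.
  have := three_J n m e0.
  have -> : 1 - cosh e ^+ 2 = - sinh e ^+ 2 by rewrite -(cosh2B e); ring.
  have c2 : cosh e ^+ 2 = 1 + sinh e ^+ 2 by rewrite -(cosh2B e); ring.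
  rewrite dblE.
  have -> : n%:R + m%:R + 2^-1 = hf n m by rewrite /hf natrD.
  have -> : n%:R = hf n m - m%:R - 2^-1 by rewrite /hf natrD; ring.
  move: (hf n m) (legendreJ _ _ _) (legendreJ _ _ _) (legendreJ _ _ _) c2.
  move: (cst n m) (sinh e) (cosh e) s0 (m%:R) (sinh e ^+ m).
  move=> k s c s0 M sm H J0 J1 J2 c2 E.
  transitivity (k * sm / s * (M * c * (c * J1 - J0) + c * (H * (- s ^+ 2 * J2)) +
     H * s ^+ 2 * J1)).
    by field; rewrite gt_eqF.
  rewrite E (_ : s ^+ 2 = c ^+ 2 - 1); last by rewrite c2; ring.
  by field; rewrite gt_eqF.
have h' : is_derive e 1 (torQ n.+1 m)
  (((n%:R + 2^-1) * cosh e * torQ n.+1 m e - (n%:R + m%:R + 2^-1) * torQ n m e) / sinh e).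
  apply: near_eq_is_derive h => //.
  by apply: filterS (near_gt0 e0) => x x0; rewrite by_parts.
case: h' => _ h'; case: (is_derive_torQ n.+1 m e0) => _ h''.
by rewrite -h'' h' mulrC divfK // gt_eqF.
Qed.

Definition torL n m e : R := - (dtorQ n m e / torQ n m e).

Let torLE n m e : 0 < e -> torL n m e =
  hf n m * sinh e * (legendreJ n (hf n m + 1) (cosh e) / legendreJ n (hf n m) (cosh e))
  - m%:R * (cosh e / sinh e).
Proof.
move=> e0; have s0 := sinh_gt0 e0.
have J0 : 0 < legendreJ n (hf n m) (cosh e).
  by rewrite legendreJ_gt0 ?cosh_gt1 ?(ltW (hf_gt0 _ _)).
rewrite /torL; case: (is_derive_torQ n m e0) => _ <-.
case: (derive_torQ_J n m e0) => _ ->; rewrite torQE //.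
have -> : 1 - cosh e ^+ 2 = - sinh e ^+ 2 by rewrite -(cosh2B e); ring.
have c0 : cst n m != 0.
  by have := cst_sign n m; apply: contraTneq => ->; rewrite mulr0 ltxx.
have sm0 : sinh e ^+ m != 0 by rewrite expf_neq0 // gt_eqF.
move: (cst n m) (sinh e) (cosh e) (hf n m) (legendreJ _ _ _) (sinh e ^+ m)
  c0 s0 sm0 {-}(legendreJ _ _ _) J0 => k s c H J1 sm c0 s0 sm0 J J0.
by field; rewrite c0 sm0 !gt_eqF.
Qed.

(** In [torLE] the quotient of two [legendreJ] is a weighted mean of 1 / (t - sin x), hence lies
    between 1 / (t + 1) and 1 / (t - 1). Together with [torL_ge] this is the linear growth in n. *)
Lemma torL_le n m e : 0 < e ->
  torL n m e <= (n%:R + m%:R + 2^-1) * (sinh e / (cosh e - 1)).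
Proof.
move=> e0; have s0 := sinh_gt0 e0; have c1 := cosh_gt1 e0.
have J0 : 0 < legendreJ n (hf n m) (cosh e).
  by rewrite legendreJ_gt0 ?(ltW (hf_gt0 _ _)).
rewrite torLE // -natrD -/(hf n m) -mulrA.
apply: (@le_trans _ _ (hf n m * (sinh e * (legendreJ n (hf n m + 1) (cosh e) /
    legendreJ n (hf n m) (cosh e))))).
  by rewrite gerBl mulr_ge0 // divr_ge0 ?ltW // cosh_gt0.
rewrite ler_pM2l // ler_pM2l // ler_pdivrMr //.
exact: legendreJ_shift_le.
Qed.

Lemma torL_ge n m e : 0 < e ->
  (n%:R + m%:R + 2^-1) * (sinh e / (cosh e + 1)) - m%:R * (cosh e / sinh e) <= torL n m e.
Proof.
move=> e0; have s0 := sinh_gt0 e0; have c1 := cosh_gt1 e0.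
have J0 : 0 < legendreJ n (hf n m) (cosh e).
  by rewrite legendreJ_gt0 ?(ltW (hf_gt0 _ _)).
rewrite torLE // -natrD -/(hf n m) -mulrA lerD2r ler_pM2l // ler_pM2l //.
rewrite ler_pdivlMr // mulrC ler_pdivrMr; last lra.
by rewrite mulrC; exact: legendreJ_shift_ge.
Qed.

(** For m = 0 consecutive normalising constants have ratio 1/2, which halves the factor of
    [legendreJ_contract]; the result is below 1. *)
Lemma torQ0_contract n e : 0 < e -> torQ n.+1 0 e <= 2 / (cosh e + 1) * torQ n 0 e.
Proof.
move=> e0; have c1 := cosh_gt1 e0.
rewrite !torQE // !expr0 !mulr1 cst_rec /hf !addn0 dblE.
have c0 : 0 < cst n 0 by have := cst_sign n 0; rewrite expr0 mul1r.
have -> : (n%:R + 2^-1) / (2 * n%:R + 1) = 2^-1 :> R.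
  by field; rewrite gt_eqF // ltr_wpDl // mulr_ge0.
have -> : 2 / (cosh e + 1) * (cst n 0 * legendreJ n (n%:R + 2^-1) (cosh e)) =
  cst n 0 * 2^-1 * (4 / (cosh e + 1) * legendreJ n (n%:R + 2^-1) (cosh e)).
  by field; rewrite gt_eqF //; lra.
rewrite ler_pM2l; last by rewrite mulr_gt0 // invr_gt0.
have -> : n.+1%:R + 2^-1 = n%:R + 2^-1 + 1 :> R by rewrite -natr1; ring.
exact: legendreJ_contract.
Qed.

(** The weight is the one that [wronskian_blowup] asks for: sinh is the factor of the Wronskian, and
    sinh * Q^2 has to stay bounded. *)
Lemma torQ_bound n m : exists K, forall e, 0 < e -> 2 <= cosh e ->
  Num.sqrt (sinh e) * `|torQ n m e| <= K.
Proof.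
exists (`|cst n m| * (2 `^ hf n m * legendreJ n 0 2)) => e e0 c2.
have s0 := sinh_gt0 e0; have c1 := cosh_gt1 e0; have c0 := cosh_gt0 e.
have h0 := ltW (hf_gt0 n m).
have I0 : 0 <= legendreJ n 0 2 :> R by rewrite ltW // legendreJ_gt0 // ltr1n.
have J0 : 0 < legendreJ n (hf n m) (cosh e) by rewrite legendreJ_gt0.
have sc : sinh e <= cosh e.
  exact: sinh_le_cosh.
have JJ : legendreJ n 0 (cosh e) = legendreJ n 0 2.
  by rewrite legendreJ.unlock; apply: eq_Rintegral => x _; rewrite !jterm.unlock oppr0 !powRr0.
have J1 : legendreJ n (hf n m) (cosh e) <= (cosh e - 1) `^ (- hf n m) * legendreJ n 0 2.
  rewrite -JJ; apply: legendreJ_le => // x.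
  rewrite jterm.unlock oppr0 powRr0 mulr1 mulrC ler_wpM2r //.
    by rewrite -mul2n exprM exprn_ge0 // sqr_ge0.
  by apply: powR_neg_le => //; [rewrite subr_gt0|rewrite lerD2l lerN2 sin_le1].
have sJ0 : 0 < sinh e ^+ m * legendreJ n (hf n m) (cosh e).
  by rewrite mulr_gt0 // exprn_gt0.
rewrite torQE // -mulrA normrM (gtr0_norm sJ0).
rewrite [leLHS](_ : _ = `|cst n m| *
    (Num.sqrt (sinh e) * (sinh e ^+ m * legendreJ n (hf n m) (cosh e)))); last by ring.
apply: ler_wpM2l; first exact: normr_ge0.
apply: (@le_trans _ _ ((Num.sqrt (sinh e) * (sinh e ^+ m * (cosh e - 1) `^ (- hf n m)))
    * legendreJ n 0 2)).
  rewrite -!mulrA; apply: ler_wpM2l; first exact: sqrtr_ge0.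
  by apply: ler_wpM2l; first by rewrite exprn_ge0 // ltW.
apply: ler_wpM2r => //; apply: powR_half_bound => //.
by rewrite /hf lerD2r ler_nat leq_addl.
Qed.

(** Legendre's equation in self-adjoint form, obtained by composing the raising and the lowering
    relation. *)
Lemma is_derive_sinh_dtorQ n m e : 0 < e ->
  is_derive e 1 (fun e => sinh e * dtorQ n m e)
    ((n%:R ^+ 2 - 4^-1 + m%:R ^+ 2 / sinh e ^+ 2) * sinh e * torQ n m e).
Proof.
move=> e0; have s0 := sinh_gt0 e0.
have h1 := is_derive_torQ n m e0; have h2 := is_derive_torQ n.+1 m e0.
have h : is_derive e 1 (fun e => (n%:R - m%:R + 2^-1) * torQ n.+1 m e -
    (n%:R + 2^-1) * cosh e * torQ n m e)
    ((n%:R ^+ 2 - 4^-1 + m%:R ^+ 2 / sinh e ^+ 2) * sinh e * torQ n m e).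
  apply: is_derive_eq.
  have c2 : cosh e ^+ 2 = 1 + sinh e ^+ 2 by rewrite -(cosh2B e); ring.
  have E1 := dtorQ_succ n m e0.
  have E2 : sinh e * dtorQ n m e = (n%:R - m%:R + 2^-1) * torQ n.+1 m e -
    (n%:R + 2^-1) * cosh e * torQ n m e by rewrite /dtorQ mulrC divfK // gt_eqF.
  apply: (mulfI (_ : sinh e != 0)); first by rewrite gt_eqF.
  rewrite /GRing.scale /= ?mulr0 ?addr0.
  move: (torQ n m e) (torQ n.+1 m e) (dtorQ n m e) (dtorQ n.+1 m e) E1 E2 c2.
  move: (sinh e) (cosh e) s0 (n%:R) (m%:R) => s c s0 x y q q' d d' E1 E2 c2.
  transitivity ((x - y + 2^-1) * (s * d') - (x + 2^-1) * (s ^+ 2 * q + c * (s * d))).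
    by ring.
  rewrite E1 E2.
  transitivity (q * ((x + 2^-1) ^+ 2 * c ^+ 2 - (x + 2^-1) ^+ 2 + y ^+ 2
    - (x + 2^-1) * s ^+ 2)); first by ring.
  by rewrite c2; field; rewrite gt_eqF.
apply: near_eq_is_derive h => //.
apply: filterS (near_gt0 e0) => x x0.
by rewrite /dtorQ [RHS]mulrC divfK // gt_eqF // sinh_gt0.
Qed.

Lemma torL_gt0 n e : 0 < e -> 0 < torL n 0 e.
Proof.
move=> e0; have s0 := sinh_gt0 e0; have c1 := cosh_gt1 e0.
apply: lt_le_trans (torL_ge n 0 e0); rewrite mul0r subr0 mulr_gt0 //.
by rewrite divr_gt0 //; lra.
Qed.

End toroidalQ.

(** * Wronskian arguments for the Legendre equation *)

Lemma derive_ge_growth {R : realType} (f df : R -> R) (a k : R) :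
  (forall x, a <= x -> is_derive x 1 f (df x)) -> (forall x, a <= x -> k <= df x) ->
  forall b, a <= b -> f a + k * (b - a) <= f b.
Proof.
move=> h hk b; rewrite le_eqVlt => /predU1P[->|ab]; first by rewrite subrr mulr0 addr0.
have [||x xab E] := @MVT R f df a b ab.
- by move=> x; rewrite in_itv /= => /andP[/ltW ax _]; exact: h.
- apply: derivable_within_continuous => x; rewrite in_itv /= => /andP[ax _].
  by case: (h x ax).
move: xab; rewrite in_itv /= => /andP[/ltW ax _].
rewrite -lerBrDl E ler_wpM2r ?hk // subr_ge0 ltW //.
Qed.

(* If W = s (A' G - A G') stays above c > 0, then u = A / G satisfies
   u' >= c / (s G^2) >= c u^2 / M^2, so that u blows up in finite time. *)
Lemma wronskian_blowup {R : realType} (A G dA dG : R -> R) (e1 c M : R) :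
  0 < e1 -> 0 < c -> 0 < M ->
  (forall e, e1 <= e -> is_derive e 1 A (dA e)) ->
  (forall e, e1 <= e -> is_derive e 1 G (dG e)) ->
  (forall e, e1 <= e -> 0 < G e) ->
  (forall e, e1 <= e -> c <= sinh e * (dA e * G e - A e * dG e)) ->
  (forall e, e1 <= e -> Num.sqrt (sinh e) * `|A e| <= M) ->
  (forall e, e1 <= e -> Num.sqrt (sinh e) * G e <= M) -> False.
Proof.
move=> e10 c0 M0 hA hG G0 hW bA bG.
have s0 e : e1 <= e -> 0 < sinh e.
  by move=> h; apply: sinh_gt0; exact: lt_le_trans h.
pose u e := A e / G e.
pose du e := (dA e * G e - A e * dG e) / G e ^+ 2.
have hu e : e1 <= e -> is_derive e 1 u (du e).
  move=> h; have Gne : G e != 0 by rewrite gt_eqF ?G0.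
  have h1 := hA e h; have h2 := hG e h.
  have h3 := is_deriveV Gne h2.
  by rewrite /u; apply: is_derive_eq; rewrite /du /GRing.scale /=; field.
have du_ge e : e1 <= e -> c / M ^+ 2 <= du e.
  move=> h; have s := s0 e h; have g := G0 e h.
  have k1 : sinh e * G e ^+ 2 <= M ^+ 2.
    rewrite -[sinh e]sqr_sqrtr ?(ltW s) // -exprMn lerXn2r ?nnegrE ?(ltW M0) ?bG //.
    by rewrite mulr_ge0 ?sqrtr_ge0 // ltW.
  have sG0 : 0 < sinh e * G e ^+ 2 by rewrite mulr_gt0 // exprn_gt0.
  apply: (@le_trans _ _ (c / (sinh e * G e ^+ 2))).
    by rewrite ler_pM2l // lef_pV2 ?posrE // exprn_gt0.
  have -> : du e = sinh e * (dA e * G e - A e * dG e) / (sinh e * G e ^+ 2).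
    by rewrite /du; field; rewrite !gt_eqF.
  by rewrite ler_pM2r ?invr_gt0 // hW.
have k0 : 0 < c / M ^+ 2 by rewrite divr_gt0 // exprn_gt0.
have grow := derive_ge_growth hu du_ge.
(* u' >= c / M^2 brings u above 1 from e2 on, so that 1 / u may be used there. *)
pose e2 := e1 + (`|u e1| + 1) / (c / M ^+ 2).
have e12 : e1 <= e2 by rewrite lerDl divr_ge0 ?addr_ge0 // ltW.
have upos e : e2 <= e -> 1 <= u e.
  move=> h; have h' := le_trans e12 h.
  apply: le_trans (grow e h').
  have : `|u e1| + 1 <= c / M ^+ 2 * (e - e1).
    by rewrite mulrC -ler_pdivrMr // lerBrDl.
  have := ler_norm (- u e1); rewrite normrN; lra.
pose v e := - (u e)^-1.
have hv e : e2 <= e -> is_derive e 1 v (du e / u e ^+ 2).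
  move=> h; have h1 := hu e (le_trans e12 h).
  have une : u e != 0 by rewrite gt_eqF // (lt_le_trans ltr01) ?upos.
  have h3 := is_deriveV une h1.
  by rewrite /v; apply: is_derive_eq; rewrite /GRing.scale /=; field.
have dv_ge e : e2 <= e -> c / M ^+ 2 <= du e / u e ^+ 2.
  move=> h; have h' := le_trans e12 h; have s := s0 e h'; have g := G0 e h'.
  have up := lt_le_trans ltr01 (upos e h).
  have k1 : sinh e * G e ^+ 2 * u e ^+ 2 <= M ^+ 2.
    have -> : sinh e * G e ^+ 2 * u e ^+ 2 = sinh e * `|A e| ^+ 2.
      by rewrite /u real_normK ?num_real //; field; rewrite gt_eqF.
    rewrite -[sinh e]sqr_sqrtr ?(ltW s) // -exprMn; apply: lerXn2r; rewrite ?nnegrE.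
    - by apply: mulr_ge0; [exact: sqrtr_ge0|exact: normr_ge0].
    - exact: ltW.
    - exact: bA.
  have sG0 : 0 < sinh e * G e ^+ 2 * u e ^+ 2.
    by rewrite mulr_gt0 ?exprn_gt0 // mulr_gt0 // exprn_gt0.
  rewrite /du; apply: (@le_trans _ _ (c / (sinh e * G e ^+ 2 * u e ^+ 2))).
    by rewrite ler_pM2l // lef_pV2 ?posrE // exprn_gt0.
  have -> : (dA e * G e - A e * dG e) / G e ^+ 2 / u e ^+ 2 =
    sinh e * (dA e * G e - A e * dG e) / (sinh e * G e ^+ 2 * u e ^+ 2).
    by field; rewrite !gt_eqF.
  by rewrite ler_pM2r ?invr_gt0 // hW.
have grow2 := derive_ge_growth hv dv_ge.
(* By e3 the function v = -1 / u, increasing at rate at least c / M^2, would have reached 0,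
   although u stays positive. *)
pose e3 := e2 + (u e2)^-1 / (c / M ^+ 2).
have u2 : 0 < (u e2)^-1 by rewrite invr_gt0 (lt_le_trans ltr01) // upos.
have e23 : e2 <= e3 by rewrite lerDl divr_ge0 // ltW.
have := grow2 e3 e23.
have -> : c / M ^+ 2 * (e3 - e2) = (u e2)^-1 by rewrite /e3 addrAC subrr add0r mulrC divfK // gt_eqF.
rewrite /v addNr leNgt oppr_lt0 invr_gt0 => /negP; apply.
by rewrite (lt_le_trans ltr01) // upos.
Qed.

(* Otherwise the Wronskian of the two solutions, which increases, would end up
   above a positive constant. *)
Lemma torL_lt {R : realType} n m (e : R) : 0 < e -> (0 < m)%N -> torL n 0 e < torL n m e.
Proof.
move=> e0 m0.
pose A e : R := (-1) ^+ m * torQ n m e; pose dA e : R := (-1) ^+ m * dtorQ n m e.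
pose G e : R := torQ n 0 e; pose dG e : R := dtorQ n 0 e.
have A0 (x : R) : 0 < x -> 0 < A x by exact: torQ_sign.
have G0 (x : R) : 0 < x -> 0 < G x by move=> /(torQ_sign n 0); rewrite expr0 mul1r.
have hA (x : R) : 0 < x -> is_derive x 1 A (dA x).
  by move=> x0; have h := is_derive_torQ n m x0; rewrite /A; apply: is_derive_eq.
have hG (x : R) : 0 < x -> is_derive x 1 G (dG x) by move=> x0; exact: is_derive_torQ.
pose W x := sinh x * (dA x * G x - A x * dG x).
(* The self-adjoint equations of orders m and 0 differ only by the term m^2 / sinh^2, so the
   derivative of W is positive. *)
have hW (x : R) : 0 < x -> is_derive x 1 W (m%:R ^+ 2 / sinh x * A x * G x).
  move=> x0; have s0 := sinh_gt0 x0.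
  have h1 := is_derive_sinh_dtorQ n m x0; have h2 := is_derive_sinh_dtorQ n 0 x0.
  have h3 := hA x x0; have h4 := hG x x0.
  have -> : W = fun x => (-1) ^+ m * (sinh x * dtorQ n m x) * G x -
     A x * (sinh x * dtorQ n 0 x).
    by apply/funext => y; rewrite /W /dA /dG; ring.
  apply: is_derive_eq; rewrite /GRing.scale /= /A /dA /G /dG.
  move: (_ ^+ _) (sinh x) (dtorQ n m x) (dtorQ n 0 x) (torQ n m x) (torQ n 0 x) s0.
  by move=> p s d d' q q' s0; field; rewrite gt_eqF.
rewrite /torL ltrN2 -subr_gt0.
have -> : dtorQ n 0 e / torQ n 0 e - dtorQ n m e / torQ n m e =
    - W e / (sinh e * (A e * G e)).
  have := torQ_neq0 n m e0; have := torQ_neq0 n 0 e0; have := sinh_gt0 e0.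
  have : (-1) ^+ m != 0 :> R by rewrite signr_eq0.
  rewrite /W /A /dA /G /dG.
  move: (_ ^+ _) (sinh e) (dtorQ n m e) (dtorQ n 0 e) (torQ n m e) (torQ n 0 e).
  move=> p s d d' q q' p0 s0 q0 q0'.
  by field; rewrite q0 q0' p0 gt_eqF.
have AG0 : 0 < sinh e * (A e * G e).
  by apply: mulr_gt0; [exact: sinh_gt0|apply: mulr_gt0; [exact: A0|exact: G0]].
rewrite divr_gt0 // oppr_gt0 ltNge; apply/negP => W0.
have Winc (x y : R) : 0 < x -> x < y -> W x < W y.
  move=> x0 xy.
  have [||z zxy E] := @MVT R W (fun x => m%:R ^+ 2 / sinh x * A x * G x) x y xy.
  - by move=> z; rewrite in_itv /= => /andP[xz _]; apply: hW; exact: lt_trans xz.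
  - apply: derivable_within_continuous => z; rewrite in_itv /= => /andP[xz _].
    by case: (hW z (lt_le_trans x0 xz)).
  have z0 : 0 < z by move: zxy; rewrite in_itv /= => /andP[xz _]; exact: lt_trans xz.
  rewrite -subr_gt0 E mulr_gt0 ?subr_gt0 // mulr_gt0 ?G0 // mulr_gt0 ?A0 //.
  by rewrite divr_gt0 ?sinh_gt0 // exprn_gt0 // ltr0n.
have [e1 e10 e1P] := @cosh_ge2 R.
have [K1 K1P] := @torQ_bound R n m; have [K2 K2P] := @torQ_bound R n 0.
pose e2 := e1 + e + 1.
have e20 : 0 < e2 by rewrite /e2; lra.
apply: (@wronskian_blowup R A G dA dG e2 (W e2) (`|K1| + `|K2| + 1)) => //.
- by apply: (le_lt_trans W0); apply: Winc => //; rewrite /e2; lra.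
- by move=> x h; apply: hA; exact: lt_le_trans h.
- by move=> x h; apply: hG; exact: lt_le_trans h.
- by move=> x h; apply: G0; exact: lt_le_trans h.
- move=> x; rewrite -/(W x) le_eqVlt => /predU1P[<-//|h].
  by rewrite ltW // Winc.
- move=> x h; rewrite /A normrM normrX normrN1 expr1n mul1r.
  apply: (le_trans (K1P x _ _)); first exact: lt_le_trans h.
    by apply: e1P; apply: le_trans h; rewrite /e2; lra.
  by apply: (le_trans (ler_norm _)); have := normr_ge0 K2; lra.
- move=> x h; rewrite -[G x]gtr0_norm ?G0 //; last exact: lt_le_trans h.
  apply: (le_trans (K2P x _ _)); first exact: lt_le_trans h.
    by apply: e1P; apply: le_trans h; rewrite /e2; lra.
  by apply: (le_trans (ler_norm _)); have := normr_ge0 K1; lra.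
Qed.

(** * The chain rule in space and toroidal coordinates *)

Section space.
Context {R : realType}.
Implicit Types (a b c : R) (x y : 'rV[R]_3).

Definition row3 a b c : 'rV[R]_3 := \row_(i < 3) nth 0 [:: a; b; c] i.

Definition i0 : 'I_3 := @Ordinal 3 0 isT.
Definition i1 : 'I_3 := @Ordinal 3 1 isT.
Definition i2 : 'I_3 := @Ordinal 3 2 isT.

Lemma ord3P (P : 'I_3 -> Prop) : P i0 -> P i1 -> P i2 -> forall i, P i.
Proof.
move=> h0 h1 h2 [[|[|[|k]]] hk] //.
- by rewrite (_ : Ordinal hk = i0) //; apply: val_inj.
- by rewrite (_ : Ordinal hk = i1) //; apply: val_inj.
- by rewrite (_ : Ordinal hk = i2) //; apply: val_inj.
Qed.

Lemma row3E x : x = row3 (x 0 i0) (x 0 i1) (x 0 i2).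
Proof. by apply/rowP; apply: ord3P; rewrite mxE. Qed.

Lemma sum3 (F : 'I_3 -> R) : \sum_i F i = F i0 + F i1 + F i2.
Proof.
rewrite !big_ord_recl big_ord0 addr0 addrA.
by congr (F _ + F _ + F _); apply: val_inj.
Qed.

Lemma nbhs_row x (A : set 'rV[R]_3) (B : 'I_3 -> set R) :
  (forall i, nbhs (x 0 i) (B i)) -> (forall y, (forall i, B i (y 0 i)) -> A y) ->
  nbhs x A.
Proof.
move=> hB hA; exists (fun _ i => B i) => [i j|y hy]; last by apply: hA => i; exact: hy.
by rewrite ord1; exact: hB.
Qed.

Lemma nbhs_row_box x (A : set 'rV[R]_3) : nbhs x A ->
  exists2 r, 0 < r & forall y, (forall i, `|x 0 i - y 0 i| < r) -> A y.
Proof.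
move=> /nbhs_ballP[r /= r0 hr]; exists r => // y hy; apply: hr; split => // i j.
by rewrite ord1; exact: hy.
Qed.

Lemma continuous_row3 (T : topologicalType) (g : T -> 'rV[R]_3) (z : T) :
  (forall i, {for z, continuous (fun t => g t 0 i)}) -> {for z, continuous g}.
Proof.
move=> h A /nbhs_row_box[r r0 hr].
have H i : \forall t \near z, `|g z 0 i - g t 0 i| < r.
  by have /cvgrPdist_lt := h i; apply.
by near=> t; apply: hr; apply: ord3P; near: t; exact: H.
Unshelve. all: by end_near. Qed.

Lemma is_derive_coord (u : 'rV[R]_3 -> R) (y : 'rV[R]_3) (g : R -> 'rV[R]_3) (i : 'I_3) a :
  (forall h, g (h + a) = h *: delta_mx 0 i + y) ->
  derivable u y (delta_mx 0 i) -> is_derive a 1 (u \o g) (partial i u y).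
Proof.
move=> hg hu.
have ga : g a = y by rewrite -[a]add0r hg scale0r add0r.
have E : (fun h : R => h^-1 *: ((u \o g) (h *: (1 : R^o) + a) - (u \o g) a)) =
  (fun h => h^-1 *: (u (h *: delta_mx 0 i + y) - u y)).
  by apply/funext => h; rewrite /= /GRing.scale /= mulr1 hg ga.
by apply: DeriveDef; [rewrite /derivable E|rewrite /derive E].
Qed.

(** The mean value theorem applied to g minus a linear function; the hypotheses are put on a ball
    around a so that a and b may come in either order. *)
Lemma mvt_dist (g dg : R -> R) a b k e :
  (forall t, `|t - a| <= `|b - a| -> is_derive t 1 g (dg t)) ->
  (forall t, `|t - a| <= `|b - a| -> `|dg t - k| <= e) ->
  `|g b - g a - k * (b - a)| <= e * `|b - a|.
Proof.
move=> hg hk.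
pose f t := g t - k * t.
have hf t : `|t - a| <= `|b - a| -> is_derive t 1 f (dg t - k).
  by move=> h; have h' := hg t h; rewrite /f; apply: is_derive_eq;
    rewrite /GRing.scale /=; ring.
have -> : g b - g a - k * (b - a) = f b - f a by rewrite /f; ring.
have [ab|ba|->] := ltgtP a b; last by rewrite !subrr normr0 mulr0.
- have ba0 : 0 < b - a by rewrite subr_gt0.
  have I t : a <= t <= b -> `|t - a| <= `|b - a|.
    by move=> /andP[h1 h2]; rewrite !ger0_norm ?subr_ge0 ?(ltW ab) // lerD2r.
  have [||t tab ->] := @MVT R f (fun t => dg t - k) a b ab.
  + by move=> t; rewrite in_itv /= => /andP[h1 h2]; apply: hf; apply: I; rewrite !ltW.
  + apply: derivable_within_continuous => t; rewrite in_itv /= => h.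
    by case: (hf t (I t h)).
  move: tab; rewrite in_itv /= => /andP[h1 h2].
  by rewrite normrM ler_wpM2r // hk // I // !ltW.
- have I t : b <= t <= a -> `|t - a| <= `|b - a|.
    by move=> /andP[h1 h2]; rewrite distrC (distrC b) !ger0_norm ?subr_ge0 ?(ltW ba) // lerD2l lerN2.
  have [||t tab E] := @MVT R f (fun t => dg t - k) b a ba.
  + by move=> t; rewrite in_itv /= => /andP[h1 h2]; apply: hf; apply: I; rewrite !ltW.
  + apply: derivable_within_continuous => t; rewrite in_itv /= => h.
    by case: (hf t (I t h)).
  move: tab; rewrite in_itv /= => /andP[h1 h2].
  by rewrite distrC E normrM (distrC b) ler_wpM2r // hk // I // !ltW.
Qed.

Definition C1_at (u : 'rV[R]_3 -> R) x : Prop :=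
  (\forall y \near x, forall i, derivable u y (delta_mx 0 i)) /\
  forall i, {for x, continuous (partial i u)}.

(** Harmonicity is stated with directional derivatives, while the chain rule needs a linear
    approximation. It is found by going from x to y along three coordinate segments, with the mean
    value theorem on each and continuity of the partial derivatives at x. *)
Lemma C1_frechet u x (e : R) : C1_at u x -> 0 < e ->
  \forall y \near x, `|u y - u x - \sum_i partial i u x * (y 0 i - x 0 i)| <=
     e * \sum_i `|y 0 i - x 0 i|.
Proof.
move=> [hd hc] e0.
have : \forall y \near x, (forall i, derivable u y (delta_mx 0 i)) /\
   (forall i, `|partial i u y - partial i u x| <= e).
  have H i : \forall y \near x, `|partial i u y - partial i u x| <= e.
    have /cvgrPdist_le /(_ _ e0) := hc i.
    by apply: filterS => y; rewrite distrC.
  apply: filterS2 (hd) (filterI (H i0) (filterI (H i1) (H i2))) => y h1 [h2 [h3 h4]].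
  split; first exact: h1.
  exact: (@ord3P (fun i => `|partial i u y - partial i u x| <= e)).
move=> /nbhs_row_box[r r0 hr].
apply: (@nbhs_row x _ (fun i => [set t | `|x 0 i - t| < r])).
  by move=> i; apply/nbhs_ballP; exists r.
move=> y hy.
pose X i := x 0 i; pose Y i := y 0 i.
have box a b c : `|X i0 - a| < r -> `|X i1 - b| < r -> `|X i2 - c| < r ->
  (forall i, derivable u (row3 a b c) (delta_mx 0 i)) /\
  (forall i, `|partial i u (row3 a b c) - partial i u x| <= e).
  by move=> h0 h1 h2; apply: hr; apply: ord3P; rewrite mxE.
have D i t : `|t - X i| <= `|Y i - X i| -> `|X i - t| < r.
  by move=> h; rewrite distrC (le_lt_trans h) // distrC; exact: hy.
have Z i : `|X i - X i| < r by rewrite subrr normr0.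
have R0 h a b c : row3 (h + a) b c = h *: delta_mx 0 i0 + row3 a b c.
  by apply/rowP; apply: ord3P; rewrite !mxE /= ?mulr1 ?mulr0 ?add0r.
have R1 h a b c : row3 a (h + b) c = h *: delta_mx 0 i1 + row3 a b c.
  by apply/rowP; apply: ord3P; rewrite !mxE /= ?mulr1 ?mulr0 ?add0r.
have R2 h a b c : row3 a b (h + c) = h *: delta_mx 0 i2 + row3 a b c.
  by apply/rowP; apply: ord3P; rewrite !mxE /= ?mulr1 ?mulr0 ?add0r.
have S0 : `|u (row3 (Y i0) (X i1) (X i2)) - u (row3 (X i0) (X i1) (X i2)) -
    partial i0 u x * (Y i0 - X i0)| <= e * `|Y i0 - X i0|.
  apply: (@mvt_dist (fun t => u (row3 t (X i1) (X i2)))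
     (fun t => partial i0 u (row3 t (X i1) (X i2)))) => t /D ht.
    by apply: (@is_derive_coord u _ (fun t => row3 t (X i1) (X i2)) i0) => //;
      exact: (box _ _ _ _ _ _).1.
  exact: (box _ _ _ _ _ _).2.
have S1 : `|u (row3 (Y i0) (Y i1) (X i2)) - u (row3 (Y i0) (X i1) (X i2)) -
    partial i1 u x * (Y i1 - X i1)| <= e * `|Y i1 - X i1|.
  apply: (@mvt_dist (fun t => u (row3 (Y i0) t (X i2)))
     (fun t => partial i1 u (row3 (Y i0) t (X i2)))) => t /D ht.
    by apply: (@is_derive_coord u _ (fun t => row3 (Y i0) t (X i2)) i1) => //;
      exact: (box _ _ _ (hy _) _ _).1.
  exact: (box _ _ _ (hy _) _ _).2.
have S2 : `|u (row3 (Y i0) (Y i1) (Y i2)) - u (row3 (Y i0) (Y i1) (X i2)) -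
    partial i2 u x * (Y i2 - X i2)| <= e * `|Y i2 - X i2|.
  apply: (@mvt_dist (fun t => u (row3 (Y i0) (Y i1) t))
     (fun t => partial i2 u (row3 (Y i0) (Y i1) t))) => t /D ht.
    by apply: (@is_derive_coord u _ (fun t => row3 (Y i0) (Y i1) t) i2) => //;
      exact: (box _ _ _ (hy _) (hy _) _).1.
  exact: (box _ _ _ (hy _) (hy _) _).2.
have Ey : y = row3 (Y i0) (Y i1) (Y i2) by exact: row3E.
have Ex : x = row3 (X i0) (X i1) (X i2) by exact: row3E.
rewrite {1}Ey {1}Ex !sum3 -/(Y i0) -/(Y i1) -/(Y i2) -/(X i0) -/(X i1) -/(X i2).
move: S0 S1 S2.
move: (u (row3 _ _ _)) (u (row3 _ _ _)) (u (row3 _ _ _)) (u (row3 _ _ _)) => A0 A1 A2 A3.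
move: (partial i0 u x) (partial i1 u x) (partial i2 u x) => p0 p1 p2.
move: (Y i0 - X i0) (Y i1 - X i1) (Y i2 - X i2) => d0 d1 d2.
rewrite !mulrDr => S0 S1 S2.
apply: le_trans (lerD (lerD S0 S1) S2).
apply: le_trans (lerD (ler_normD _ _) (lexx _)).
apply: le_trans (ler_normD _ _).
by rewrite le_eqVlt; apply/orP; left; apply/eqP; congr (`|_|); ring.
Qed.

Lemma is_derive_curve u (g dg : R -> 'rV[R]_3) (t : R) : C1_at u (g t) ->
  (forall i, is_derive t 1 (fun s => g s 0 i) (dg t 0 i)) ->
  is_derive t 1 (u \o g) (\sum_i partial i u (g t) * dg t 0 i).
Proof.
move=> hu hg.
have cg : {for t, continuous g}.
  by apply: continuous_row3 => i; exact: is_derive_continuous (hg i).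
pose q (i : 'I_3) h : R := h^-1 * (g (h + t) 0 i - g t 0 i).
have hq i : q i h @[h --> 0^'] --> dg t 0 i.
  have [d <-] := hg i; rewrite /derive /q.
  have E : (fun h : R => h^-1 *: (g (h *: (1 : R^o) + t) 0 i - g t 0 i)) =
    (fun h => h^-1 * (g (h + t) 0 i - g t 0 i)).
    by apply/funext => h; rewrite /GRing.scale /= mulr1.
  rewrite E; move: d; rewrite /derivable E; exact.
have lim : (u (g (h + t)) - u (g t)) / h @[h --> 0^'] -->
    \sum_i partial i u (g t) * dg t 0 i.
  have L : \sum_i partial i u (g t) * q i h @[h --> 0^'] -->
      \sum_i partial i u (g t) * dg t 0 i.
    rewrite sum3; under eq_fun do rewrite sum3.
    by apply: cvgD; [apply: cvgD|]; (apply: cvgM; [exact: cvg_cst|exact: hq]).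
  suff D : (u (g (h + t)) - u (g t)) / h - \sum_i partial i u (g t) * q i h
      @[h --> 0^'] --> (0 : R).
    rewrite -[X in _ --> X]add0r (_ : (fun h => _) = (fun h => ((u (g (h + t)) - u (g t)) / h -
      \sum_i partial i u (g t) * q i h) + \sum_i partial i u (g t) * q i h)).
      exact: cvgD D L.
    by apply/funext => h; rewrite subrK.
  (* K bounds the sum of the difference quotients |q i h| near 0, so a remainder (e / K) times the
     sum of the increments is at most e |h|. *)
  pose K : R := \sum_i (`|dg t 0 i| + 1).
  have K0 : 0 < K.
    have H z : 0 < `|z : R| + 1 by rewrite ltr_wpDl.
    by rewrite /K sum3; apply: addr_gt0 (H _); apply: addr_gt0 (H _) (H _).
  apply/cvgr0Pnorm_le => e e0.
  have e'0 : 0 < e / K by rewrite divr_gt0.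
  have F := C1_frechet hu e'0.
  have cg0 : g (h + t) @[h --> 0^'] --> g t.
    have c0 : h + t @[h --> 0^'] --> t.
      rewrite -[X in _ --> X]add0r; apply: cvgD; last exact: cvg_cst.
      exact: nbhs_dnbhs.
    by move=> A hA; exact: (c0 _ (cg A hA)).
  have qb i : \forall h \near 0^', `|q i h| <= `|dg t 0 i| + 1.
    have /cvgrPdist_le /(_ _ ltr01) := hq i; apply: filterS => h hh.
    rewrite -[q i h](subrK (dg t 0 i)) (le_trans (ler_normD _ _)) // addrC lerD2l.
    by rewrite distrC.
  have F' := cg0 _ F.
  near=> h.
  have h0 : h != 0 by near: h; exact: nbhs_dnbhs_neq.
  have Fh : `|u (g (h + t)) - u (g t) - \sum_i partial i u (g t) *
      (g (h + t) 0 i - g t 0 i)| <= e / K * \sum_i `|g (h + t) 0 i - g t 0 i|.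
    by near: h; exact: F'.
  have E : (u (g (h + t)) - u (g t)) / h - \sum_i partial i u (g t) * q i h =
    h^-1 * (u (g (h + t)) - u (g t) - \sum_i partial i u (g t) *
      (g (h + t) 0 i - g t 0 i)).
    rewrite mulrBr mulr_sumr mulrC; congr (_ - _).
    by apply: eq_bigr => i _; rewrite /q mulrCA.
  rewrite E normrM normfV mulrC ler_pdivrMr ?normr_gt0 //.
  apply: (le_trans Fh); rewrite -mulrA ler_wpM2l ?(ltW e0) //.
  rewrite ler_pdivrMl //; apply: (@le_trans _ _ (\sum_i `|q i h| * `|h|)).
    rewrite le_eqVlt; apply/orP; left; apply/eqP; apply: eq_bigr => i _.
    by rewrite /q normrM normfV mulrAC mulVf ?mul1r // normr_eq0.
  rewrite -mulr_suml ler_wpM2r // ler_sum // => i _.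
  by move: i; apply: ord3P; near: h; exact: qb.
have E : (fun h : R => h^-1 *: ((u \o g) (h *: (1 : R^o) + t) - (u \o g) t)) =
    (fun h => (u (g (h + t)) - u (g t)) / h).
  by apply/funext => h; rewrite /= /GRing.scale /= mulr1 mulrC.
apply: DeriveDef; first by rewrite /derivable E; apply/cvg_ex; eexists; exact: lim.
by rewrite /derive E; apply: cvg_lim.
Unshelve. all: by end_near. Qed.

Lemma is_derive_curve2 u (g dg ddg : R -> 'rV[R]_3) (t : R) :
  C1_at u (g t) -> (forall i, C1_at (partial i u) (g t)) ->
  (forall i, is_derive t 1 (fun s => g s 0 i) (dg t 0 i)) ->
  (forall i, is_derive t 1 (fun s => dg s 0 i) (ddg t 0 i)) ->
  is_derive t 1 (fun s => \sum_i partial i u (g s) * dg s 0 i)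
    (\sum_i ((\sum_j partial j (partial i u) (g t) * dg t 0 j) * dg t 0 i +
       partial i u (g t) * ddg t 0 i)).
Proof.
move=> hu hpu hg hdg.
under eq_fun do rewrite sum3; rewrite sum3.
have H i : is_derive t 1 (fun s => partial i u (g s) * dg s 0 i)
   ((\sum_j partial j (partial i u) (g t) * dg t 0 j) * dg t 0 i +
       partial i u (g t) * ddg t 0 i).
  have h1 := is_derive_curve (hpu i) hg; have h2 := hdg i.
  by apply: is_derive_eq; rewrite /GRing.scale /=; ring.
have h0 := H i0; have h1 := H i1; have h2 := H i2.
exact: is_deriveD.
Qed.

End space.

(** * Toroidal coordinates and the topology of the solid torus *)

Section geometry.
Context {R : realType}.
Implicit Types (x : 'rV[R]_3) (e t p : R).

Lemma polar_angle (a b : R) : a ^+ 2 + b ^+ 2 = 1 ->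
  exists2 y : R, - pi < y <= pi & cos y = a /\ sin y = b.
Proof.
move=> ab.
have a1 : -1 <= a <= 1.
  rewrite -ler_norml -sqrtr_sqr -[leRHS]sqrtr1 ler_wsqrtr //.
  by rewrite -ab lerDl sqr_ge0.
have sE : sin (acos a) = `|b|.
  by rewrite sin_acos // -sqrtr_sqr -ab; congr Num.sqrt; ring.
have pi0 : 0 < pi :> R := pi_gt0 R.
have [b0|b0] := leP 0 b.
  exists (acos a); first by rewrite acos_lepi // andbT (lt_le_trans _ (acos_ge0 a1)) // oppr_lt0.
  by rewrite acosK // sE ger0_norm.
exists (- acos a).
  rewrite ltrN2 lt_neqAle acos_lepi // andbT; apply/andP; split.
    apply/eqP => E; move: sE; rewrite E sinpi => /esym/eqP; rewrite normr_eq0 => /eqP h.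
    by move: b0; rewrite h ltxx.
  by rewrite lerNl (le_trans _ (acos_ge0 a1)) // oppr_le0 ltW.
by rewrite cosN sinN acosK // sE ltr0_norm // opprK.
Qed.

Lemma sinhB e e' : sinh (e - e') = sinh e * cosh e' - cosh e * sinh e' :> R.
Proof.
by rewrite /sinh /cosh opprB expRD (expRD e'); field.
Qed.

Lemma sinhN e : sinh (- e) = - sinh e :> R.
Proof. by rewrite /sinh opprK -mulNr opprB. Qed.

Lemma sinh_gt0E e : (0 < sinh e) = (0 < e).
Proof.
apply/idP/idP => [|/sinh_gt0 //]; apply: contraLR; rewrite -!leNgt.
rewrite le_eqVlt => /orP[/eqP->|e0].
  by rewrite /sinh oppr0 subrr mul0r.
by rewrite ltW // -oppr_gt0 -sinhN sinh_gt0 // oppr_gt0.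
Qed.

Lemma sinh_eq0 e : (sinh e == 0) = (e == 0).
Proof.
rewrite !eq_le -[RHS](@negbK (_ && _)) negb_and -!ltNge -[LHS](@negbK (_ && _)) negb_and -!ltNge.
by rewrite sinh_gt0E; congr (~~ (_ || _)); rewrite -oppr_gt0 -sinhN sinh_gt0E oppr_gt0.
Qed.

Lemma hyperbolic_angle (a b : R) : 0 < a -> 0 < b -> a ^+ 2 - b ^+ 2 = 1 ->
  exists e, cosh e = a /\ sinh e = b.
Proof.
move=> a0 b0 ab; exists (ln (a + b)).
have ab0 : a + b \is Num.pos by rewrite posrE addr_gt0.
have E : (a + b)^-1 = a - b.
  have h : (a + b) * (a - b) = 1 by rewrite -ab; ring.
  have h0 : a + b != 0 by rewrite gt_eqF // addr_gt0.
  by apply: (mulfI h0); rewrite h mulfV.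
by rewrite /cosh /sinh expRN lnK // E; split; field.
Qed.

(** The relation tanh eta = 2 r / (1 + |x|^2), cleared of denominators. Its sign describes the solid
    torus, core circle included, by one continuous function, from which openness and compactness
    follow. *)
Definition torus_gap e0 x : R :=
  2 * cosh e0 * Num.sqrt (x 0 i1 ^+ 2 + x 0 i2 ^+ 2)
  - (1 + x 0 i0 ^+ 2 + x 0 i1 ^+ 2 + x 0 i2 ^+ 2) * sinh e0.

Lemma toroidalE e t p : toroidal e t p =
  row3 (sin t / (cosh e - cos t)) (sinh e * cos p / (cosh e - cos t))
    (sinh e * sin p / (cosh e - cos t)).
Proof. by []. Qed.

Lemma denom_gt0 e t : 0 < e -> 0 < cosh e - cos t.
Proof. by move=> /cosh_gt1 h; rewrite subr_gt0 (le_lt_trans (cos_le1 t)). Qed.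

Lemma torus_gap_toroidal e0 e t p : 0 < e ->
  torus_gap e0 (toroidal e t p) = 2 / (cosh e - cos t) * sinh (e - e0).
Proof.
move=> e_gt0; rewrite toroidalE /torus_gap !mxE /= sinhB.
have h0 := denom_gt0 t e_gt0.
have s0 := sinh_gt0 e_gt0.
have cs := cosh2B e.
have ct := cos2Dsin2 t. have cp := cos2Dsin2 p.
move: (cosh e) (sinh e) (cosh e0) (sinh e0) (cos t) (sin t) (cos p) (sin p) h0 s0 cs ct cp.
move=> C S C0 S0 c s k l h0 s0 cs ct cp.
have -> : (S * k / (C - c)) ^+ 2 + (S * l / (C - c)) ^+ 2 = (S / (C - c)) ^+ 2.
  rewrite -[RHS]mulr1 -cp; ring.
rewrite sqrtr_sqr gtr0_norm ?divr_gt0 //.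
have -> : 1 + (s / (C - c)) ^+ 2 + (S * k / (C - c)) ^+ 2 + (S * l / (C - c)) ^+ 2
   = 1 + (s ^+ 2 + S ^+ 2 * (k ^+ 2 + l ^+ 2)) / (C - c) ^+ 2.
  by field; rewrite gt_eqF.
rewrite cp.
have -> : s ^+ 2 = 1 - c ^+ 2 by rewrite -ct; ring.
have -> : S ^+ 2 = C ^+ 2 - 1 by rewrite -cs; ring.
by field; rewrite gt_eqF.
Qed.

(** With d^2 = (r^2 + z^2 - 1)^2 + 4 z^2, which vanishes only on the core circle, cosh e = (r^2 +
    z^2 + 1) / d, sinh e = 2 r / d, cos t = (r^2 + z^2 - 1) / d and sin t = 2 z / d. The assumption
    on the gap excludes the axis r = 0, where sinh e would vanish. *)
Lemma toroidal_inverse e0 x : 0 < e0 -> 0 <= torus_gap e0 x ->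
  (x 0 i0 = 0 /\ x 0 i1 ^+ 2 + x 0 i2 ^+ 2 = 1) \/
  exists e t p, [/\ 0 < e, angles t p & x = toroidal e t p].
Proof.
move=> e00 gap.
have [s0 c0] := (sinh_gt0 e00, cosh_gt0 e0).
pose r := Num.sqrt (x 0 i1 ^+ 2 + x 0 i2 ^+ 2).
have r2 : r ^+ 2 = x 0 i1 ^+ 2 + x 0 i2 ^+ 2 by rewrite sqr_sqrtr // addr_ge0 // sqr_ge0.
have r0 : 0 < r.
  rewrite lt_neqAle sqrtr_ge0 andbT eq_sym; apply/eqP => h.
  move: gap; rewrite /torus_gap -/r h mulr0 sub0r oppr_ge0.
  apply/negP; rewrite -ltNge; apply: mulr_gt0 => //.
  by rewrite -!addrA ltr_wpDr // !addr_ge0 // sqr_ge0.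
set z := x 0 i0 in gap *.
have [[hz hr]|hne] := pselect (z = 0 /\ x 0 i1 ^+ 2 + x 0 i2 ^+ 2 = 1); [by left|right].
pose D := (r ^+ 2 + z ^+ 2 - 1) ^+ 2 + 4 * z ^+ 2.
have D0 : 0 < D.
  have h1 := sqr_ge0 (r ^+ 2 + z ^+ 2 - 1); have h2 := sqr_ge0 z.
  rewrite /D lt0r; apply/andP; split; last by rewrite addr_ge0 // mulr_ge0.
  apply/negP; rewrite (paddr_eq0 h1) ?(mulr_ge0 _ h2) // => /andP[/eqP h3 /eqP h4]; apply: hne.
  have z0 : z = 0 by apply/eqP; rewrite -sqrf_eq0; apply/eqP; lra.
  split=> //; rewrite -r2; move/eqP: h3; rewrite sqrf_eq0 z0 => /eqP; lra.
pose d := Num.sqrt D.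
have d0 : 0 < d by rewrite sqrtr_gt0.
have d2 : d ^+ 2 = D by rewrite sqr_sqrtr // ltW.
have dn : d != 0 by rewrite gt_eqF.
have ha : 0 < (r ^+ 2 + z ^+ 2 + 1) / d.
  by apply: divr_gt0 d0; rewrite ltr_wpDl // addr_ge0 // sqr_ge0.
have hb : 0 < 2 * r / d by apply: divr_gt0 d0; apply: mulr_gt0.
have [|e [he1 he2]] := hyperbolic_angle ha hb.
  by rewrite !expr_div_n d2 -mulrBl /D; field; rewrite -/D gt_eqF.
have [|t /andP[ht1 ht2] [hct hst]] := @polar_angle ((r ^+ 2 + z ^+ 2 - 1) / d) (2 * z / d).
  by rewrite !expr_div_n d2 -mulrDl /D; field; rewrite -/D gt_eqF.
have [|p hp [hcp hsp]] := @polar_angle (x 0 i1 / r) (x 0 i2 / r).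
  by rewrite !expr_div_n -mulrDl -r2 divff // expf_neq0 // gt_eqF.
exists e, t, p; split.
- by rewrite -sinh_gt0E he2.
- by rewrite /angles ht2 (ltW ht1).
- have E : cosh e - cos t = 2 / d by rewrite he1 hct -mulrBl; congr (_ / _); ring.
  rewrite toroidalE E he2 hst hcp hsp [LHS]row3E -/z; congr row3.
  + by field.
  + by field; rewrite dn gt_eqF.
  + by field; rewrite dn gt_eqF.
Qed.

Lemma inordi0 : inord 0 = i0. Proof. by apply: val_inj; rewrite /= inordK. Qed.
Lemma inordi1 : inord 1 = i1. Proof. by apply: val_inj; rewrite /= inordK. Qed.
Lemma inordi2 : inord 2 = i2. Proof. by apply: val_inj; rewrite /= inordK. Qed.

Lemma sinh_lt_cosh e : sinh e < cosh e :> R.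
Proof.
rewrite /sinh /cosh ltr_pM2r ?invr_gt0 // ltrD2l.
by have := expR_gt0 (- e); lra.
Qed.

Lemma solid_torusE e0 : 0 < e0 -> solid_torus e0 = [set x : 'rV[R]_3 | 0 < torus_gap e0 x].
Proof.
move=> e00; apply/seteqP; split => x.
  rewrite /solid_torus /= inordi0 inordi1 inordi2 => -[[e [t [p [he _ ->]]]]|[h0 h12]].
    have e_gt0 : 0 < e by apply: lt_trans he.
    rewrite torus_gap_toroidal //; apply: mulr_gt0.
      by rewrite divr_gt0 // denom_gt0.
    by rewrite sinh_gt0E subr_gt0.
  rewrite /torus_gap -!addrA h12 h0 sqrtr1 expr0n /= add0r.
  by have := sinh_lt_cosh e0; lra.
move=> /= gap; have [[h0 h12]|[e [t [p [e_gt0 tp E]]]]] := toroidal_inverse e00 (ltW gap).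
  by right; rewrite inordi0 inordi1 inordi2.
left; exists e, t, p; split => //.
move: gap; rewrite E torus_gap_toroidal // pmulr_rgt0; last by rewrite divr_gt0 // denom_gt0.
by rewrite sinh_gt0E subr_gt0.
Qed.

Lemma closed_torusE e0 : 0 < e0 ->
  solid_torus e0 `|` torus e0 = [set x : 'rV[R]_3 | 0 <= torus_gap e0 x].
Proof.
move=> e00; rewrite solid_torusE //; apply/seteqP; split => x /=.
  move=> [/ltW //|[t [p [_ ->]]]].
  by rewrite torus_gap_toroidal // subrr (eqP (_ : sinh 0 == 0)) ?mulr0 // sinh_eq0.
rewrite le_eqVlt => /orP[|->]; last by left.
move=> /eqP/esym gap; right.
have [|[h0 h12]|[e [t [p [e_gt0 tp E]]]]] := toroidal_inverse e00 (_ : 0 <= torus_gap e0 x).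
- by rewrite gap.
- move: gap; rewrite /torus_gap -!addrA h12 h0 sqrtr1 expr0n /= add0r => gap.
  by have := sinh_lt_cosh e0; lra.
- exists t, p; split => //; rewrite E; congr toroidal.
  move: gap; rewrite E torus_gap_toroidal // => /eqP.
  rewrite mulf_eq0 gt_eqF ?divr_gt0 ?denom_gt0 //= sinh_eq0 subr_eq0 => /eqP //.
Qed.

Lemma toroidal_solid e0 e t p : 0 < e0 -> e0 < e -> solid_torus e0 (toroidal e t p).
Proof.
move=> e00 he; rewrite solid_torusE //=; have e_gt0 := lt_trans e00 he.
rewrite torus_gap_toroidal //; apply: mulr_gt0.
  by rewrite divr_gt0 // denom_gt0.
by rewrite sinh_gt0E subr_gt0.
Qed.

(** [torus] restricts the angles, so arbitrary t and p are first brought into the fundamental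
    range. *)
Lemma toroidal_torus e t p : torus e (toroidal e t p).
Proof.
have [|t' /andP[h1 h2] [ct st]] := @polar_angle (cos t) (sin t); first exact: cos2Dsin2.
have [|p' h [cp sp]] := @polar_angle (cos p) (sin p); first exact: cos2Dsin2.
exists t', p'; split; first by rewrite /angles h2 (ltW h1).
by rewrite !toroidalE ct st cp sp.
Qed.

Lemma continuous_torus_gap e0 : continuous (torus_gap e0).
Proof.
have H (T : topologicalType) (a b c : T -> R) (z : T) : {for z, continuous a} ->
    {for z, continuous b} -> {for z, continuous c} ->
    {for z, continuous (fun y => 2 * cosh e0 * Num.sqrt (b y ^+ 2 + c y ^+ 2)
      - (1 + a y ^+ 2 + b y ^+ 2 + c y ^+ 2) * sinh e0)}.
  move=> ha hb hc.
  have h2 (f : T -> R) : {for z, continuous f} -> {for z, continuous (fun y => f y ^+ 2)}.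
    by move=> hf; exact: (cvgM hf hf).
  apply: cvgB; last first.
    apply: cvgM; last exact: cvg_cst.
    by apply: cvgD (h2 _ hc); apply: cvgD (h2 _ hb); apply: cvgD (h2 _ ha); exact: cvg_cst.
  apply: cvgM; first exact: cvg_cst.
  exact: (continuous_comp (cvgD (h2 _ hb) (h2 _ hc)) (@sqrt_continuous R _)).
by move=> x; apply: (@H 'rV[R]_3 (fun y => y 0 i0) (fun y => y 0 i1) (fun y => y 0 i2));
  exact: coord_continuous.
Qed.

Lemma open_solid_torus e0 : 0 < e0 -> open (solid_torus e0).
Proof.
move=> e00; rewrite solid_torusE //.
have -> : [set x | 0 < torus_gap e0 x] = torus_gap e0 @^-1` [set y | 0 < y] by [].
by apply: open_comp (@open_gt R 0) => x _; exact: continuous_torus_gap.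
Qed.

(** A nonnegative gap means 1 + |x|^2 <= M r with M = 2 coth e0, which bounds r and then every
    coordinate by M. *)
Lemma compact_closed_torus e0 : 0 < e0 -> compact (solid_torus e0 `|` torus e0).
Proof.
move=> e00; rewrite closed_torusE //; apply: bounded_closed_compact; last first.
  have -> : [set x | 0 <= torus_gap e0 x] = torus_gap e0 @^-1` [set y | 0 <= y] by [].
  by apply: closed_comp (@closed_ge R 0) => x _; exact: continuous_torus_gap.
have [s0 c0] := (sinh_gt0 e00, cosh_gt0 e0).
pose M := 2 * cosh e0 / sinh e0.
exists (1 + M); split; first exact: num_real.
move=> y hy x /= gap.
have r_ge0 : 0 <= x 0 i1 ^+ 2 + x 0 i2 ^+ 2 by rewrite addr_ge0 // sqr_ge0.
set r := Num.sqrt (x 0 i1 ^+ 2 + x 0 i2 ^+ 2) in gap.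
have r2 : r ^+ 2 = x 0 i1 ^+ 2 + x 0 i2 ^+ 2 by rewrite sqr_sqrtr.
have h1 : (1 + x 0 i0 ^+ 2 + r ^+ 2) <= M * r.
  rewrite /M mulrAC ler_pdivlMr // -subr_ge0.
  by move: gap; rewrite /torus_gap -/r r2 !addrA.
have r0 : 0 <= r by exact: sqrtr_ge0.
have M0 : 0 < M by rewrite /M; apply: divr_gt0 => //; apply: mulr_gt0.
have rM : r <= M.
  rewrite leNgt; apply/negP => h; have h2 := sqr_ge0 (x 0 i0).
  by have : M * r <= r * r; [rewrite ler_wpM2r // ltW|move: h1; rewrite expr2; lra].
have h2 i : x 0 i ^+ 2 <= M ^+ 2.
  have rM2 : M * r <= M ^+ 2 by rewrite expr2 ler_wpM2l // ltW.
  have a0 := sqr_ge0 (x 0 i0); have a1 := sqr_ge0 (x 0 i1); have a2 := sqr_ge0 (x 0 i2).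
  by move: i; apply: (@ord3P (fun i => x 0 i ^+ 2 <= M ^+ 2)); lra.
have hM i : `|x 0 i| <= M.
  by rewrite -(ger0_norm (ltW M0)) -!sqrtr_sqr ler_wsqrtr.
apply: le_trans (ltW hy); rewrite [leLHS]/Num.norm /= mx_normrE.
have M1 : 0 <= 1 + M by rewrite addr_ge0 // ltW.
apply/bigmax_leP; split => // -[i j] _ /=.
by rewrite ord1 (le_trans (hM j)) // lerDr.
Qed.

End geometry.

(** * Derivatives of the parametrization and of the weight *)

Section toroidal_derivatives.
Context {R : realType}.
Implicit Types (e t p k : R).

Lemma is_derive_as (f g : R -> R) (x df dg : R) :
  is_derive x 1 f df -> (forall y, g y = f y) -> df = dg -> is_derive x 1 g dg.
Proof. by move=> h /funext -> <-. Qed.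

Lemma is_derive_mull k (f : R -> R) (x df : R) :
  is_derive x 1 f df -> is_derive x 1 (fun y => k * f y) (k * df).
Proof.
move=> h; apply: is_derive_eq; rewrite /GRing.scale /=; ring.
Qed.

Lemma is_derive_mul (f g : R -> R) (x df dg : R) :
  is_derive x 1 f df -> is_derive x 1 g dg ->
  is_derive x 1 (fun y => f y * g y) (df * g x + f x * dg).
Proof. by move=> hf hg; apply: is_derive_eq; rewrite /GRing.scale /=; ring. Qed.

Lemma is_derive_add (f g : R -> R) (x df dg : R) :
  is_derive x 1 f df -> is_derive x 1 g dg ->
  is_derive x 1 (fun y => f y + g y) (df + dg).
Proof. by move=> hf hg; exact: is_deriveD. Qed.

Lemma is_derive_ratio (f g : R -> R) (x df dg : R) :
  is_derive x 1 f df -> is_derive x 1 g dg -> g x != 0 ->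
  is_derive x 1 (fun y => f y / g y) ((df * g x - f x * dg) / g x ^+ 2).
Proof.
move=> hf hg g0; have hV := is_deriveV g0.
apply: is_derive_eq; rewrite /GRing.scale /=; by field.
Qed.

Definition den e t : R := cosh e - cos t.

Lemma den_gt0 e t : 0 < e -> 0 < den e t. Proof. exact: denom_gt0. Qed.

Lemma den_neq0 e t : 0 < e -> den e t != 0.
Proof. by move=> e_gt0; rewrite gt_eqF // den_gt0. Qed.

Lemma is_derive_den_e e t : is_derive e 1 (den^~ t) (sinh e).
Proof. by apply: is_derive_as (is_deriveB (is_derive_cosh e) (is_derive_cst (cos t) e 1)) _ _ => //; rewrite subr0. Qed.

Lemma is_derive_den_t e t : is_derive t 1 (den e) (sin t).
Proof. by apply: is_derive_as (is_deriveB (is_derive_cst (cosh e) t 1) (is_derive_cos t)) _ _ => //; rewrite sub0r opprK. Qed.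

Let is_derive_den2_e e t : is_derive e 1 (fun e => den e t ^+ 2) (2 * den e t * sinh e).
Proof. by have h := is_derive_expr 2 (is_derive_den_e e t); rewrite expr1 in h. Qed.

Let is_derive_den2_t e t : is_derive t 1 (fun t => den e t ^+ 2) (2 * den e t * sin t).
Proof. by have h := is_derive_expr 2 (is_derive_den_t e t); rewrite expr1 in h. Qed.

Let sE e : sinh e ^+ 2 = cosh e ^+ 2 - 1 :> R.
Proof. by rewrite -(cosh2B e) opprB addrC subrK. Qed.

Let stE t : sin t ^+ 2 = 1 - cos t ^+ 2 :> R.
Proof. by rewrite -(cos2Dsin2 t) addrAC subrr add0r. Qed.

Lemma is_derive_cst_den_e k e t : 0 < e ->
  is_derive e 1 (fun e => k / den e t) (- k * sinh e / den e t ^+ 2).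
Proof.
move=> e_gt0; have d0 := den_neq0 t e_gt0; have d1 := is_derive_den_e e t.
apply: is_derive_as (is_derive_ratio (is_derive_cst k e 1) d1 d0) _ _ => //.
by rewrite /cst /= mul0r sub0r !mulNr.
Qed.

Lemma is_derive_sinh_den_e k e t : 0 < e ->
  is_derive e 1 (fun e => k * sinh e / den e t) (k * (1 - cosh e * cos t) / den e t ^+ 2).
Proof.
move=> e_gt0; have d0 := den_neq0 t e_gt0; have d1 := is_derive_den_e e t.
have hn : is_derive e 1 (fun e => k * sinh e) (k * cosh e).
  exact: is_derive_mull.
apply: is_derive_as (is_derive_ratio hn d1 d0) _ _ => //.
congr (_ / _); rewrite /den; have := sE e; move: (sinh e) (cosh e) (cos t) => S C c h; ring: h.
Qed.

Lemma is_derive_sinh_den2_e k e t : 0 < e ->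
  is_derive e 1 (fun e => k * sinh e / den e t ^+ 2)
    (k * (cosh e * den e t - 2 * sinh e ^+ 2) / den e t ^+ 3).
Proof.
move=> e_gt0; have d0 := den_neq0 t e_gt0; have d1 := is_derive_den2_e e t.
have hn : is_derive e 1 (fun e => k * sinh e) (k * cosh e).
  exact: is_derive_mull.
apply: is_derive_as (is_derive_ratio hn d1 (expf_neq0 2 d0)) _ _ => //.
by move: (sinh e) (cosh e) (den e t) d0 => S C h h0; field.
Qed.

Lemma is_derive_coshcos_den2_e k e t : 0 < e ->
  is_derive e 1 (fun e => k * (1 - cosh e * cos t) / den e t ^+ 2)
    (k * (- sinh e * cos t * den e t - 2 * sinh e * (1 - cosh e * cos t)) / den e t ^+ 3).
Proof.
move=> e_gt0; have d0 := den_neq0 t e_gt0; have d1 := is_derive_den2_e e t.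
have hn : is_derive e 1 (fun e => k * (1 - cosh e * cos t)) (k * (- (sinh e * cos t))).
  apply: is_derive_mull; apply: is_derive_as (is_deriveB (is_derive_cst (1 : R) e 1)
    (is_derive_mull (cos t) (is_derive_cosh e))) _ _ => [y|]; first by rewrite mulrC.
  by rewrite sub0r mulrC.
apply: is_derive_as (is_derive_ratio hn d1 (expf_neq0 2 d0)) _ _ => //.
by move: (sinh e) (cosh e) (cos t) (den e t) d0 => S C c h h0; field.
Qed.

Lemma is_derive_cst_den_t k e t : 0 < e ->
  is_derive t 1 (fun t => k / den e t) (- k * sin t / den e t ^+ 2).
Proof.
move=> e_gt0; have d0 := den_neq0 t e_gt0; have d1 := is_derive_den_t e t.
apply: is_derive_as (is_derive_ratio (is_derive_cst k t 1) d1 d0) _ _ => //.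
by rewrite /cst /= mul0r sub0r !mulNr.
Qed.

Lemma is_derive_sin_den_t e t : 0 < e ->
  is_derive t 1 (fun t => sin t / den e t) ((cosh e * cos t - 1) / den e t ^+ 2).
Proof.
move=> e_gt0; have d0 := den_neq0 t e_gt0; have d1 := is_derive_den_t e t.
apply: is_derive_as (is_derive_ratio (is_derive_sin t) d1 d0) _ _ => //.
congr (_ / _); rewrite /den; have := stE t; move: (cosh e) (cos t) (sin t) => C c s h; ring: h.
Qed.

Lemma is_derive_sin_den2_t k e t : 0 < e ->
  is_derive t 1 (fun t => k * sin t / den e t ^+ 2)
    (k * (cos t * den e t - 2 * sin t ^+ 2) / den e t ^+ 3).
Proof.
move=> e_gt0; have d0 := den_neq0 t e_gt0; have d1 := is_derive_den2_t e t.
have hn : is_derive t 1 (fun t => k * sin t) (k * cos t).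
  exact: is_derive_mull.
apply: is_derive_as (is_derive_ratio hn d1 (expf_neq0 2 d0)) _ _ => //.
by move: (sin t) (cos t) (den e t) d0 => S C h h0; field.
Qed.

Lemma is_derive_coshcos_den2_t e t : 0 < e ->
  is_derive t 1 (fun t => (cosh e * cos t - 1) / den e t ^+ 2)
    ((- cosh e * sin t * den e t - 2 * sin t * (cosh e * cos t - 1)) / den e t ^+ 3).
Proof.
move=> e_gt0; have d0 := den_neq0 t e_gt0; have d1 := is_derive_den2_t e t.
have hn : is_derive t 1 (fun t => cosh e * cos t - 1) (- (cosh e * sin t)).
  apply: is_derive_as (is_deriveB (is_derive_mull (cosh e) (is_derive_cos t))
    (is_derive_cst (1 : R) t 1)) _ _ => //.
  by rewrite subr0 mulrN.
apply: is_derive_as (is_derive_ratio hn d1 (expf_neq0 2 d0)) _ _ => //.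
by move: (cosh e) (cos t) (sin t) (den e t) d0 => C c s h h0; field.
Qed.

Definition tor_e e t p : 'rV[R]_3 :=
  row3 (- sin t * sinh e / den e t ^+ 2)
       (cos p * (1 - cosh e * cos t) / den e t ^+ 2)
       (sin p * (1 - cosh e * cos t) / den e t ^+ 2).

Definition tor_ee e t p : 'rV[R]_3 :=
  row3 (- sin t * (cosh e * den e t - 2 * sinh e ^+ 2) / den e t ^+ 3)
       (cos p * (- sinh e * cos t * den e t - 2 * sinh e * (1 - cosh e * cos t)) / den e t ^+ 3)
       (sin p * (- sinh e * cos t * den e t - 2 * sinh e * (1 - cosh e * cos t)) / den e t ^+ 3).

Definition tor_t e t p : 'rV[R]_3 :=
  row3 ((cosh e * cos t - 1) / den e t ^+ 2)
       (- (sinh e * cos p) * sin t / den e t ^+ 2)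
       (- (sinh e * sin p) * sin t / den e t ^+ 2).

Definition tor_tt e t p : 'rV[R]_3 :=
  row3 ((- cosh e * sin t * den e t - 2 * sin t * (cosh e * cos t - 1)) / den e t ^+ 3)
       (- (sinh e * cos p) * (cos t * den e t - 2 * sin t ^+ 2) / den e t ^+ 3)
       (- (sinh e * sin p) * (cos t * den e t - 2 * sin t ^+ 2) / den e t ^+ 3).

Definition tor_p e t p : 'rV[R]_3 :=
  row3 0 (- (sinh e / den e t) * sin p) (sinh e / den e t * cos p).

Definition tor_pp e t p : 'rV[R]_3 :=
  row3 0 (- (sinh e / den e t) * cos p) (- (sinh e / den e t) * sin p).

Ltac coords := apply: ord3P; under eq_fun do rewrite mxE /=; rewrite mxE /=.

Lemma is_derive_toroidal_e e t p : 0 < e ->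
  forall i, is_derive e 1 (fun e => toroidal e t p 0 i) (tor_e e t p 0 i).
Proof.
move=> e_gt0; coords.
- exact: is_derive_cst_den_e.
- under eq_fun do rewrite (mulrC (sinh _)); exact: is_derive_sinh_den_e.
- under eq_fun do rewrite (mulrC (sinh _)); exact: is_derive_sinh_den_e.
Qed.

Lemma is_derive_tor_e e t p : 0 < e ->
  forall i, is_derive e 1 (fun e => tor_e e t p 0 i) (tor_ee e t p 0 i).
Proof. by move=> e_gt0; coords; [exact: is_derive_sinh_den2_e|exact: is_derive_coshcos_den2_e..]. Qed.

Lemma is_derive_toroidal_t e t p : 0 < e ->
  forall i, is_derive t 1 (fun t => toroidal e t p 0 i) (tor_t e t p 0 i).
Proof. by move=> e_gt0; coords; [exact: is_derive_sin_den_t|exact: is_derive_cst_den_t..]. Qed.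

Lemma is_derive_tor_t e t p : 0 < e ->
  forall i, is_derive t 1 (fun t => tor_t e t p 0 i) (tor_tt e t p 0 i).
Proof. by move=> e_gt0; coords; [exact: is_derive_coshcos_den2_t|exact: is_derive_sin_den2_t..]. Qed.

Lemma is_derive_toroidal_p e t p :
  forall i, is_derive p 1 (fun p => toroidal e t p 0 i) (tor_p e t p 0 i).
Proof.
coords; first exact: is_derive_cst.
  apply: is_derive_as (is_derive_mull (sinh e / den e t) (is_derive_cos p)) _ _ => [y|].
    by rewrite /den mulrAC.
  by rewrite mulrN mulNr.
apply: is_derive_as (is_derive_mull (sinh e / den e t) (is_derive_sin p)) _ _ => [y|] //.
by rewrite /den mulrAC.
Qed.

Lemma is_derive_tor_p e t p :
  forall i, is_derive p 1 (fun p => tor_p e t p 0 i) (tor_pp e t p 0 i).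
Proof.
coords; first exact: is_derive_cst.
  exact: is_derive_mull.
by apply: is_derive_as (is_derive_mull _ (is_derive_cos p)) _ _ => //; rewrite mulrN mulNr.
Qed.

(* The coefficients of the Hessian, of the gradient and of the value of u in the
   equation satisfied by u / sqrt (cosh e - cos t); see [gauged_pde]. *)
Lemma toroidal_gauge_hessian e t p i j : 0 < e ->
  tor_e e t p 0 i * tor_e e t p 0 j + tor_t e t p 0 i * tor_t e t p 0 j +
    tor_p e t p 0 i * tor_p e t p 0 j / sinh e ^+ 2 = (i == j)%:R / den e t ^+ 2.
Proof.
move=> e_gt0.
have d0 := den_neq0 t e_gt0; have s0 : sinh e != 0 by rewrite gt_eqF // sinh_gt0.
have cs := sE e; have ct := stE t; have cp := stE p.
move: i j; apply: ord3P; apply: ord3P; rewrite !mxE /=;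
  move: d0 s0 cs ct cp; rewrite /den;
  move: (cosh e) (sinh e) (cos t) (sin t) (cos p) (sin p) => C S c s k l d0 s0 cs ct cp;
  by field: cs ct cp; rewrite d0 s0.
Qed.

Lemma toroidal_gauge_gradient e t p i : 0 < e ->
  tor_ee e t p 0 i + cosh e / sinh e * tor_e e t p 0 i + tor_tt e t p 0 i +
    tor_pp e t p 0 i / sinh e ^+ 2 - sinh e / den e t * tor_e e t p 0 i
    - sin t / den e t * tor_t e t p 0 i = 0.
Proof.
move=> e_gt0.
have d0 := den_neq0 t e_gt0; have s0 : sinh e != 0 by rewrite gt_eqF // sinh_gt0.
have cs := sE e; have ct := stE t.
move: i; apply: ord3P; rewrite !mxE /=;
  move: d0 s0 cs ct; rewrite /den;
  move: (cosh e) (sinh e) (cos t) (sin t) (cos p) (sin p) => C S c s k l d0 s0 cs ct;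
  by field: cs ct; rewrite d0 s0.
Qed.

Definition wt e t : R := (Num.sqrt (den e t))^-1.

Lemma wt_gt0 e t : 0 < e -> 0 < wt e t.
Proof. by move=> e_gt0; rewrite invr_gt0 sqrtr_gt0 den_gt0. Qed.

Let is_derive_invsqrt (f : R -> R) (x df : R) : 0 < f x -> is_derive x 1 f df ->
  is_derive x 1 (fun y => (Num.sqrt (f y))^-1) (- (df / (2 * f x)) * (Num.sqrt (f x))^-1).
Proof.
move=> f0 hf.
have s0 : 0 < Num.sqrt (f x) by rewrite sqrtr_gt0.
have h := is_derive1_sqrt f0.
have hs : is_derive x 1 (fun y => Num.sqrt (f y)) ((2 * Num.sqrt (f x))^-1 * df).
  exact: (@is_derive1_comp R Num.sqrt f).
apply: is_derive_as (is_derive_ratio (is_derive_cst (1 : R) x 1) hs _) _ _ => [|y|].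
- by rewrite gt_eqF.
- by rewrite /cst /= mul1r.
- have H (z y : R) : 0 < z -> z ^+ 2 = y -> (0 * z - 1 * ((2 * z)^-1 * df)) / z ^+ 2 =
      - (df / (2 * y)) * z^-1.
    by move=> z0 <-; field; rewrite gt_eqF.
  exact: (H _ _ s0 (sqr_sqrtr (ltW f0))).
Qed.

Lemma is_derive_wt_e e t : 0 < e ->
  is_derive e 1 (wt^~ t) (- (sinh e / (2 * den e t)) * wt e t).
Proof.
move=> e_gt0; exact: (@is_derive_invsqrt (den^~ t) e _ (den_gt0 t e_gt0) (is_derive_den_e e t)).
Qed.

Lemma is_derive_wt_t e t : 0 < e ->
  is_derive t 1 (wt e) (- (sin t / (2 * den e t)) * wt e t).
Proof.
move=> e_gt0; exact: (is_derive_invsqrt (den_gt0 t e_gt0) (is_derive_den_t e t)).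
Qed.

(** The second derivative of w = b^(-1/2), with a = b'; stated abstractly because [wt] has this form
    in e and in t alike. *)
Let is_derive_log (a b w : R -> R) (x da db dw : R) :
  is_derive x 1 a da -> is_derive x 1 b db -> is_derive x 1 w dw -> b x != 0 ->
  dw = - (a x / (2 * b x)) * w x -> db = a x ->
  is_derive x 1 (fun y => - (a y / (2 * b y)) * w y)
   ((- da / (2 * b x) + 3 * a x ^+ 2 / (4 * b x ^+ 2)) * w x).
Proof.
move=> ha hb hw b0 wE bE.
have b20 : 2 * b x != 0 by rewrite mulf_neq0 // pnatr_eq0.
have h := is_derive_ratio ha (is_derive_mull 2 hb) b20.
apply: is_derive_as (is_derive_mul (is_derive_mull (-1) h) hw) _ _ => [y|].
  by rewrite mulN1r.
rewrite wE bE; by field.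
Qed.

Lemma is_derive_wt_ee e t : 0 < e ->
  is_derive e 1 (fun e => - (sinh e / (2 * den e t)) * wt e t)
  ((- cosh e / (2 * den e t) + 3 * sinh e ^+ 2 / (4 * den e t ^+ 2)) * wt e t).
Proof.
move=> e_gt0; apply: is_derive_log (is_derive_sinh e) (is_derive_den_e e t)
  (is_derive_wt_e t e_gt0) _ _ _ => //; exact: den_neq0.
Qed.

Lemma is_derive_wt_tt e t : 0 < e ->
  is_derive t 1 (fun t => - (sin t / (2 * den e t)) * wt e t)
  ((- cos t / (2 * den e t) + 3 * sin t ^+ 2 / (4 * den e t ^+ 2)) * wt e t).
Proof.
move=> e_gt0; apply: is_derive_log (is_derive_sin t) (is_derive_den_t e t)
  (is_derive_wt_t t e_gt0) _ _ _ => //; exact: den_neq0.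
Qed.

Lemma toroidal_gauge_value e t : 0 < e ->
  (- cosh e / (2 * den e t) + 3 * sinh e ^+ 2 / (4 * den e t ^+ 2))
  + cosh e / sinh e * (- (sinh e / (2 * den e t)))
  + (- cos t / (2 * den e t) + 3 * sin t ^+ 2 / (4 * den e t ^+ 2)) + 4^-1 = 0.
Proof.
move=> e_gt0.
have d0 := den_neq0 t e_gt0; have s0 : sinh e != 0 by rewrite gt_eqF // sinh_gt0.
have cs := sE e; have ct := stE t.
move: d0 s0 cs ct; rewrite /den;
move: (cosh e) (sinh e) (cos t) (sin t) => C S c s d0 s0 cs ct.
by field: cs ct; rewrite d0 s0.
Qed.

End toroidal_derivatives.

(** * Joint continuity in eta and the two angles *)

Section continuous3.
Context {R : realType}.
Implicit Types (F G : R -> R -> R -> R) (f : R -> R).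

(** Joint continuity gives the bounds on compact boxes needed to differentiate under the integral.
    It is asked only for e > e0, inside the torus. *)
Definition continuous3 (e0 : R) F : Prop :=
  forall z : R * R * R, e0 < z.1.1 ->
    {for z, continuous (fun z : R * R * R => F z.1.1 z.1.2 z.2)}.

Lemma continuous3M e0 F G : continuous3 e0 F -> continuous3 e0 G ->
  continuous3 e0 (fun e t p => F e t p * G e t p).
Proof. by move=> hF hG z hz; apply: cvgM; [exact: hF|exact: hG]. Qed.

Lemma continuous3D e0 F G : continuous3 e0 F -> continuous3 e0 G ->
  continuous3 e0 (fun e t p => F e t p + G e t p).
Proof. by move=> hF hG z hz; apply: cvgD; [exact: hF|exact: hG]. Qed.

Lemma continuous3N e0 F : continuous3 e0 F -> continuous3 e0 (fun e t p => - F e t p).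
Proof. by move=> hF z hz; apply: cvgN; exact: hF. Qed.

Lemma continuous3X e0 F n : continuous3 e0 F -> continuous3 e0 (fun e t p => F e t p ^+ n).
Proof.
move=> hF; elim: n => [|n IH]; first by move=> z hz; exact: cvg_cst.
have -> : (fun e t p => F e t p ^+ n.+1) = (fun e t p => F e t p * F e t p ^+ n).
  by do 3! (apply/funext => ?); rewrite exprS.
exact: continuous3M.
Qed.

Lemma continuous3V e0 F : (forall e t p, e0 < e -> F e t p != 0) ->
  continuous3 e0 F -> continuous3 e0 (fun e t p => (F e t p)^-1).
Proof. by move=> h hF z hz; apply: cvgV; [exact: h|exact: hF]. Qed.

Lemma continuous3_cst e0 (c : R) : continuous3 e0 (fun _ _ _ => c).
Proof. by move=> z _; exact: cvg_cst. Qed.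

Lemma continuous3_1 e0 f : (forall e, e0 < e -> {for e, continuous f}) ->
  continuous3 e0 (fun e _ _ => f e).
Proof.
move=> hf z hz.
apply: (@continuous_comp _ _ _ (fun z : R * R * R => z.1.1) f); last exact: hf.
by apply: (@continuous_comp _ _ _ (fun z : R * R * R => z.1) fst); exact: cvg_fst.
Qed.

Lemma continuous3_2 e0 f : continuous f -> continuous3 e0 (fun _ t _ => f t).
Proof.
move=> hf z hz.
apply: (@continuous_comp _ _ _ (fun z : R * R * R => z.1.2) f); last exact: hf.
by apply: (@continuous_comp _ _ _ (fun z : R * R * R => z.1) snd); [exact: cvg_fst|exact: cvg_snd].
Qed.

Lemma continuous3_3 e0 f : continuous f -> continuous3 e0 (fun _ _ p => f p).
Proof.
move=> hf z hz.
by apply: (@continuous_comp _ _ _ (fun z : R * R * R => z.2) f); [exact: cvg_snd|exact: hf].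
Qed.

Lemma continuous3_comp (T : topologicalType) e0 (g : T -> R) (h : R -> R -> R -> T) :
  (forall z : R * R * R, e0 < z.1.1 ->
    {for z, continuous (fun z : R * R * R => h z.1.1 z.1.2 z.2)}) ->
  (forall e t p, e0 < e -> {for h e t p, continuous g}) ->
  continuous3 e0 (fun e t p => g (h e t p)).
Proof.
move=> hh hg z hz.
by apply: (@continuous_comp _ _ _ (fun z : R * R * R => h z.1.1 z.1.2 z.2) g); [exact: hh|exact: hg].
Qed.

Lemma continuous3_2d e0 F e : e0 < e -> continuous3 e0 F -> continuous2 (F e).
Proof.
move=> he hF z; have h := hF ((e, z.1), z.2) he.
apply: (@continuous_comp _ _ _ (fun z : R * R => ((e, z.1), z.2))
  (fun z : R * R * R => F z.1.1 z.1.2 z.2)) => //.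
by apply: continuous_pair; [apply: continuous_pair; [exact: cvg_cst|exact: cvg_fst]|exact: cvg_snd].
Qed.

Lemma continuous3_bounded e0 F a b : e0 < a -> a < b -> continuous3 e0 F ->
  exists2 C, 0 <= C & forall e t p, a <= e <= b -> square (t, p) -> `|F e t p| <= C.
Proof.
move=> ha ab hF.
pose K : set (R * R * R) := (`[a, b] `*` `[- pi, pi]) `*` `[- pi, pi].
have cK : compact K by do 2! (apply: compact_setX; last exact: segment_compact); exact: segment_compact.
have [|C C0 HC] := @continuous_bounded_compact _ R (fun z : R * R * R => F z.1.1 z.1.2 z.2) K cK.
  move=> [[e t] p] [[/= he _] _]; apply: hF => /=.
  by move: he; rewrite in_itv /= => /andP[h _]; exact: lt_le_trans ha h.
exists C => // e t p he [/= ht hp]; apply: (HC ((e, t), p)).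
by split => //; split => //=; rewrite in_itv.
Qed.

Lemma is_derive_angle_integral3 e0 F F' a : e0 < a ->
  continuous3 e0 F -> continuous3 e0 F' ->
  (forall e t p, e0 < e -> is_derive e 1 (fun e => F e t p) (F' e t p)) ->
  is_derive a 1 (fun e => angle_integral (F e)) (angle_integral (F' a)).
Proof.
move=> ha cF cF' dF.
pose u := (e0 + a) / 2; pose v := a + 1.
have hu : e0 < u by rewrite /u; lra.
have uav : u < a < v by rewrite /u /v; apply/andP; split; lra.
have uv : u < v by case/andP: uav; exact: lt_trans.
have [C C0 HC] := continuous3_bounded hu uv cF.
have [C' C'0 HC'] := continuous3_bounded hu uv cF'.
have W t : u < t < v -> u <= t <= v by move=> /andP[h1 h2]; rewrite !ltW.
have E t : u < t < v -> e0 < t by move=> /andP[h1 _]; exact: lt_trans hu h1.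
apply: (@is_derive_angle_integral _ F F' u v a (C + C')) => //.
- by rewrite addr_ge0.
- by move=> t /E ht; exact: continuous3_2d cF.
- exact: continuous3_2d cF'.
- by move=> t x y /W ht hs; rewrite (le_trans (HC _ _ _ ht hs)) // lerDl.
- by move=> t x y /E ht hs; exact: dF.
- by move=> t x y /W ht hs; rewrite (le_trans (HC' _ _ _ ht hs)) // lerDr.
Qed.

End continuous3.

(** * The Laplace equation in toroidal coordinates *)

(** Pure algebra: with tangent vectors A, B, C, their derivatives A', B', C' and logarithmic
    derivatives a, b of the weight, the operator is regrouped by the value, the gradient g and the
    Hessian H of u, so that the three gauge identities apply separately. *)
Lemma laplacian_split (R : comPzRingType) (I : finType) (g A A' B B' C C' : I -> R)
    (H : I -> I -> R) (k l q U W a a' b b' : R) :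
  U * (a' * W) + 2 * (a * W) * (\sum_i g i * A i)
    + (\sum_i ((\sum_j H i j * A j) * A i + g i * A' i)) * W
  + k * (U * (a * W) + (\sum_i g i * A i) * W)
  + (U * (b' * W) + 2 * (b * W) * (\sum_i g i * B i)
    + (\sum_i ((\sum_j H i j * B j) * B i + g i * B' i)) * W)
  + U * W * q
  + (U * (0 * W) + 2 * (0 * W) * (\sum_i g i * C i)
    + (\sum_i ((\sum_j H i j * C j) * C i + g i * C' i)) * W) * l
  = U * W * (a' + k * a + b' + q)
    + W * \sum_i g i * (A' i + k * A i + B' i + C' i * l + a * A i *+ 2 + b * B i *+ 2)
    + W * \sum_i \sum_j H i j * (A i * A j + B i * B j + C i * C j * l).
Proof.
have hess (X Y : I -> R) : \sum_i ((\sum_j H i j * X j) * X i + g i * Y i)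
    = (\sum_i \sum_j H i j * (X i * X j)) + \sum_i g i * Y i.
  rewrite big_split /=; congr (_ + _); apply: eq_bigr => i _.
  by rewrite mulr_suml; apply: eq_bigr => j _; rewrite mulrAC mulrA.
have D2 : \sum_i \sum_j H i j * (A i * A j + B i * B j + C i * C j * l)
    = (\sum_i \sum_j H i j * (A i * A j)) + (\sum_i \sum_j H i j * (B i * B j))
      + (\sum_i \sum_j H i j * (C i * C j)) * l.
  rewrite mulr_suml -!big_split /=; apply: eq_bigr => i _.
  by rewrite mulr_suml -!big_split /=; apply: eq_bigr => j _; ring.
have D1 : \sum_i g i * (A' i + k * A i + B' i + C' i * l + a * A i *+ 2 + b * B i *+ 2)
    = (\sum_i g i * A' i) + k * (\sum_i g i * A i) + (\sum_i g i * B' i)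
      + (\sum_i g i * C' i) * l + 2 * a * (\sum_i g i * A i) + 2 * b * (\sum_i g i * B i).
  by rewrite !mulr_sumr mulr_suml -!big_split /=; apply: eq_bigr => i _; ring.
rewrite !hess D2 D1.
move: (\sum_i \sum_j H i j * (A i * A j)) (\sum_i \sum_j H i j * (B i * B j))
  (\sum_i \sum_j H i j * (C i * C j)) => hA hB hC.
move: (\sum_i g i * A i) (\sum_i g i * B i) (\sum_i g i * C i) (\sum_i g i * A' i)
  (\sum_i g i * B' i) (\sum_i g i * C' i) => *; ring.
Qed.

Section harmonic.
Context {R : realType}.
Variables (e0 : R) (u : 'rV[R]_3 -> R).
Hypothesis e00 : 0 < e0.
Hypothesis hu : harmonic_on (solid_torus e0) u.
Implicit Types (e t p : R) (T : R -> R -> R -> 'rV[R]_3) (w : R -> R -> R)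
  (F G : R -> R -> R -> R).

Let near_solid e t p : e0 < e -> \forall y \near toroidal e t p, solid_torus e0 y.
Proof.
move=> he; apply: open_nbhs_nbhs; split; first exact: open_solid_torus.
exact: toroidal_solid.
Qed.

Let C1_u e t p : e0 < e -> C1_at u (toroidal e t p).
Proof.
move=> he; split=> [|i]; last by have [_ /(_ i)[]] := hu.1 _ (toroidal_solid t p e00 he).
by apply: filterS (near_solid t p he) => y /hu.1[_ h _] i; case: (h i).
Qed.

Let C1_du e t p : e0 < e -> forall i, C1_at (partial i u) (toroidal e t p).
Proof.
move=> he i; split=> [|j]; last by have [_ _ /(_ i j)[]] := hu.1 _ (toroidal_solid t p e00 he).
by apply: filterS (near_solid t p he) => y /hu.1[_ _ h] j; case: (h i j).
Qed.

Definition pull_u e t p := u (toroidal e t p).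
Definition pull_d1 T e t p := \sum_i partial i u (toroidal e t p) * T e t p 0 i.
Definition pull_d2 T T' e t p := \sum_i
  ((\sum_j partial j (partial i u) (toroidal e t p) * T e t p 0 j) * T e t p 0 i
   + partial i u (toroidal e t p) * T' e t p 0 i).

Definition gauged e t p := pull_u e t p * wt e t.
Definition gauged_d1 w T e t p := pull_u e t p * (w e t * wt e t) + pull_d1 T e t p * wt e t.
Definition gauged_d2 w w' T T' e t p :=
  pull_u e t p * (w' e t * wt e t) + 2 * (w e t * wt e t) * pull_d1 T e t p
  + pull_d2 T T' e t p * wt e t.

Definition wt_e e t := - (sinh e / (2 * den e t)).
Definition wt_ee e t := - cosh e / (2 * den e t) + 3 * sinh e ^+ 2 / (4 * den e t ^+ 2).
Definition wt_t e t := - (sin t / (2 * den e t)).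
Definition wt_tt e t := - cos t / (2 * den e t) + 3 * sin t ^+ 2 / (4 * den e t ^+ 2).

Lemma is_derive_pull_e e t p : e0 < e ->
  is_derive e 1 (fun e => pull_u e t p) (pull_d1 tor_e e t p).
Proof.
move=> he; have e_gt0 := lt_trans e00 he.
exact: (@is_derive_curve _ u (fun e => toroidal e t p) (fun e => tor_e e t p) e
  (C1_u t p he) (is_derive_toroidal_e t p e_gt0)).
Qed.

Lemma is_derive_gauged_e e t p : e0 < e ->
  is_derive e 1 (fun e => gauged e t p) (gauged_d1 wt_e tor_e e t p).
Proof.
move=> he; have e_gt0 := lt_trans e00 he.
apply: is_derive_as (is_derive_mul (is_derive_pull_e t p he) (is_derive_wt_e t e_gt0)) _ _ => //.
by rewrite /gauged_d1 addrC.
Qed.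

Lemma is_derive_gauged_ee e t p : e0 < e ->
  is_derive e 1 (fun e => gauged_d1 wt_e tor_e e t p) (gauged_d2 wt_e wt_ee tor_e tor_ee e t p).
Proof.
move=> he; have e_gt0 := lt_trans e00 he.
have h2 := @is_derive_curve2 _ u (fun e => toroidal e t p) (fun e => tor_e e t p)
  (fun e => tor_ee e t p) e (C1_u t p he) (C1_du t p he) (is_derive_toroidal_e t p e_gt0)
  (is_derive_tor_e t p e_gt0).
apply: is_derive_as (is_derive_add (is_derive_mul (is_derive_pull_e t p he)
  (is_derive_wt_ee t e_gt0)) (is_derive_mul h2 (is_derive_wt_e t e_gt0))) _ _ => //.
rewrite /gauged_d2 -/(pull_d2 tor_e tor_ee e t p) -/(wt_e e t) -/(wt_ee e t) -/(pull_d1 tor_e e t p).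
move: (pull_u e t p) (wt e t) (wt_e e t) (wt_ee e t) (pull_d1 _ e t p) (pull_d2 _ _ e t p).
by move=> *; ring.
Qed.

Lemma is_derive_pull_t e t p : e0 < e ->
  is_derive t 1 (fun t => pull_u e t p) (pull_d1 tor_t e t p).
Proof.
move=> he; have e_gt0 := lt_trans e00 he.
exact: (@is_derive_curve _ u (fun t => toroidal e t p) (fun t => tor_t e t p) t
  (C1_u t p he) (is_derive_toroidal_t t p e_gt0)).
Qed.

Lemma is_derive_gauged_t e t p : e0 < e ->
  is_derive t 1 (fun t => gauged e t p) (gauged_d1 wt_t tor_t e t p).
Proof.
move=> he; have e_gt0 := lt_trans e00 he.
apply: is_derive_as (is_derive_mul (is_derive_pull_t t p he) (is_derive_wt_t t e_gt0)) _ _ => //.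
by rewrite /gauged_d1 addrC.
Qed.

Lemma is_derive_gauged_tt e t p : e0 < e ->
  is_derive t 1 (fun t => gauged_d1 wt_t tor_t e t p) (gauged_d2 wt_t wt_tt tor_t tor_tt e t p).
Proof.
move=> he; have e_gt0 := lt_trans e00 he.
have h2 := @is_derive_curve2 _ u (fun t => toroidal e t p) (fun t => tor_t e t p)
  (fun t => tor_tt e t p) t (C1_u t p he) (C1_du t p he) (is_derive_toroidal_t t p e_gt0)
  (is_derive_tor_t t p e_gt0).
apply: is_derive_as (is_derive_add (is_derive_mul (is_derive_pull_t t p he)
  (is_derive_wt_tt t e_gt0)) (is_derive_mul h2 (is_derive_wt_t t e_gt0))) _ _ => //.
rewrite /gauged_d2 -/(pull_d2 tor_t tor_tt e t p) -/(wt_t e t) -/(wt_tt e t) -/(pull_d1 tor_t e t p).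
move: (pull_u e t p) (wt e t) (wt_t e t) (wt_tt e t) (pull_d1 _ e t p) (pull_d2 _ _ e t p).
by move=> *; ring.
Qed.

(** The weight does not depend on the azimuth. *)
Definition wt0 e t : R := 0.

Lemma is_derive_gauged_p e t p : e0 < e ->
  is_derive p 1 (fun p => gauged e t p) (gauged_d1 wt0 tor_p e t p).
Proof.
move=> he; have e_gt0 := lt_trans e00 he.
have h := @is_derive_curve _ u (fun p => toroidal e t p) (fun p => tor_p e t p) p
  (C1_u t p he) (is_derive_toroidal_p e t p).
apply: is_derive_as (is_derive_mull (wt e t) h) _ _ => [y|].
  by rewrite mulrC.
by rewrite /gauged_d1 /wt0 mul0r mulr0 add0r mulrC.
Qed.

Lemma is_derive_gauged_pp e t p : e0 < e ->
  is_derive p 1 (fun p => gauged_d1 wt0 tor_p e t p) (gauged_d2 wt0 wt0 tor_p tor_pp e t p).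
Proof.
move=> he; have e_gt0 := lt_trans e00 he.
have h := @is_derive_curve2 _ u (fun p => toroidal e t p) (fun p => tor_p e t p)
  (fun p => tor_pp e t p) p (C1_u t p he) (C1_du t p he) (is_derive_toroidal_p e t p)
  (is_derive_tor_p e t p).
apply: is_derive_as (is_derive_mull (wt e t) h) _ _ => [y|].
  by rewrite /gauged_d1 /wt0 mul0r mulr0 add0r mulrC.
by rewrite /gauged_d2 /wt0 mul0r !mulr0 mul0r !add0r mulrC.
Qed.

(** The left side equals the Laplacian of u times (cosh e - cos t)^(-5/2): the factor den^(-2) of
    [toroidal_gauge_hessian] and one factor [wt]. All coefficients depend on e only, so the equation
    separates. *)
Lemma gauged_pde e t p : e0 < e ->
  gauged_d2 wt_e wt_ee tor_e tor_ee e t p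
  + cosh e / sinh e * gauged_d1 wt_e tor_e e t p
  + gauged_d2 wt_t wt_tt tor_t tor_tt e t p
  + gauged e t p / 4
  + gauged_d2 wt0 wt0 tor_p tor_pp e t p / sinh e ^+ 2 = 0.
Proof.
move=> he; have e_gt0 := lt_trans e00 he.
have M i j := toroidal_gauge_hessian t p i j e_gt0.
have G1 i := toroidal_gauge_gradient t p i e_gt0.
have G0 := toroidal_gauge_value t e_gt0.
have H := hu.2 _ (toroidal_solid t p e00 he).
have E : forall i, wt_e e t * tor_e e t p 0 i *+ 2 = - (sinh e / den e t * tor_e e t p 0 i).
  by move=> i; rewrite /wt_e -mulr_natr; field; rewrite den_neq0.
have E' : forall i, wt_t e t * tor_t e t p 0 i *+ 2 = - (sin t / den e t * tor_t e t p 0 i).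
  by move=> i; rewrite /wt_t -mulr_natr; field; rewrite den_neq0.
have G1' i : tor_ee e t p 0 i + cosh e / sinh e * tor_e e t p 0 i + tor_tt e t p 0 i +
   tor_pp e t p 0 i / sinh e ^+ 2 + wt_e e t * tor_e e t p 0 i *+ 2
   + wt_t e t * tor_t e t p 0 i *+ 2 = 0.
  by rewrite E E' G1.
move: G0; rewrite -/(wt_e e t) -/(wt_ee e t) -/(wt_tt e t) => G0.
transitivity (pull_u e t p * wt e t * (wt_ee e t + cosh e / sinh e * wt_e e t + wt_tt e t + 4^-1)
  + wt e t * \sum_i partial i u (toroidal e t p) *
    (tor_ee e t p 0 i + cosh e / sinh e * tor_e e t p 0 i + tor_tt e t p 0 i +
   tor_pp e t p 0 i / sinh e ^+ 2 + wt_e e t * tor_e e t p 0 i *+ 2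
   + wt_t e t * tor_t e t p 0 i *+ 2)
  + wt e t * \sum_i \sum_j partial j (partial i u) (toroidal e t p) *
     (tor_e e t p 0 i * tor_e e t p 0 j + tor_t e t p 0 i * tor_t e t p 0 j +
    tor_p e t p 0 i * tor_p e t p 0 j / sinh e ^+ 2)).
  exact: laplacian_split.
rewrite G0 mulr0 add0r big1 ?mulr0 ?add0r; last by move=> i _; rewrite G1' mulr0.
rewrite (eq_bigr (fun i => partial i (partial i u) (toroidal e t p) / den e t ^+ 2)).
  by rewrite -mulr_suml H mul0r mulr0.
move=> i _; rewrite (bigD1 i) //= M eqxx mul1r big1 ?addr0 // => j ji.
by rewrite M eq_sym (negbTE ji) mul0r mulr0.
Qed.

Let c3_cosh : continuous3 e0 (fun e _ _ => cosh e : R).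
Proof. by apply: continuous3_1 => e _; exact: is_derive_continuous (is_derive_cosh e). Qed.
Let c3_sinh : continuous3 e0 (fun e _ _ => sinh e : R).
Proof. by apply: continuous3_1 => e _; exact: is_derive_continuous (is_derive_sinh e). Qed.
Let c3_cos2 : continuous3 e0 (fun _ t _ => cos t : R).
Proof. apply: continuous3_2; exact: continuous_cos. Qed.
Let c3_sin2 : continuous3 e0 (fun _ t _ => sin t : R).
Proof. apply: continuous3_2; exact: continuous_sin. Qed.
Let c3_cos3 : continuous3 e0 (fun _ _ p => cos p : R).
Proof. apply: continuous3_3; exact: continuous_cos. Qed.
Let c3_sin3 : continuous3 e0 (fun _ _ p => sin p : R).
Proof. apply: continuous3_3; exact: continuous_sin. Qed.
Let c3_den : continuous3 e0 (fun e t _ => den e t).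
Proof. exact: continuous3D c3_cosh (continuous3N c3_cos2). Qed.
Let c3_denV : continuous3 e0 (fun e t _ => (den e t)^-1).
Proof.
by apply: continuous3V c3_den => e t _ he; rewrite den_neq0 // (lt_trans e00 he).
Qed.
Let c3_denXV n : continuous3 e0 (fun e t _ => (den e t ^+ n)^-1).
Proof.
apply: continuous3V; last exact: continuous3X.
by move=> e t _ he; rewrite expf_neq0 // den_neq0 // (lt_trans e00 he).
Qed.
Let c3_kdenXV n k : continuous3 e0 (fun e t _ => (k.+1%:R * den e t ^+ n)^-1).
Proof.
apply: continuous3V; last exact: (@continuous3M _ _ (fun _ _ _ => k.+1%:R)
  (fun e t _ => den e t ^+ n) (@continuous3_cst _ _ _) (@continuous3X _ _ _ _ c3_den)).
by move=> e t _ he; rewrite mulf_neq0 ?pnatr_eq0 // expf_neq0 // den_neq0 // (lt_trans e00 he).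
Qed.
Let c3_wt : continuous3 e0 (fun e t _ => wt e t).
Proof.
apply: continuous3V => [e t _ he|]; first by rewrite gt_eqF // sqrtr_gt0 den_gt0 // (lt_trans e00 he).
move=> z hz; apply: (continuous_comp (c3_den hz)); exact: sqrt_continuous.
Qed.

(** Inverses are recognised only in shapes built from [den], which is known not to vanish; what is
    free of the three variables falls to the last case. *)
Ltac cont3 := lazymatch goal with
  | |- continuous3 _ (fun e t p => @?f e t p + @?g e t p) =>
      refine (@continuous3D _ _ f g _ _); cont3
  | |- continuous3 _ (fun e t p => @?f e t p * @?g e t p) =>
      refine (@continuous3M _ _ f g _ _); cont3
  | |- continuous3 _ (fun e t p => - @?f e t p) =>
      refine (@continuous3N _ _ f _); cont3
  | |- continuous3 _ (fun e t p => (den e t)^-1) => exact c3_denV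
  | |- continuous3 _ (fun e t p => (den e t ^+ ?n)^-1) => exact (@c3_denXV n)
  | |- continuous3 _ (fun e t p => (?k.+1%:R * den e t)^-1) => exact (@c3_kdenXV 1 k)
  | |- continuous3 _ (fun e t p => (?k.+1%:R * den e t ^+ ?n)^-1) => exact (@c3_kdenXV n k)
  | |- continuous3 _ (fun e t p => @?f e t p ^+ ?n) =>
      refine (@continuous3X _ _ f n _); cont3
  | |- continuous3 _ (fun e t p => cosh e) => exact c3_cosh
  | |- continuous3 _ (fun e t p => sinh e) => exact c3_sinh
  | |- continuous3 _ (fun e t p => cos t) => exact c3_cos2
  | |- continuous3 _ (fun e t p => sin t) => exact c3_sin2
  | |- continuous3 _ (fun e t p => cos p) => exact c3_cos3
  | |- continuous3 _ (fun e t p => sin p) => exact c3_sin3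
  | |- continuous3 _ (fun e t p => den e t) => exact c3_den
  | |- continuous3 _ (fun e t p => ?c) => exact (@continuous3_cst _ _ c)
  end.

Definition row_continuous3 T := forall i, continuous3 e0 (fun e t p => T e t p 0 i).

Let continuous3_ext F G : (forall e t p, F e t p = G e t p) ->
  continuous3 e0 G -> continuous3 e0 F.
Proof. by move=> h; rewrite (_ : F = G) //; do 3! (apply/funext => ?). Qed.

Ltac cont_row := rewrite /row_continuous3; apply: ord3P;
  (apply: continuous3_ext => [e t p|]; [rewrite mxE /=; reflexivity|]); cont3.

Lemma toroidal_continuous3 : row_continuous3 toroidal.
Proof.
rewrite /row_continuous3; apply: ord3P; (apply: continuous3_ext => [e t p|];
  [rewrite mxE /= -/(den e t); reflexivity|]); cont3.
Qed.
Lemma tor_e_continuous3 : row_continuous3 tor_e. Proof. cont_row. Qed.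
Lemma tor_ee_continuous3 : row_continuous3 tor_ee. Proof. cont_row. Qed.
Lemma tor_t_continuous3 : row_continuous3 tor_t. Proof. cont_row. Qed.
Lemma tor_tt_continuous3 : row_continuous3 tor_tt. Proof. cont_row. Qed.
Lemma tor_p_continuous3 : row_continuous3 tor_p. Proof. cont_row. Qed.
Lemma tor_pp_continuous3 : row_continuous3 tor_pp. Proof. cont_row. Qed.

Definition wt_continuous3 w := continuous3 e0 (fun e t _ => w e t).

Lemma wt_e_continuous3 : wt_continuous3 wt_e. Proof. rewrite /wt_continuous3 /wt_e; cont3. Qed.
Lemma wt_ee_continuous3 : wt_continuous3 wt_ee. Proof. rewrite /wt_continuous3 /wt_ee; cont3. Qed.
Lemma wt_t_continuous3 : wt_continuous3 wt_t. Proof. rewrite /wt_continuous3 /wt_t; cont3. Qed.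
Lemma wt_tt_continuous3 : wt_continuous3 wt_tt. Proof. rewrite /wt_continuous3 /wt_tt; cont3. Qed.
Lemma wt0_continuous3 : wt_continuous3 wt0. Proof. exact: continuous3_cst. Qed.

Let pull_continuous3 (g : 'rV[R]_3 -> R) :
  (forall x, solid_torus e0 x -> {for x, continuous g}) ->
  continuous3 e0 (fun e t p => g (toroidal e t p)).
Proof.
move=> hg; apply: continuous3_comp => [z hz|e t p he]; last by apply: hg; exact: toroidal_solid.
by apply: continuous_row3 => i; exact: toroidal_continuous3.
Qed.

Lemma pull_u_continuous3 : continuous3 e0 pull_u.
Proof. by apply: pull_continuous3 => x /hu.1[]. Qed.
Let c3_grad i : continuous3 e0 (fun e t p => partial i u (toroidal e t p)).
Proof. by apply: pull_continuous3 => x /hu.1[_ /(_ i)[]]. Qed.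
Let c3_hess i j : continuous3 e0 (fun e t p => partial j (partial i u) (toroidal e t p)).
Proof. by apply: pull_continuous3 => x /hu.1[_ _ /(_ i j)[]]. Qed.

Lemma continuous3_sum (F : 'I_3 -> R -> R -> R -> R) : (forall i, continuous3 e0 (F i)) ->
  continuous3 e0 (fun e t p => \sum_i F i e t p).
Proof.
move=> h; apply: continuous3_ext => [e t p|]; [exact: sum3|].
by apply: continuous3D; [apply: continuous3D|].
Qed.

Lemma pull_d1_continuous3 T : row_continuous3 T -> continuous3 e0 (pull_d1 T).
Proof. by move=> hT; apply: continuous3_sum => i; exact: continuous3M. Qed.

Lemma pull_d2_continuous3 T T' : row_continuous3 T -> row_continuous3 T' ->
  continuous3 e0 (pull_d2 T T').
Proof.
move=> hT hT'; apply: continuous3_sum => i; apply: continuous3D; last exact: continuous3M.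
by apply: continuous3M (hT i); apply: continuous3_sum => j; exact: continuous3M.
Qed.

Lemma gauged_continuous3 : continuous3 e0 gauged.
Proof. exact: continuous3M pull_u_continuous3 c3_wt. Qed.

Lemma gauged_d1_continuous3 w T : wt_continuous3 w -> row_continuous3 T ->
  continuous3 e0 (gauged_d1 w T).
Proof. by move=> hw hT; have h := pull_d1_continuous3 hT;
  exact: continuous3D (continuous3M pull_u_continuous3 (continuous3M hw c3_wt)) (continuous3M h c3_wt). Qed.

Lemma gauged_d2_continuous3 w w' T T' : wt_continuous3 w -> wt_continuous3 w' ->
  row_continuous3 T -> row_continuous3 T' -> continuous3 e0 (gauged_d2 w w' T T').
Proof.
move=> hw hw' hT hT'; have h := pull_d1_continuous3 hT; have h2 := pull_d2_continuous3 hT hT'.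
apply: continuous3D (continuous3M h2 c3_wt).
apply: continuous3D (continuous3M pull_u_continuous3 (continuous3M hw' c3_wt)) _.
exact: continuous3M (continuous3M (@continuous3_cst _ _ 2) (continuous3M hw c3_wt)) h.
Qed.

End harmonic.

(** * Trigonometric functions and integration by parts over the angles *)

Section trigonometric_modes.
Context {R : realType}.
Notation mu := (@lebesgue_measure R).
Implicit Types (n m : nat) (nu : bool) (x t p : R).

Definition dPhi n nu x : R := (if nu then - n%:R else n%:R) * Phi n (~~ nu) x.

Lemma is_derive_Phi n nu x : is_derive x 1 (Phi n nu) (dPhi n nu x).
Proof.
have h : is_derive x 1 (fun x => n%:R * x) n%:R.
  by apply: is_derive_as (is_derive_mull n%:R (is_derive_id x 1)) _ _ => //; rewrite mulr1.
rewrite /dPhi; case: nu.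
- apply: is_derive_as (@is_derive1_comp R cos (fun x => n%:R * x) x _ _ (is_derive_cos _) h) _ _ => //.
  by rewrite mulNr mulrC mulrN.
- apply: is_derive_as (@is_derive1_comp R sin (fun x => n%:R * x) x _ _ (is_derive_sin _) h) _ _ => //.
  by rewrite mulrC.
Qed.

Lemma is_derive_dPhi n nu x : is_derive x 1 (dPhi n nu) (- n%:R ^+ 2 * Phi n nu x).
Proof.
apply: is_derive_as (is_derive_mull _ (is_derive_Phi n (~~ nu) x)) _ _ => //.
by rewrite /dPhi negbK expr2; case: nu => /=; ring.
Qed.

Lemma continuous_Phi n nu : continuous (Phi n nu : R -> R).
Proof. by move=> x; exact: is_derive_continuous (is_derive_Phi n nu x). Qed.

Lemma continuous_dPhi n nu : continuous (dPhi n nu).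
Proof. by move=> x; exact: is_derive_continuous (is_derive_dPhi n nu x). Qed.

Lemma Phi_le1 n nu x : `|Phi n nu x| <= 1.
Proof.
by case: nu; rewrite /= ler_norml ?cos_geN1 ?cos_le1 ?sin_geN1 ?sin_le1.
Qed.

Lemma Phi_periodic n nu x : Phi n nu (x + 2 * pi) = Phi n nu x.
Proof.
have E : n%:R * (x + 2 * pi) = n%:R * x + (pi *+ 2) *+ n :> R.
  by rewrite -mulr_natl -(mulr_natl _ n); ring.
by rewrite /Phi E (periodicn (@sinD2pi R)) (periodicn (@cosD2pi R)).
Qed.

Lemma Phi_pi n nu : Phi n nu pi = Phi n nu (- pi) :> R.
Proof. by rewrite -[in RHS](Phi_periodic n nu (- pi)); congr Phi; ring. Qed.

Lemma dPhi_pi n nu : dPhi n nu pi = dPhi n nu (- pi) :> R.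
Proof. by rewrite /dPhi Phi_pi. Qed.

Lemma pi_NltP : - pi < pi :> R.
Proof. by rewrite gtrN // pi_gt0. Qed.

Lemma integral_derive_segment (F f : R -> R) : continuous f ->
  (forall x, is_derive x 1 F (f x)) ->
  \int[mu]_(x in `[- pi, pi]) f x = F pi - F (- pi).
Proof.
move=> cf dF; rewrite /Rintegral (continuous_FTC2 (F := F) pi_NltP) //.
- exact: continuous_subspaceT.
- split.
  + by move=> x _; case: (dF x).
  + by apply: cvg_at_right_filter; exact: (is_derive_continuous (dF _)).
  + by apply: cvg_at_left_filter; exact: (is_derive_continuous (dF _)).
- by move=> x _; rewrite derive1E; case: (dF x).
Qed.

Lemma angle_integral_derive (g dg : R -> R -> R) : continuous2 dg ->
  (forall t p, is_derive t 1 (g^~ p) (dg t p)) ->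
  (forall p, g pi p = g (- pi) p) -> angle_integral dg = 0.
Proof.
move=> cdg hd hp; rewrite angle_integral_swap // /angle_integral.
under eq_Rintegral => p _.
  rewrite (integral_derive_segment (F := g^~ p)) //; last exact: continuous2_l.
  rewrite hp subrr; over.
by rewrite Rintegral_cst ?mul0r.
Qed.

(** The combination v'' Phi + n^2 v Phi is the derivative of v' Phi - v Phi', whose values at the
    two ends agree by periodicity. *)
Lemma angle_integral_by_parts (v dv ddv : R -> R -> R) (k : R -> R) n nu :
  continuous2 v -> continuous2 ddv -> continuous k ->
  (forall t p, is_derive t 1 (v^~ p) (dv t p)) ->
  (forall t p, is_derive t 1 (dv^~ p) (ddv t p)) ->
  (forall p, v pi p = v (- pi) p) -> (forall p, dv pi p = dv (- pi) p) ->
  angle_integral (fun t p => ddv t p * (Phi n nu t * k p)) =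
  - n%:R ^+ 2 * angle_integral (fun t p => v t p * (Phi n nu t * k p)).
Proof.
move=> cv cddv ck hv hdv vpi dvpi.
have cP : continuous2 (fun t p => Phi n nu t * k p).
  by apply: continuous2M; [apply: continuous2_fst; exact: continuous_Phi|exact: continuous2_snd].
have c1 : continuous2 (fun t p => ddv t p * (Phi n nu t * k p)) by exact: continuous2M.
have c2 : continuous2 (fun t p => v t p * (Phi n nu t * k p)) by exact: continuous2M.
have : angle_integral (fun t p => ddv t p * (Phi n nu t * k p)
    + n%:R ^+ 2 * (v t p * (Phi n nu t * k p))) = 0.
  apply: (@angle_integral_derive (fun t p => k p * (dv t p * Phi n nu t - v t p * dPhi n nu t))).
  - by apply: continuous2D => //; apply: continuous2M => //; exact: continuous2_cst.
  - move=> t p; apply: is_derive_as (is_derive_mull (k p) (is_derive_add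
      (is_derive_mul (hdv t p) (is_derive_Phi n nu t)) (is_derive_mull (-1)
      (is_derive_mul (hv t p) (is_derive_dPhi n nu t))))) _ _ => [y|].
      by rewrite mulN1r.
    by ring.
  - by move=> p; rewrite vpi dvpi Phi_pi dPhi_pi.
rewrite angle_integralD //; last by apply: continuous2M => //; exact: continuous2_cst.
by rewrite angle_integralZ // => /eqP; rewrite addr_eq0 => /eqP ->; rewrite mulNr.
Qed.

End trigonometric_modes.

(** * The ordinary differential equation of a double Fourier mode *)

Section modes.
Context {R : realType}.
Variables (e0 : R) (u : 'rV[R]_3 -> R).
Hypothesis e00 : 0 < e0.
Hypothesis hu : harmonic_on (solid_torus e0) u.
Variables (n m : nat) (nu mu : bool).
Implicit Types (e t p : R).

Let PP t p : R := Phi n nu t * Phi m mu p.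

Definition mode_integral (F : R -> R -> R -> R) e : R :=
  angle_integral (fun t p => F e t p * PP t p).

Lemma continuous2_PhiPhi : continuous2 PP.
Proof.
by apply: continuous2M; [apply: continuous2_fst|apply: continuous2_snd]; exact: continuous_Phi.
Qed.

Lemma is_derive_mode_integral F F' e : e0 < e -> continuous3 e0 F -> continuous3 e0 F' ->
  (forall e t p, e0 < e -> is_derive e 1 (fun e => F e t p) (F' e t p)) ->
  is_derive e 1 (mode_integral F) (mode_integral F' e).
Proof.
move=> he cF cF' dF.
have c3 G : continuous3 e0 G -> continuous3 e0 (fun e t p => G e t p * PP t p).
  move=> cG; apply: continuous3M => //.
  by apply: continuous3M; [apply: continuous3_2|apply: continuous3_3]; exact: continuous_Phi.
apply: (is_derive_angle_integral3 he (c3 _ cF) (c3 _ cF')) => e' t p he'.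
have h := dF e' t p he'.
apply: is_derive_as (is_derive_mull (PP t p) h) _ _ => [y|]; exact: mulrC.
Qed.

Let d1 := gauged_d1 u wt_e tor_e.
Let d2 := gauged_d2 u wt_e wt_ee tor_e tor_ee.

Let c_gauged := gauged_continuous3 e00 hu.
Let c_d1 : continuous3 e0 d1.
Proof. exact: gauged_d1_continuous3 (wt_e_continuous3 e00) (tor_e_continuous3 e00). Qed.
Let c_d2 : continuous3 e0 d2.
Proof.
exact: gauged_d2_continuous3 (wt_e_continuous3 e00) (wt_ee_continuous3 e00)
  (tor_e_continuous3 e00) (tor_ee_continuous3 e00).
Qed.

Lemma is_derive_mode1 e : e0 < e ->
  is_derive e 1 (mode_integral (gauged u)) (mode_integral d1 e).
Proof. by move=> he; apply: is_derive_mode_integral => //; exact: is_derive_gauged_e. Qed.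

Lemma is_derive_mode2 e : e0 < e ->
  is_derive e 1 (mode_integral d1) (mode_integral d2 e).
Proof. by move=> he; apply: is_derive_mode_integral => //; exact: is_derive_gauged_ee. Qed.

Lemma toroidal_shift e t p : toroidal e (t + 2 * pi) p = toroidal e t p.
Proof.
rewrite !toroidalE (_ : t + 2 * pi = t + pi *+ 2 :> R) ?cosD2pi ?sinD2pi //.
by rewrite mulr_natl.
Qed.

Lemma toroidal_pi e p : toroidal e pi p = toroidal e (- pi) p.
Proof. by rewrite -[in RHS](toroidal_shift e (- pi)); congr toroidal; ring. Qed.

Lemma toroidal_pi2 e t : toroidal e t pi = toroidal e t (- pi).
Proof. by rewrite !toroidalE sinN cosN sinpi oppr0. Qed.

(** [gauged_pde] is tested against Phi n * Phi m; the angular second derivatives become -n^2 and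
    -m^2. The azimuth is treated after exchanging the two integrations, as [angle_integral_by_parts]
    acts on the first variable. *)
Lemma mode_ode e : e0 < e -> mode_integral d2 e + cosh e / sinh e * mode_integral d1 e =
  (n%:R ^+ 2 - 4^-1 + m%:R ^+ 2 / sinh e ^+ 2) * mode_integral (gauged u) e.
Proof.
move=> he; have e_gt0 := lt_trans e00 he.
have c2 F : continuous3 e0 F -> continuous2 (fun t p => F e t p * PP t p).
  by move=> cF; apply: continuous2M continuous2_PhiPhi; exact: continuous3_2d cF.
have ct2 : continuous3 e0 (gauged_d2 u wt_t wt_tt tor_t tor_tt).
  exact: gauged_d2_continuous3 (wt_t_continuous3 e00) (wt_tt_continuous3 e00)
    (tor_t_continuous3 e00) (tor_tt_continuous3 e00).
have cp2 : continuous3 e0 (gauged_d2 u wt0 wt0 tor_p tor_pp).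
  exact: gauged_d2_continuous3 (@wt0_continuous3 _ e0) (@wt0_continuous3 _ e0)
    (tor_p_continuous3 e00) (tor_pp_continuous3 e00).
have It : mode_integral (gauged_d2 u wt_t wt_tt tor_t tor_tt) e =
    - n%:R ^+ 2 * mode_integral (gauged u) e.
  apply: (@angle_integral_by_parts _ (gauged u e) (gauged_d1 u wt_t tor_t e)).
  - exact: continuous3_2d c_gauged.
  - exact: continuous3_2d ct2.
  - exact: continuous_Phi.
  - by move=> t p; exact: (is_derive_gauged_t e00 hu t p he).
  - by move=> t p; exact: (is_derive_gauged_tt e00 hu t p he).
  - by move=> p; rewrite /gauged /pull_u toroidal_pi /wt /den cosN.
  - move=> p; rewrite /gauged_d1 /pull_u /pull_d1 toroidal_pi /wt /wt_t /tor_t /den.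
    by rewrite cosN sinN sinpi oppr0.
have Ip : mode_integral (gauged_d2 u wt0 wt0 tor_p tor_pp) e =
    - m%:R ^+ 2 * mode_integral (gauged u) e.
  rewrite /mode_integral angle_integral_swap; last exact: c2.
  rewrite [X in _ = _ * X]angle_integral_swap; last exact: c2.
  transitivity (angle_integral (fun x y => gauged_d2 u wt0 wt0 tor_p tor_pp e y x *
      (Phi m mu x * Phi n nu y))).
    by apply: eq_angle_integral => x y; rewrite /PP (mulrC (Phi n _ _)).
  rewrite (eq_angle_integral (g1 := fun x y => gauged u e y x * PP y x)
    (g2 := fun x y => gauged u e y x * (Phi m mu x * Phi n nu y))); last first.
    by move=> x y; rewrite /PP (mulrC (Phi n _ _)).
  apply: (@angle_integral_by_parts _ (fun x y => gauged u e y x)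
    (fun x y => gauged_d1 u wt0 tor_p e y x)).
  - by apply: continuous2_swap; exact: continuous3_2d c_gauged.
  - by apply: continuous2_swap; exact: continuous3_2d cp2.
  - exact: continuous_Phi.
  - by move=> x y; exact: (is_derive_gauged_p e00 hu y x he).
  - by move=> x y; exact: (is_derive_gauged_pp e00 hu y x he).
  - by move=> p; rewrite /gauged /pull_u toroidal_pi2.
  - move=> p; rewrite /gauged_d1 /pull_u /pull_d1 toroidal_pi2 /tor_p.
    by rewrite cosN sinN sinpi oppr0.
have S k F : continuous3 e0 F -> continuous2 (fun t p => k * (F e t p * PP t p)).
  by move=> cF; apply: continuous2M (c2 _ cF); exact: continuous2_cst.
have : mode_integral (fun e t p => d2 e t p + cosh e / sinh e * d1 e t p +
    gauged_d2 u wt_t wt_tt tor_t tor_tt e t p + gauged u e t p / 4 +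
    gauged_d2 u wt0 wt0 tor_p tor_pp e t p / sinh e ^+ 2) e = 0.
  rewrite /mode_integral; under eq_angle_integral.
    by move=> t p; rewrite (gauged_pde e00 hu t p he) mul0r; over.
  rewrite (_ : (fun _ _ => 0) = (fun _ _ => 0 * 0)); last by rewrite mul0r.
  by rewrite angle_integralZ ?mul0r //; exact: continuous2_cst.
rewrite /mode_integral.
rewrite (eq_angle_integral (g2 := fun t p => d2 e t p * PP t p + cosh e / sinh e * (d1 e t p * PP t p)
   + gauged_d2 u wt_t wt_tt tor_t tor_tt e t p * PP t p + 4^-1 * (gauged u e t p * PP t p)
   + (sinh e ^+ 2)^-1 * (gauged_d2 u wt0 wt0 tor_p tor_pp e t p * PP t p))); last first.
  move=> t p; move: (cosh e / sinh e) (sinh e ^+ 2)^-1 => k l.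
  move: (d2 e t p) (d1 e t p) (gauged_d2 u wt_t wt_tt tor_t tor_tt e t p) (gauged u e t p)
    (gauged_d2 u wt0 wt0 tor_p tor_pp e t p) (PP t p) => *; ring.
rewrite angle_integralD; [|by do ?apply: continuous2D; auto|exact: S].
rewrite angle_integralD; [|by do ?apply: continuous2D; auto|exact: S].
rewrite angle_integralD; [|by do ?apply: continuous2D; auto|exact: c2].
rewrite angle_integralD; [|exact: c2|exact: S].
rewrite !angle_integralZ; [|exact: c2..].
move: It Ip; rewrite /mode_integral => -> ->.
move: (angle_integral _) (angle_integral _) (angle_integral _) => A B C.
move: (cosh e / sinh e) (sinh e ^+ 2)^-1 => k l h.
apply/eqP; rewrite -subr_eq0 -h; apply/eqP; ring.
Qed.

End modes.

(** * Bounded solutions of the Legendre equation *)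

Section legendre_multiple.
Context {R : realType}.
Implicit Types e : R.

Lemma constant_of_derive0 (e0 : R) (f : R -> R) : (forall e, e0 < e -> is_derive e 1 f 0) ->
  forall a b, e0 < a -> e0 < b -> f a = f b.
Proof.
move=> hf.
have H a b : e0 < a -> a < b -> f a = f b.
  move=> ha ab.
  have : `|f a - f b - 0 * (a - b)| <= 0 * `|a - b|.
    apply: (@mvt_dist _ f (fun=> 0)) => t; last by rewrite subrr normr0.
    move=> ht; apply: hf; apply: lt_le_trans ha _.
    move: ht; rewrite (distrC a) (ger0_norm (_ : 0 <= b - a)) ?subr_ge0 ?(ltW ab) //.
    by rewrite ler_norml => /andP[]; lra.
  by rewrite !mul0r subr0 normr_le0 subr_eq0 => /eqP.
move=> a b ha hb; have [|/esym|->//] := ltgtP a b; first exact: H.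
by move=> /esym ba; rewrite (H b a).
Qed.

(** The Wronskian with Q is constant. Were it nonzero, [wronskian_blowup] would apply to A or to -A
    according to its sign; so it vanishes, and A / Q has derivative zero. *)
Lemma bounded_legendre_multiple (e0 C : R) (n m : nat) (A dA : R -> R) : 0 < e0 ->
  (forall e, e0 < e -> is_derive e 1 A (dA e)) ->
  (forall e, e0 < e -> is_derive e 1 (fun e => sinh e * dA e)
    ((n%:R ^+ 2 - 4^-1 + m%:R ^+ 2 / sinh e ^+ 2) * sinh e * A e)) ->
  (forall e, e0 < e -> 2 <= cosh e -> Num.sqrt (sinh e) * `|A e| <= C) ->
  exists k, forall e, e0 < e -> A e = k * torQ n m e.
Proof.
move=> e00 hA hsA bA.
pose sg : R := (-1) ^+ m.
pose G e := sg * torQ n m e.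
pose dG e := sg * dtorQ n m e.
have pos e : e0 < e -> 0 < e by exact: lt_trans.
have G0 e : e0 < e -> 0 < G e by move=> /pos; exact: torQ_sign.
have hG e : e0 < e -> is_derive e 1 G (dG e).
  by move=> /pos he; apply: is_derive_mull; exact: is_derive_torQ.
have hdG e : e0 < e -> is_derive e 1 (fun e => sinh e * dG e)
    ((n%:R ^+ 2 - 4^-1 + m%:R ^+ 2 / sinh e ^+ 2) * sinh e * G e).
  move=> /pos he; apply: is_derive_as (is_derive_mull sg (is_derive_sinh_dtorQ n m he)) _ _ => [y|].
    by rewrite /dG mulrCA.
  by rewrite /G mulrCA.
pose W e := sinh e * (dA e * G e - A e * dG e).
have hW e : e0 < e -> is_derive e 1 W 0.
  move=> he; have := is_derive_add (is_derive_mul (hsA e he) (hG e he))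
    (is_derive_mull (-1) (is_derive_mul (hA e he) (hdG e he))).
  move=> h; apply: is_derive_as h _ _ => [y|]; rewrite /W.
    by move: (sinh y) (dA y) (dG y) (A y) (G y) => *; ring.
  move: (n%:R ^+ 2 - 4^-1 + m%:R ^+ 2 / sinh e ^+ 2) (sinh e) (dA e) (dG e) (A e) (G e) => *; ring.
have [e2 _ he2] := @cosh_ge2 R.
pose e1 := Num.max (e0 + 1) e2.
have e01 e : e1 <= e -> e0 < e.
  by rewrite ge_max => /andP[h _]; apply: lt_le_trans h; rewrite ltrDl.
have e12 e : e1 <= e -> 2 <= cosh e by rewrite ge_max => /andP[_ h]; exact: he2.
have e10 : 0 < e1 by apply/pos/e01.
have [K HK] := @torQ_bound R n m.
pose M' := `|C| + `|K| + 1.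
have M'0 : 0 < M' by rewrite ltr_wpDl // addr_ge0.
have bA' e : e1 <= e -> Num.sqrt (sinh e) * `|A e| <= M'.
  move=> he; apply: le_trans (bA e (e01 e he) (e12 e he)) _.
  by apply: le_trans (ler_norm C) _; rewrite /M' -addrA lerDl addr_ge0.
have sgn x : `|sg * x| = `|x| by rewrite normrM /sg normr_sign mul1r.
have bG e : e1 <= e -> Num.sqrt (sinh e) * G e <= M'.
  move=> he; have h := HK e (pos e (e01 e he)) (e12 e he).
  rewrite -(ger0_norm (ltW (G0 e (e01 e he)))) /G sgn.
  apply: le_trans h _; apply: le_trans (ler_norm K) _.
  by rewrite /M' addrAC lerDr addr_ge0.
have GE e : G e = sg * torQ n m e by [].
clearbody G dG M' sg.
have Wc e : e1 <= e -> W e = W e1 by move=> he; apply: (constant_of_derive0 hW); exact: e01.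
have W0 : W e1 = 0.
  apply/eqP; rewrite eq_le !leNgt; apply/andP; split; apply/negP => hc.
  - apply: (wronskian_blowup (A := A) (G := G) (dA := dA) (dG := dG) e10 hc M'0 _ _ _ _ bA' bG).
    + by move=> e /e01 /hA.
    + by move=> e /e01 /hG.
    + by move=> e /e01 /G0.
    + by move=> e /Wc <-.
  - have hc' : 0 < - W e1 by rewrite oppr_gt0.
    apply: (wronskian_blowup (A := fun e => -1 * A e) (G := G) (dA := fun e => -1 * dA e)
      (dG := dG) e10 hc' M'0 _ _ _ _ _ bG).
    + by move=> e /e01 /hA h; exact: is_derive_mull.
    + by move=> e /e01 /hG.
    + by move=> e /e01 /G0.
    + move=> e /Wc <-; rewrite /W le_eqVlt; apply/orP; left; apply/eqP.
      by move: (sinh e) (dA e) (dG e) (A e) (G e) => *; ring.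
    + by move=> e he; rewrite mulN1r normrN bA'.
have W00 e : e0 < e -> W e = 0.
  by move=> he; rewrite -W0; apply: (constant_of_derive0 hW) => //; exact: e01.
have hq e : e0 < e -> is_derive e 1 (fun e => A e / G e) 0.
  move=> he; have g0 : G e != 0 by rewrite gt_eqF // G0.
  apply: is_derive_as (is_derive_ratio (hA e he) (hG e he) g0) _ _ => //.
  have s0 : sinh e != 0 by rewrite gt_eqF // sinh_gt0 // pos.
  have /eqP := W00 e he; rewrite /W mulf_eq0 (negbTE s0) /= => /eqP ->.
  by rewrite mul0r.
exists (A e1 / G e1 * sg) => e he.
have g0 : G e != 0 by rewrite gt_eqF // G0.
have := constant_of_derive0 hq he (e01 e1 (lexx _)); rewrite /= => h.
by rewrite -mulrA -GE -h divfK.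
Qed.

End legendre_multiple.

Section mode_legendre.
Context {R : realType}.
Variables (e0 : R) (u : 'rV[R]_3 -> R) (M : R).
Hypothesis e00 : 0 < e0.
Hypothesis hu : harmonic_on (solid_torus e0) u.
Hypothesis uM : forall x, solid_torus e0 x -> `|u x| <= M.
Variables (n m : nat) (nu mu : bool).
Implicit Types (e t p : R).

Notation A := (mode_integral n m nu mu (gauged u)).

Lemma wt_le e t : 0 < e -> wt e t <= (Num.sqrt (cosh e - 1))^-1.
Proof.
move=> e_gt0; have h := cosh_gt1 e_gt0.
rewrite lef_pV2 ?posrE ?sqrtr_gt0 ?subr_gt0 //; last by rewrite -subr_gt0 denom_gt0.
by rewrite ler_wsqrtr // lerD2l lerN2 cos_le1.
Qed.

Lemma PhiPhi_le1 t p : `|Phi n nu t * Phi m mu p| <= 1.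
Proof. by rewrite normrM mulr_ile1 // Phi_le1. Qed.

(** The weight is at most (cosh e - 1)^(-1/2), and sinh e <= cosh e <= 2 (cosh e - 1) once cosh e >=
    2. *)
Lemma mode_integral_bound e : e0 < e -> 2 <= cosh e ->
  Num.sqrt (sinh e) * `|A e| <= `|M| * (2 * pi) ^+ 2 * Num.sqrt 2.
Proof.
move=> he he2; have e_gt0 := lt_trans e00 he.
have c1 : 0 < cosh e - 1 by have := he2; lra.
have s0 : 0 < Num.sqrt (cosh e - 1) by rewrite sqrtr_gt0.
have AB : `|A e| <= `|M| * (Num.sqrt (cosh e - 1))^-1 * (2 * pi) ^+ 2.
  apply: angle_integral_le.
    apply: continuous2M; last exact: (@continuous2_PhiPhi R n m nu mu).
    exact: continuous3_2d he (gauged_continuous3 e00 hu).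
  move=> t p _; rewrite normrM -[leRHS]mulr1; apply: ler_pM => //; last exact: PhiPhi_le1.
  rewrite /gauged normrM; apply: ler_pM => //.
    by apply: le_trans (ler_norm _); apply: uM; exact: toroidal_solid.
  by rewrite ger0_norm ?wt_le // ltW // wt_gt0.
have sq : Num.sqrt (sinh e) <= Num.sqrt 2 * Num.sqrt (cosh e - 1).
  rewrite -sqrtrM // ler_wsqrtr // (le_trans (sinh_le_cosh e)) //.
  by move: he2; lra.
apply: le_trans (ler_pM (sqrtr_ge0 _) (normr_ge0 _) sq AB) _.
rewrite le_eqVlt; apply/orP; left; apply/eqP.
by move: s0 (Num.sqrt 2) => + k; move: (Num.sqrt (cosh e - 1)) => s s0; field; rewrite gt_eqF.
Qed.

Lemma mode_multiple : exists k, forall e, e0 < e -> A e = k * torQ n m e.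
Proof.
pose dA := mode_integral n m nu mu (gauged_d1 u wt_e tor_e).
pose ddA := mode_integral n m nu mu (gauged_d2 u wt_e wt_ee tor_e tor_ee).
have hA e : e0 < e -> is_derive e 1 A (dA e) by exact: (is_derive_mode1 e00 hu).
have hdA e : e0 < e -> is_derive e 1 dA (ddA e) by exact: (is_derive_mode2 e00 hu).
have hsA e : e0 < e -> is_derive e 1 (fun e => sinh e * dA e)
    ((n%:R ^+ 2 - 4^-1 + m%:R ^+ 2 / sinh e ^+ 2) * sinh e * A e).
  move=> he; apply: is_derive_as (is_derive_mul (is_derive_sinh e) (hdA e he)) _ _ => //.
  have := mode_ode e00 hu n m nu mu he; rewrite -/ddA -/dA => O.
  have s0 : sinh e != 0 by rewrite gt_eqF // sinh_gt0 // (lt_trans e00 he).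
  rewrite [RHS]mulrAC -O; move: (sinh e) (cosh e) (dA e) (ddA e) s0 => s c x y s0.
  by field.
exact: bounded_legendre_multiple e00 hA hsA mode_integral_bound.
Qed.

End mode_legendre.

(** * The Fourier modes at the boundary *)

Section right_limits.
Context {R : realType}.
Implicit Types (a e : R).

Lemma is_derive_right_quotient (g : R -> R) a d : is_derive a 1 g d ->
  (g e - g a) / (e - a) @[e --> a^'+] --> d.
Proof.
move=> [hd <-]; rewrite /derive.
have E : (fun h : R => h^-1 *: (g (h *: (1 : R^o) + a) - g a)) =
    (fun h => (g (h + a) - g a) / h).
  by apply/funext => h; rewrite /GRing.scale /= mulr1 mulrC.
have h1 : (g (h + a) - g a) / h @[h --> 0^'] --> 'D_1 g a.
  by rewrite -E; exact: hd.
apply/cvgrPdist_lt => eps eps0; move/cvgrPdist_lt: h1 => /(_ _ eps0).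
move=> [r /= r0 hr]; exists r => //= e he ae.
have := hr (e - a); rewrite subrK; apply.
  by rewrite /ball /= sub0r normrN distrC.
by rewrite subr_eq0 gt_eqF.
Qed.

(** B is controlled only to the right of a, so its limit [B0] replaces the value at a: the mean
    value estimate is made between e1 and e, and then e1 tends to a. *)
Lemma derive_limit_quotient (B dB : R -> R) (a B0 L : R) :
  (forall e, a < e -> is_derive e 1 B (dB e)) ->
  B e @[e --> a^'+] --> B0 -> dB e @[e --> a^'+] --> L ->
  (B e - B0) / (e - a) @[e --> a^'+] --> L.
Proof.
move=> hB cB cdB; apply/cvgrPdist_le => eps eps0.
move/cvgrPdist_le: cdB => /(_ _ eps0) [r /= r0 hr].
near=> e.
have ae : a < e by near: e; exact: nbhs_right_gt.
have er : e < a + r / 2 by near: e; apply: nbhs_right_lt; rewrite ltrDl divr_gt0.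
have K e1 : a < e1 -> e1 < e -> `|B e1 - B e - L * (e1 - e)| <= eps * `|e1 - e|.
  move=> ae1 e1e.
  have I t : `|t - e| <= `|e1 - e| -> a < t /\ t - a < r.
    rewrite (distrC e1) (ger0_norm (_ : 0 <= e - e1)) ?subr_ge0 ?(ltW e1e) //.
    by rewrite ler_norml => /andP[h1 h2]; split; move: h1 h2 ae1 e1e er; lra.
  apply: (@mvt_dist _ B dB) => t /I[h1 h2]; first exact: hB.
  rewrite distrC; apply: hr => //=; rewrite distrC ger0_norm // subr_ge0 ltW //.
have : `|B0 - B e - L * (a - e)| <= eps * `|a - e|.
  have c1 : `|B e1 - B e - L * (e1 - e)| @[e1 --> a^'+] --> `|B0 - B e - L * (a - e)|.
    apply: cvg_norm; apply: cvgB; first by apply: cvgB => //; exact: cvg_cst.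
    apply: cvgM; first exact: cvg_cst.
    by apply: cvgB; [exact: cvg_at_right_filter|exact: cvg_cst].
  have c2 : eps * `|e1 - e| @[e1 --> a^'+] --> eps * `|a - e|.
    apply: cvgM; first exact: cvg_cst.
    by apply: cvg_norm; apply: cvgB; [exact: cvg_at_right_filter|exact: cvg_cst].
  apply: (ler_cvg_to c1 c2); near=> e1; apply: K; near: e1.
    exact: nbhs_right_gt.
  exact: nbhs_right_lt.
have d0 : 0 < e - a by rewrite subr_gt0.
have -> : L - (B e - B0) / (e - a) = (B0 - B e - L * (a - e)) / (e - a).
  by field; rewrite gt_eqF.
by rewrite normrM normfV (distrC a) ler_pdivrMr // normr_gt0 gt_eqF.
Unshelve. all: by end_near. Qed.

Lemma cvg_right_ext (f g : R -> R) (a l : R) : (forall e, a < e -> f e = g e) ->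
  g e @[e --> a^'+] --> l -> f e @[e --> a^'+] --> l.
Proof.
move=> fg hg V /hg; rewrite /nbhs /= => -[r /= r0 hr]; exists r => //= e he ae.
by rewrite fg //; exact: hr.
Qed.

End right_limits.

(** * Boundary values of the modes *)

Section boundary.
Context {R : realType}.
Variables (e0 : R) (u f : 'rV[R]_3 -> R).
Hypothesis e00 : 0 < e0.
Hypothesis hu : harmonic_on (solid_torus e0) u.
Hypothesis ucont : {within solid_torus e0 `|` torus e0, continuous u}.
Hypothesis uf : forall x, torus e0 x -> u x = f x.
Implicit Types (e t p : R) (n m : nat) (nu mu : bool).

Lemma closed_torus_bounded :
  exists2 M, 0 <= M & forall x, (solid_torus e0 `|` torus e0) x -> `|u x| <= M.
Proof.
have [|M [_ HM]] := @compact_bounded R R^o (u @` (solid_torus e0 `|` torus e0)).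
  by apply: continuous_compact => //; exact: compact_closed_torus.
exists (`|M| + 1); first by rewrite addr_ge0.
move=> z Kz; apply: (HM (`|M| + 1)); last by exists z.
by rewrite (le_lt_trans (ler_norm _)) // ltrDl.
Qed.

Lemma continuous_toroidal_e e t p : 0 < e -> {for e, continuous (fun e => toroidal e t p)}.
Proof.
move=> he; apply: continuous_row3 => i.
exact: is_derive_continuous (is_derive_toroidal_e t p he i).
Qed.

Lemma boundary_limit t p :
  u (toroidal e t p) @[e --> e0^'+] --> f (toroidal e0 t p).
Proof.
rewrite -uf; last exact: toroidal_torus.
move/subspace_continuousP : ucont => /(_ (toroidal e0 t p)).
move=> /(_ (or_intror (toroidal_torus _ _ _))) h.
move=> V /h /= hV.
have := @continuous_toroidal_e e0 t p e00 _ hV => /=.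
rewrite /nbhs /= => -[r /= r0 hr]; exists r => //= e he ee0.
apply: hr => //; left; exact: toroidal_solid.
Qed.

Let c3_toroidal : forall z : R * R * R, 0 < z.1.1 ->
  {for z, continuous (fun z : R * R * R => toroidal z.1.1 z.1.2 z.2)}.
Proof.
move=> z hz; have h : 0 < z.1.1 / 2 by rewrite divr_gt0.
apply: continuous_row3 => i; apply: (toroidal_continuous3 h) => //.
by rewrite ltr_pdivrMr // ltr_pMr // ltr1n.
Qed.

Lemma boundary_continuous2 : continuous2 (fun t p => f (toroidal e0 t p)).
Proof.
have -> : (fun t p => f (toroidal e0 t p)) = (fun t p => u (toroidal e0 t p)).
  by apply/funext => t; apply/funext => p; rewrite uf //; exact: toroidal_torus.
move=> z.
have c : {for z, continuous (fun z : R * R => toroidal e0 z.1 z.2)}.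
  apply: (@continuous_comp _ _ _ (fun z : R * R => ((e0, z.1), z.2))
    (fun z : R * R * R => toroidal z.1.1 z.1.2 z.2)); last exact: c3_toroidal.
  by apply: continuous_pair; [apply: continuous_pair; [exact: cvg_cst|exact: cvg_fst]|exact: cvg_snd].
move/subspace_continuousP : ucont => /(_ (toroidal e0 z.1 z.2)).
move=> /(_ (or_intror (toroidal_torus _ _ _))) h.
move=> V /h /= hV.
have W : nbhs z [set w : R * R | (solid_torus e0 `|` torus e0) (toroidal e0 w.1 w.2) ->
  V (u (toroidal e0 w.1 w.2))] := c _ hV.
change (nbhs z [set w : R * R | V (u (toroidal e0 w.1 w.2))]).
apply: filterS W => w /=; apply.
by right; exact: toroidal_torus.
Qed.

Lemma continuous_wt e : 0 < e -> continuous (wt e).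
Proof. by move=> he t; exact: is_derive_continuous (is_derive_wt_t t he). Qed.

Lemma continuous_sqrt_den e : 0 < e -> continuous (fun t => Num.sqrt (den e t)).
Proof.
move=> he t; apply: (@continuous_comp _ _ _ (den e) Num.sqrt).
  exact: is_derive_continuous (is_derive_den_t e t).
exact: sqrt_continuous.
Qed.

Section fixed_azimuth.
Variables (m : nat) (nu mu : bool).

Definition boundary_mode n : R := angle_integral (fun t p =>
  f (toroidal e0 t p) * wt e0 t * (Phi n nu t * Phi m mu p)).

Lemma boundary_mode_limit n :
  mode_integral n m nu mu (gauged u) e @[e --> e0^'+] --> boundary_mode n.
Proof.
have [M M0 HM] := closed_torus_bounded.
have e01 : e0 < e0 + 1 by rewrite ltrDl.
pose K := M * (Num.sqrt (cosh e0 - 1))^-1.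
have c0 : 0 < Num.sqrt (cosh e0 - 1) by rewrite sqrtr_gt0 subr_gt0 cosh_gt1.
apply: (@cvg_angle_integral_right _ _ _ e0 (e0 + 1) K) => //.
- move=> e /andP[he _]; apply: continuous2M; last exact: (@continuous2_PhiPhi R n m nu mu).
  exact: continuous3_2d he (gauged_continuous3 e00 hu).
- apply: continuous2M; last exact: (@continuous2_PhiPhi R n m nu mu).
  apply: continuous2M; first exact: boundary_continuous2.
  by apply: continuous2_fst; exact: continuous_wt.
- move=> e t p /andP[he _] _; rewrite normrM -[leRHS]mulr1.
  apply: ler_pM => //; last exact: PhiPhi_le1.
  rewrite /gauged normrM; apply: ler_pM => //.
    by apply: HM; left; exact: toroidal_solid.
  have e_gt0 := lt_trans e00 he.
  rewrite ger0_norm; last by rewrite ltW // wt_gt0.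
  apply: le_trans (wt_le t e_gt0) _.
  have c1 : cosh e0 - 1 <= cosh e - 1 by rewrite lerD2r ltW // ltr_cosh // ltW.
  rewrite lef_pV2 ?posrE // ?ler_wsqrtr //.
  by rewrite sqrtr_gt0 (lt_le_trans _ c1) // -sqrtr_gt0.
- move=> t p _; apply: cvgM; last exact: cvg_cst.
  apply: cvgM; first exact: boundary_limit.
  by apply: cvg_at_right_filter; exact: is_derive_continuous (is_derive_wt_e t e00).
Qed.

(** The right side is differentiable at e0 although u is only continuous up to the boundary: this is
    how the modes acquire a boundary derivative. *)
Lemma mode_legendre n e : e0 < e -> mode_integral n m nu mu (gauged u) e =
  boundary_mode n / torQ n m e0 * torQ n m e.
Proof.
have [M M0 HM] := closed_torus_bounded.
have HM' x : solid_torus e0 x -> `|u x| <= M by move=> hx; apply: HM; left.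
have [k hk] := mode_multiple e00 hu HM' n m nu mu.
have Q0 := torQ_neq0 n m e00.
suff -> : boundary_mode n = k * torQ n m e0 by move=> he; rewrite hk // mulfK.
have c1 := @boundary_mode_limit n.
have c2 : k * torQ n m e @[e --> e0^'+] --> k * torQ n m e0.
  apply: cvgM; first exact: cvg_cst.
  by apply: cvg_at_right_filter; exact: is_derive_continuous (is_derive_torQ n m e00).
apply: (cvg_unique _ c1) => //.
exact: cvg_right_ext hk c2.
Qed.

(** Multiplication by cos t seen on the modes: the mean of the two neighbours, except for the
    constant mode. For sine modes the neighbour of index 0 of the first one is zero. *)
Definition cos_shift (a : nat -> R) n : R :=
  if n is n'.+1 then (a n' + a n'.+2) / 2 else a 1%N.

Lemma cos_Phi n t : admissible n nu ->
  cos t * Phi n nu t = cos_shift (fun j => Phi j nu t) n.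
Proof.
case: n => [|n] adm.
  by move: adm; rewrite /admissible orbF => ->; rewrite /cos_shift /Phi mul0r cos0 mulr1 mul1r.
have E1 : n%:R * t = n.+1%:R * t - t by rewrite -natr1; ring.
have E2 : n.+2%:R * t = n.+1%:R * t + t by rewrite -natr1; ring.
rewrite /= /Phi E1 E2; case: nu; rewrite ?cosB ?cosD ?sinB ?sinD; by field.
Qed.

Lemma angle_integral_cos n (v : R -> R -> R) (c : R) : admissible n nu -> continuous2 v ->
  angle_integral (fun t p => (c - cos t) * v t p * (Phi n nu t * Phi m mu p)) =
  c * angle_integral (fun t p => v t p * (Phi n nu t * Phi m mu p)) -
  cos_shift (fun j => angle_integral (fun t p => v t p * (Phi j nu t * Phi m mu p))) n.
Proof.
move=> adm cv.
have cP j : continuous2 (fun t p => v t p * (Phi j nu t * Phi m mu p)).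
  by apply: continuous2M => //; exact: (@continuous2_PhiPhi R j m nu mu).
have cZ k j : continuous2 (fun t p => k * (v t p * (Phi j nu t * Phi m mu p))).
  by apply: continuous2M => //; exact: continuous2_cst.
case: n adm => [|n] adm.
  rewrite (eq_angle_integral (g2 := fun t p => c * (v t p * (Phi 0 nu t * Phi m mu p)) +
    -1 * (v t p * (Phi 1 nu t * Phi m mu p)))).
    by rewrite angle_integralD // !angle_integralZ // mulN1r.
  move=> t p; have := cos_Phi t adm; rewrite /cos_shift => <-; ring.
rewrite (eq_angle_integral (g2 := fun t p => c * (v t p * (Phi n.+1 nu t * Phi m mu p)) +
    (- 2^-1 * (v t p * (Phi n nu t * Phi m mu p)) +
     - 2^-1 * (v t p * (Phi n.+2 nu t * Phi m mu p))))).
  rewrite angle_integralD //; last exact: continuous2D.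
  rewrite angle_integralD // !angle_integralZ // /cos_shift.
  by move: (angle_integral _) (angle_integral _) (angle_integral _) => *; field.
move=> t p; have := cos_Phi t adm; rewrite /cos_shift => E.
transitivity (c * (v t p * (Phi n.+1 nu t * Phi m mu p)) -
  v t p * Phi m mu p * (cos t * Phi n.+1 nu t)); first by ring.
rewrite E; move: (v t p) (Phi m mu p) (Phi n nu t) (Phi n.+2 nu t) (Phi n.+1 nu t) => *.
by field.
Qed.

Lemma sqrt_denE e t : 0 < e -> Num.sqrt (den e t) = den e t * wt e t.
Proof.
move=> he; have d0 := den_gt0 t he; rewrite /wt -{2}(sqr_sqrtr (ltW d0)).
by rewrite expr2 mulfK // gt_eqF // sqrtr_gt0.
Qed.

Lemma is_derive_sqrt_den e t : 0 < e ->
  is_derive e 1 (fun e => Num.sqrt (den e t)) (sinh e / 2 * wt e t).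
Proof.
move=> he; have d0 := den_gt0 t he.
have h := is_derive1_sqrt d0.
have hs := @is_derive1_comp R Num.sqrt (den^~ t) e _ _ h (is_derive_den_e e t).
apply: is_derive_as hs _ _ => //.
by rewrite mulrC /wt invfM mulrA.
Qed.

(** The difference quotient falls on the explicit weight only, while u is bounded and tends to f; no
    derivative of u enters. The factor sinh / 2 * wt is the derivative of sqrt (den e t). *)
Lemma defect_limit n :
  mode_integral n m nu mu (fun e t p => pull_u u e t p *
     (Num.sqrt (den e0 t) - Num.sqrt (den e t))) e / (e - e0) @[e --> e0^'+] -->
  - (sinh e0 / 2) * boundary_mode n.
Proof.
have [M M0 HM] := closed_torus_bounded.
have e01 : e0 < e0 + 1 by rewrite ltrDl.
have cF e : e0 < e -> continuous2 (fun t p => pull_u u e t p *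
     (Num.sqrt (den e0 t) - Num.sqrt (den e t)) * (Phi n nu t * Phi m mu p)).
  move=> he; apply: continuous2M; last exact: (@continuous2_PhiPhi R n m nu mu).
  apply: continuous2M; first exact: continuous3_2d he (pull_u_continuous3 e00 hu).
  apply: continuous2_fst => t; apply: cvgB; apply: continuous_sqrt_den => //.
  exact: lt_trans he.
have cL : continuous2 (fun t p => f (toroidal e0 t p) * wt e0 t * (Phi n nu t * Phi m mu p)).
  apply: continuous2M; last exact: (@continuous2_PhiPhi R n m nu mu).
  apply: continuous2M; first exact: boundary_continuous2.
  by apply: continuous2_fst; exact: continuous_wt.
rewrite -angle_integralZ //.
apply: (cvg_right_ext (g := fun e => angle_integral (fun t p => (e - e0)^-1 * (pull_u u e t p *
     (Num.sqrt (den e0 t) - Num.sqrt (den e t)) * (Phi n nu t * Phi m mu p))))).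
  by move=> e he; rewrite (angle_integralZ _ (cF _ he)) [RHS]mulrC.
(* Bounds sinh x / 2 * wt x t, the derivative of sqrt (den x t), for x between e0 and e0 + 1. *)
pose K := cosh (e0 + 1) * (Num.sqrt (cosh e0 - 1))^-1.
have c0 : 0 < Num.sqrt (cosh e0 - 1) by rewrite sqrtr_gt0 subr_gt0 cosh_gt1.
have wtK e t : e0 <= e -> wt e t <= (Num.sqrt (cosh e0 - 1))^-1.
  move=> he; have e_gt0 := lt_le_trans e00 he.
  apply: le_trans (wt_le t e_gt0) _.
  have c1 : cosh e0 - 1 <= cosh e - 1.
    rewrite lerD2r; move: he; rewrite le_eqVlt => /orP[/eqP -> //|he].
    by rewrite ltW // ltr_cosh // ltW.
  rewrite lef_pV2 ?posrE // ?ler_wsqrtr //.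
  by rewrite sqrtr_gt0 (lt_le_trans _ c1) // -sqrtr_gt0.
apply: (@cvg_angle_integral_right _ _ _ e0 (e0 + 1) (M * K)) => //.
- move=> e /andP[he _]; apply: continuous2M; last exact: cF.
  exact: continuous2_cst.
- by apply: continuous2M => //; exact: continuous2_cst.
- move=> e t p /andP[he he1] _.
  have d0 : 0 < e - e0 by rewrite subr_gt0.
  have Dq : `|Num.sqrt (den e0 t) - Num.sqrt (den e t)| <= K * `|e0 - e|.
    have [||x] := @MVT R (fun e => Num.sqrt (den e t)) (fun e => sinh e / 2 * wt e t) e0 e he.
    + move=> x; rewrite in_itv /= => /andP[h1 _]; apply: is_derive_sqrt_den.
      exact: lt_trans h1.
    + apply: derivable_within_continuous => x; rewrite in_itv /= => /andP[h1 _].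
      by case: (is_derive_sqrt_den t (lt_le_trans e00 h1)).
    rewrite in_itv /= => /andP[h1 h2] E; rewrite distrC E normrM (distrC e0).
    have x0 := lt_trans e00 h1.
    have s0 := sinh_gt0 x0; have w0 := wt_gt0 t x0.
    rewrite ler_wpM2r // ger0_norm; last by rewrite mulr_ge0 ?(ltW w0) // divr_ge0 // ltW.
    apply: (@ler_pM _ (sinh x / 2) (cosh (e0 + 1)) (wt x t)).
    - by move: s0; move: (sinh x) => z; lra.
    - exact: ltW.
    - apply: (@le_trans _ _ (sinh x)); first by move: s0; move: (sinh x) => z; lra.
      apply: le_trans (sinh_le_cosh x) _; apply: ltW; apply: ltr_cosh; first exact: ltW.
      exact: lt_trans he1.
    - by apply: wtK; exact: ltW.
  have pull : `|pull_u u e t p| <= M by apply: HM; left; exact: toroidal_solid.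
  have pp := PhiPhi_le1 n m nu mu t p.
  rewrite normrM normfV [in X in X^-1]ger0_norm ?(ltW d0) // mulrC ler_pdivrMr //.
  rewrite normrM -[leRHS]mulr1; apply: ler_pM => //.
  rewrite normrM -mulrA; apply: ler_pM => //.
  by rewrite (le_trans Dq) // distrC ger0_norm // ltW.
- move=> t p _.
  have h := is_derive_right_quotient (is_derive_sqrt_den t e00).
  have hu' := @boundary_limit t p.
  apply: (cvg_right_ext (g := fun e => - (u (toroidal e t p) * ((Num.sqrt (den e t) - Num.sqrt (den e0 t)) / (e - e0))
     * (Phi n nu t * Phi m mu p)))).
    move=> e he; rewrite /pull_u; move: (e - e0)^-1 (u _) (Num.sqrt _) (Num.sqrt _) => *; ring.
  have -> : - (sinh e0 / 2) * (f (toroidal e0 t p) * wt e0 t * (Phi n nu t * Phi m mu p)) =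
   - (f (toroidal e0 t p) * (sinh e0 / 2 * wt e0 t) * (Phi n nu t * Phi m mu p)).
    move: (sinh e0 / 2) (f _) (wt _ _) => *; ring.
  by apply: cvgN; apply: cvgM; [apply: cvgM|exact: cvg_cst].
Qed.

Lemma is_derive_cos_shift (a da : nat -> R -> R) n e :
  (forall j, is_derive e 1 (a j) (da j e)) ->
  is_derive e 1 (fun e => cos_shift (fun j => a j e) n) (cos_shift (fun j => da j e) n).
Proof.
move=> h; case: n => [|n]; rewrite /cos_shift; first exact: h.
have := is_derive_mull 2^-1 (is_derive_add (h n) (h n.+2)).
move=> h'; apply: is_derive_as h' _ _ => [y|]; exact: mulrC.
Qed.

Lemma cos_shiftZ c (a : nat -> R) n : cos_shift (fun j => c * a j) n = c * cos_shift a n.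
Proof. by case: n => [|n] //=; rewrite mulrA mulrDr. Qed.

(* With w = sqrt (cosh e - cos t), split the integral of u sqrt (cosh e0 - cos t)
   as the integral of u w, known explicitly in e, plus a defect of first order in
   e - e0; the derivative at e0 of the sum is L. *)
Lemma boundary_relation n (L : R) : admissible n nu ->
  mode_integral n m nu mu (fun e t p => pull_d1 u tor_e e t p * Num.sqrt (den e0 t)) e
    @[e --> e0^'+] --> L ->
  L = sinh e0 / 2 * boundary_mode n - cosh e0 * (torL n m e0 * boundary_mode n)
      + cos_shift (fun j => torL j m e0 * boundary_mode j) n.
Proof.
move=> adm hL.
pose F := boundary_mode.
pose B := mode_integral n m nu mu (fun e t p => pull_u u e t p * Num.sqrt (den e0 t)).
pose D := mode_integral n m nu mu (fun e t p => pull_u u e t p *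
     (Num.sqrt (den e0 t) - Num.sqrt (den e t))).
pose A j e := F j / torQ j m e0 * torQ j m e.
pose C e := cosh e * A n e - cos_shift (fun j => A j e) n.
have cw e : e0 < e -> continuous2 (fun t p => pull_u u e t p * Num.sqrt (den e t)).
  move=> he; apply: continuous2M; first exact: continuous3_2d he (pull_u_continuous3 e00 hu).
  by apply: continuous2_fst; apply: continuous_sqrt_den; exact: lt_trans he.
have cw0 e : e0 < e -> continuous2 (fun t p => pull_u u e t p * Num.sqrt (den e0 t)).
  move=> he; apply: continuous2M; first exact: continuous3_2d he (pull_u_continuous3 e00 hu).
  by apply: continuous2_fst; exact: continuous_sqrt_den.
have cPP := @continuous2_PhiPhi R n m nu mu.
(* Since sqrt (den e t) = den e t * wt e t, the part u * sqrt (den e t) is (cosh e - cos t) times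
   the gauged function, whose modes are explicit. *)
have BE e : e0 < e -> B e = C e + D e.
  move=> he; have e_gt0 := lt_trans e00 he.
  have -> : C e = angle_integral (fun t p => (cosh e - cos t) * gauged u e t p *
      (Phi n nu t * Phi m mu p)).
    rewrite angle_integral_cos //; last exact: continuous3_2d he (gauged_continuous3 e00 hu).
    rewrite /C /A; congr (_ * _ - _); first by rewrite -mode_legendre.
    by congr (cos_shift _ n); apply/funext => j; rewrite -mode_legendre.
  rewrite /B /D /mode_integral -angle_integralD.
  - apply: eq_angle_integral => t p; rewrite /gauged -/(den e t) -mulrDl; congr (_ * _).
    rewrite (sqrt_denE t e_gt0); move: (den e t) (wt e t) (pull_u _ _ _ _) (Num.sqrt _) => *; ring.
  - apply: continuous2M => //; apply: continuous2M.
      by apply: continuous2_fst => t; exact: is_derive_continuous (is_derive_den_t e t).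
    exact: continuous3_2d he (gauged_continuous3 e00 hu).
  - apply: continuous2M => //.
    have -> : (fun t p => pull_u u e t p * (Num.sqrt (den e0 t) - Num.sqrt (den e t))) =
     (fun t p => pull_u u e t p * Num.sqrt (den e0 t) + -1 * (pull_u u e t p * Num.sqrt (den e t))).
      by apply/funext => t; apply/funext => p; ring.
    apply: continuous2D; first exact: cw0.
    by apply: continuous2M; [exact: continuous2_cst|exact: cw].
have Q0 j := torQ_neq0 j m e00.
have A0 j : A j e0 = F j by rewrite /A divfK.
have hA j : is_derive e0 1 (A j) (- (torL j m e0 * F j)).
  have := is_derive_mull (F j / torQ j m e0) (is_derive_torQ j m e00).
  move=> h; apply: is_derive_as h _ _ => //.
  by rewrite /torL; have := Q0 j; move: (torQ _ _ _) (dtorQ _ _ _) => q d q0; field.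
have hC : is_derive e0 1 C (sinh e0 * F n + cosh e0 * (- (torL n m e0 * F n)) +
    -1 * cos_shift (fun j => - (torL j m e0 * F j)) n).
  have hs := @is_derive_cos_shift A (fun j _ => - (torL j m e0 * F j)) n e0 hA.
  have := is_derive_add (is_derive_mul (is_derive_cosh e0) (hA n)) (is_derive_mull (-1) hs).
  by move=> h; apply: is_derive_as h _ _ => [y|]; rewrite ?A0 // mulN1r.
have qC := is_derive_right_quotient hC.
have qD := @defect_limit n; rewrite -/D -/F in qD.
have id0 : (e - e0) @[e --> e0^'+] --> (0 : R).
  rewrite -[X in _ --> X](subrr e0); apply: cvgB; [exact: cvg_at_right_filter|exact: cvg_cst].
have D0 : D e @[e --> e0^'+] --> (0 : R).
  apply: (cvg_right_ext (g := fun e => D e / (e - e0) * (e - e0))).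
    by move=> e he; rewrite divfK // subr_eq0 gt_eqF.
  rewrite -[X in _ --> X](mulr0 (- (sinh e0 / 2) * F n)); exact: cvgM qD id0.
have B0 : B e @[e --> e0^'+] --> C e0.
  apply: (cvg_right_ext BE); rewrite -[X in _ --> X]addr0; apply: cvgD D0.
  by apply: cvg_at_right_filter; exact: is_derive_continuous hC.
have hB e : e0 < e -> is_derive e 1 B (mode_integral n m nu mu
    (fun e t p => pull_d1 u tor_e e t p * Num.sqrt (den e0 t)) e).
  have cs : continuous3 e0 (fun _ t _ => Num.sqrt (den e0 t)).
    by apply: continuous3_2; exact: continuous_sqrt_den.
  move=> he; apply: is_derive_mode_integral he _ _ _.
  - exact: continuous3M (pull_u_continuous3 e00 hu) cs.
  - exact: continuous3M (pull_d1_continuous3 e00 hu (tor_e_continuous3 e00)) cs.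
  - move=> e' t p he'; have h := is_derive_pull_e e00 hu t p he'.
    by apply: is_derive_as (is_derive_mull (Num.sqrt (den e0 t)) h) _ _ => [y|]; exact: mulrC.
(* The right derivative of B at e0 is computed twice: from the Neumann data in [q1], from the
   explicit modes and the defect in [q2]. *)
have q1 := derive_limit_quotient hB B0 hL.
have q2 : (B e - C e0) / (e - e0) @[e --> e0^'+] --> sinh e0 * F n + cosh e0 * (- (torL n m e0 * F n)) +
    -1 * cos_shift (fun j => - (torL j m e0 * F j)) n + - (sinh e0 / 2) * F n.
  apply: (cvg_right_ext (g := fun e => (C e - C e0) / (e - e0) + D e / (e - e0))); last exact: cvgD.
  by move=> e he; rewrite BE // -mulrDl; congr (_ / _); ring.
rewrite (cvg_unique _ q1 q2) //.
have -> : cos_shift (fun j => - (torL j m e0 * F j)) n = - cos_shift (fun j => torL j m e0 * F j) n.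
  by rewrite -mulN1r -cos_shiftZ; congr cos_shift; apply/funext => j; rewrite mulN1r.
rewrite -/F; move: (cos_shift _ _) (F n) (torL _ _ _) (cosh e0) (sinh e0) => *; by field.
Qed.

End fixed_azimuth.

End boundary.

(** * Test functions that extract the Neumann data *)

Section test_functions.
Context {R : realType}.
Variable e0 : R.
Hypothesis e00 : 0 < e0.
Implicit Types (n m k : nat) (nu mu : bool) (t p : R).

(* Closed under differentiation, which gives [Ck] at every order. *)
Inductive smooth_expr : (R -> R) -> Prop :=
| smooth_cst c : smooth_expr (fun=> c)
| smooth_Phi n nu : smooth_expr (Phi n nu)
| smooth_sqrt : smooth_expr (fun t => Num.sqrt (den e0 t))
| smooth_wt : smooth_expr (wt e0)
| smooth_add f g : smooth_expr f -> smooth_expr g -> smooth_expr (fun t => f t + g t)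
| smooth_mul f g : smooth_expr f -> smooth_expr g -> smooth_expr (fun t => f t * g t).

Lemma smooth_derive f : smooth_expr f ->
  exists2 df, smooth_expr df & forall t, is_derive t 1 f (df t).
Proof.
elim=> {f} [c|n nu|||f g _ [df sdf hf] _ [dg sdg hg]|f g sf [df sdf hf] sg [dg sdg hg]].
- by exists (fun=> 0); [exact: smooth_cst|move=> t; exact: is_derive_cst].
- exists (fun t => (if nu then - n%:R else n%:R) * Phi n (~~ nu) t).
    by apply: smooth_mul; [exact: smooth_cst|exact: smooth_Phi].
  exact: is_derive_Phi.
- exists (fun t => 2^-1 * (Phi 1 false t * wt e0 t)).
    apply: smooth_mul; first exact: smooth_cst.
    by apply: smooth_mul; [exact: smooth_Phi|exact: smooth_wt].
  move=> t; have h := is_derive1_sqrt (den_gt0 t e00).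
  apply: is_derive_as (@is_derive1_comp R Num.sqrt (den e0) t _ _ h (is_derive_den_t e0 t)) _ _ => //.
  by rewrite invfM /Phi mul1r /wt -mulrA [_^-1 * sin t]mulrC.
- exists (fun t => - 2^-1 * (Phi 1 false t * (wt e0 t * (wt e0 t * wt e0 t)))).
    apply: smooth_mul; first exact: smooth_cst.
    apply: smooth_mul; first exact: smooth_Phi.
    by do 2?[apply: smooth_mul]; exact: smooth_wt.
  move=> t; apply: is_derive_as (is_derive_wt_t t e00) _ _ => //.
  have d0 := den_gt0 t e00.
  have -> : den e0 t = (wt e0 t) ^- 2 by rewrite /wt exprVn invrK sqr_sqrtr // ltW.
  rewrite /Phi mul1r; have := wt_gt0 t e00; move: (wt e0 t) (sin t) => w s w0.
  by field; rewrite gt_eqF.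
- exists (fun t => df t + dg t); first exact: smooth_add.
  by move=> t; exact: is_derive_add.
- exists (fun t => df t * g t + f t * dg t).
    by apply: smooth_add; exact: smooth_mul.
  by move=> t; exact: is_derive_mul.
Qed.

Lemma smooth_continuous f : smooth_expr f -> continuous f.
Proof. by move=> /smooth_derive[df _ hf] t; exact: is_derive_continuous (hf t). Qed.

Lemma smooth_Ck k f g : smooth_expr f -> smooth_expr g -> Ck k (fun t p => f t * g p).
Proof.
have c f1 g1 : smooth_expr f1 -> smooth_expr g1 -> continuous2 (fun t p => f1 t * g1 p).
  by move=> s1 s2; apply: continuous2M; [apply: continuous2_fst|apply: continuous2_snd];
    exact: smooth_continuous.
elim: k f g => [|k IH] f g sf sg; first by split=> //; exact: c.
have [df sdf hf] := smooth_derive sf; have [dg sdg hg] := smooth_derive sg.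
have h1 t p : is_derive t 1 (fun t => f t * g p) (df t * g p).
  by apply: is_derive_as (is_derive_mull (g p) (hf t)) _ _ => [y|]; exact: mulrC.
have h2 t p : is_derive p 1 (fun p => f t * g p) (f t * dg p) by exact: is_derive_mull.
split; first exact: c.
split=> [t p|t p||]; first by case: (h1 t p).
- by case: (h2 t p).
- rewrite (_ : (fun _ _ => _) = (fun t p => df t * g p)); first exact: IH.
  by apply/funext => t; apply/funext => p; rewrite derive1E; case: (h1 t p).
- rewrite (_ : (fun _ _ => _) = (fun t p => f t * dg p)); first exact: IH.
  by apply/funext => t; apply/funext => p; rewrite derive1E; case: (h2 t p).
Qed.

Lemma den_periodic e t : den e (t + 2 * pi) = den e t :> R.
Proof. by rewrite /den (_ : t + 2 * pi = t + pi *+ 2) ?cosD2pi // mulr_natl. Qed.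

(* The weight cancels the area element and leaves sqrt (den e0 t) against u_eta. *)
Definition normal_test n m nu mu t p : R :=
  (sinh e0)^-1 * (Num.sqrt (den e0 t) * (den e0 t * Phi n nu t)) * Phi m mu p.

Lemma normal_test_function n m nu mu : test_function (normal_test n m nu mu).
Proof.
split.
- move=> k; apply: (@smooth_Ck k (fun t => (sinh e0)^-1 * (Num.sqrt (den e0 t) *
    (den e0 t * Phi n nu t))) (Phi m mu)); last exact: smooth_Phi.
  apply: smooth_mul; first exact: smooth_cst.
  apply: smooth_mul; first exact: smooth_sqrt.
  apply: smooth_mul; last exact: smooth_Phi.
  rewrite (_ : den e0 = (fun t => Num.sqrt (den e0 t) * Num.sqrt (den e0 t))).
    by apply: smooth_mul; exact: smooth_sqrt.
  by apply/funext => t; rewrite -expr2 sqr_sqrtr // ltW // den_gt0.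
- by move=> t p; rewrite /normal_test den_periodic Phi_periodic.
- by move=> t p; rewrite /normal_test Phi_periodic.
Qed.

Lemma area_elementE t p : area_element e0 t p = sinh e0 / den e0 t ^+ 2.
Proof.
have Et : tangent_theta e0 t p = tor_t e0 t p.
  apply/rowP => i; rewrite mxE derive1E.
  by case: (is_derive_toroidal_t t p e00 i).
have Ep : tangent_phi e0 t p = tor_p e0 t p.
  apply/rowP => i; rewrite mxE derive1E.
  by case: (is_derive_toroidal_p e0 t p i).
rewrite /area_element Et Ep /dot !sum3 !mxE /=.
have d0 := den_gt0 t e00; have s0 := sinh_gt0 e00.
have ct : sin t ^+ 2 = 1 - cos t ^+ 2 by rewrite -(cos2Dsin2 t) addrAC subrr add0r.
have cp : sin p ^+ 2 = 1 - cos p ^+ 2 by rewrite -(cos2Dsin2 p) addrAC subrr add0r.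
have cs : sinh e0 ^+ 2 = cosh e0 ^+ 2 - 1 by rewrite -(cosh2B e0) opprB addrC subrK.
rewrite -[RHS]ger0_norm; last by rewrite divr_ge0 ?exprn_ge0 // ltW.
rewrite -sqrtr_sqr; congr Num.sqrt.
move: d0 s0 ct cp cs; rewrite /den.
move: (cosh e0) (sinh e0) (cos t) (sin t) (cos p) (sin p) => C S c s k l d0 s0 ct cp cs.
by field: ct cp cs; rewrite gt_eqF.
Qed.

Variables (u h : 'rV[R]_3 -> R) (g : R -> R -> R).
Hypothesis hu : harmonic_on (solid_torus e0) u.
Hypothesis hn : normal_derivative e0 u h.
Hypothesis hg : forall t p, h (toroidal e0 t p) = Num.sqrt (cosh e0 - cos t) * g t p.

Lemma normal_mode_limit n m nu mu :
  mode_integral n m nu mu (fun e t p => pull_d1 u tor_e e t p * Num.sqrt (den e0 t)) e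
    @[e --> e0^'+] --> angle_integral (fun t p => g t p * (Phi n nu t * Phi m mu p)).
Proof.
have := hn (normal_test_function n m nu mu).
have s0 : sinh e0 != 0 by rewrite gt_eqF // sinh_gt0.
have -> : surface_integral e0 (fun t p => h (toroidal e0 t p) * normal_test n m nu mu t p) =
    angle_integral (fun t p => g t p * (Phi n nu t * Phi m mu p)).
  apply: eq_angle_integral => t p; rewrite hg -/(den e0 t) area_elementE /normal_test.
  have d0 := den_gt0 t e00; have := sqr_sqrtr (ltW d0).
  move: s0 (gt_eqF d0); move: (sinh e0) (den e0 t) (Num.sqrt (den e0 t)) (g t p)
    (Phi n nu t) (Phi m mu p) => s d w x y z s0 d0' w2.
  have -> : w * x * (s^-1 * (w * (d * y)) * z) * (s / d ^+ 2) =
    w ^+ 2 * (x * (s^-1 * ((d * y)) * z) * (s / d ^+ 2)) by ring.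
  by rewrite w2; field; rewrite s0 d0'.
apply: cvg_right_ext => e he.
apply: eq_angle_integral => t p; rewrite -/(den e0 t) area_elementE /normal_test.
have -> : d_eta u e t p = pull_d1 u tor_e e t p.
  by rewrite /d_eta derive1E; case: (is_derive_pull_e e00 hu t p he).
have d0 := den_gt0 t e00.
move: s0 (gt_eqF d0); move: (sinh e0) (den e0 t) (Num.sqrt (den e0 t)) (pull_d1 u _ e t p)
  (Phi n nu t) (Phi m mu p) => s d w x y z s0 d0'.
by field; rewrite s0 d0'.
Qed.

End test_functions.

(** * The theorem of Denjoy and Luzin *)

Lemma Rintegral_sum d (Y : measurableType d) (R : realType) (mu : {measure set Y -> \bar R})
    (D : set Y) (F : nat -> Y -> R) (N : nat) : measurable D ->
  (forall k, mu.-integrable D (EFin \o F k)) ->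
  mu.-integrable D (EFin \o (fun y => \sum_(0 <= k < N) F k y)) /\
  \int[mu]_(y in D) (\sum_(0 <= k < N) F k y) = \sum_(0 <= k < N) \int[mu]_(y in D) F k y.
Proof.
move=> mD iF; elim: N => [|N [IH1 IH2]].
  split.
    under eq_fun do rewrite /= big_geq //.
    exact: integrable0.
  rewrite [RHS]big_geq //; under eq_Rintegral do rewrite big_geq //.
  by rewrite Rintegral_cst ?mul0r.
have E : (fun y => \sum_(0 <= k < N.+1) F k y) = (fun y => (\sum_(0 <= k < N) F k y) + F N y).
  by apply/funext => y; rewrite big_nat_recr.
split; rewrite E; last by rewrite RintegralD // big_nat_recr // IH2.
have := integrableD mD IH1 (iF N).
by rewrite (_ : (_ \+ _)%E = EFin \o (fun y => (\sum_(0 <= k < N) F k y) + F N y)) //.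
Qed.

(* Egorov-type argument: the partial sums of |b_k psi_k| are uniformly bounded off a
   set so small that it cannot carry the mass of any |psi_k|. *)
Lemma denjoy_luzin d (Y : measurableType d) (R : realType) (mu : {measure set Y -> \bar R})
    (D : set Y) (V c : R) (psi : nat -> Y -> R) (b : nat -> R) :
  measurable D -> mu D = V%:E -> 0 < c -> (forall k, measurable_fun D (psi k)) ->
  (forall k y, D y -> `|psi k y| <= 1) ->
  (forall k, b k != 0 -> c <= \int[mu]_(y in D) `|psi k y|) ->
  (forall y, D y -> exists C, forall N, \sum_(0 <= k < N) `|b k * psi k y| <= C) ->
  exists B, forall N, \sum_(0 <= k < N) `|b k| <= B.
Proof.
move=> mD muD c0 mpsi psi1 psic hC.
pose S N y := \sum_(0 <= k < N) `|b k * psi k y|.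
have mabs k : measurable_fun D (fun y => `|psi k y|).
  exact: measurableT_comp (@normr_measurable R setT) (mpsi k).
have mterm k : measurable_fun D (fun y => `|b k * psi k y|).
  apply: measurableT_comp (@normr_measurable R setT) _.
  by apply: measurable_funM => //; exact: measurable_cst.
have mS N : measurable_fun D (S N).
  elim: N => [|N IH]; rewrite /S.
    by under eq_fun do rewrite big_geq //; exact: measurable_cst.
  under eq_fun do rewrite big_nat_recr //=.
  exact: measurable_funD.
pose E M := [set y | D y /\ forall N, S N y <= M%:R].
have ED M : E M `<=` D by move=> y [].
have mE M : measurable (E M).
  have -> : E M = D `&` \bigcap_N (D `&` S N @^-1` [set x | x <= M%:R]).
    apply/seteqP; split => [y [Dy h]|y [Dy h]]; split => //.
      by move=> N _; split => //=; exact: h.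
    by move=> N; case: (h N I).
  apply: measurableI => //; apply: bigcapT_measurable => N.
  have -> : [set x | x <= M%:R] = `]-oo, M%:R]%classic :> set R.
    by apply/seteqP; split => x; rewrite /= in_itv.
  by apply: mS => //; exact: measurable_itv.
have UE : \bigcup_M E M = D.
  apply/seteqP; split => [y [M _ []] //|y Dy].
  have [C HC] := hC y Dy; exists (Num.truncn C).+1 => //; split => // N.
  apply: le_trans (HC N) _; apply: ltW.
  by case: (lerP 0 C) => h; [case/andP: (truncn_itv h)|apply: lt_trans h _].
have cE : mu (E M) @[M --> \oo] --> V%:E.
  rewrite -muD -UE; apply: nondecreasing_cvg_mu => //; first by rewrite UE.
  move=> i j ij; apply/subsetPset => y [Dy h]; split => // N.
  by rewrite (le_trans (h N)) // ler_nat.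
have muDoo : (mu D < +oo)%E by rewrite muD ltry.
have muEoo M : (mu (E M) < +oo)%E.
  by apply: le_lt_trans muDoo; apply: le_measure => //; rewrite inE.
have fE M : mu (E M) \is a fin_num by rewrite ge0_fin_numE.
(* The sets E M increase to D. As |psi k| <= 1, discarding measure c / 2 lowers each integral by at
   most c / 2, uniformly in k. *)
have [M HM] : exists M, V - fine (mu (E M)) <= c / 2.
  have /fine_cvgP[_ /cvgrPdist_le /(_ (c / 2))] := cE.
  rewrite divr_gt0 // => /(_ isT) [M _ hM]; exists M.
  by have := hM M (leqnn M); rewrite /= => h; exact: le_trans (ler_norm _) h.
have V0 : 0 <= V by rewrite -lee_fin -muD.
have bint A (F : Y -> R) (K : R) : measurable A -> A `<=` D -> measurable_fun D F ->
    (forall y, A y -> `|F y| <= K) -> mu.-integrable A (EFin \o F).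
  move=> mA AD mF FK; apply: measurable_bounded_integrable => //.
  - by apply: le_lt_trans muDoo; apply: le_measure => //; rewrite inE.
  - exact: measurable_funS mF.
  - exists K; split; first exact: num_real.
    by move=> M' KM y Ay /=; rewrite (le_trans (FK y Ay)) // ltW.
have lower k : b k != 0 -> c / 2 <= \int[mu]_(y in E M) `|psi k y|.
  move=> bk; have := psic k bk.
  have mDE : measurable (D `\` E M) by exact: measurableD.
  have DU : D = E M `|` (D `\` E M) by rewrite setDUK.
  have b1 y : D y -> `| `|psi k y| | <= 1 by move=> Dy; rewrite normr_id psi1.
  rewrite {1}DU Rintegral_setU //; last 2 first.
  - by rewrite -DU; apply: (bint _ _ 1).
  - by apply/disj_setPS => y [h1 [_ h2]].
  have : \int[mu]_(y in D `\` E M) `|psi k y| <= c / 2.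
    apply: (@le_trans _ _ (\int[mu]_(y in D `\` E M) 1)).
      apply: le_Rintegral => //.
      - by apply: (bint _ _ 1) => // y [Dy _]; exact: b1.
      - by apply: (bint _ (fun=> 1) 1) => // y _; rewrite normr1.
      - by move=> y [Dy _]; exact: psi1.
    rewrite Rintegral_cst // mul1r measureD //.
    have -> : D `&` E M = E M by apply/setIidPr.
    have -> : (mu D - mu (E M) = (V - fine (mu (E M)))%:E)%E by rewrite EFinB fineK // -muD.
    exact: HM.
  lra.
have [V1 hV1] : exists V1, V1 = fine (mu (E M)) by eexists.
(* c / 2 times the sum of the |b k| is at most the integral of S N over E M, where S N <= M. *)
exists (M%:R * V1 / (c / 2)) => N; rewrite ler_pdivlMr ?divr_gt0 //.
have iterm k : mu.-integrable (E M) (EFin \o (fun y => `|b k * psi k y|)).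
  apply: (bint _ _ `|b k|) => // y [Dy _].
  by rewrite normr_id normrM ler_piMr // psi1.
have [iS SE] := Rintegral_sum N (mE M) iterm.
have : \int[mu]_(y in E M) S N y <= M%:R * V1.
  rewrite hV1 -Rintegral_cst //; apply: le_Rintegral => //.
    by apply: (bint _ (fun=> M%:R) M%:R) => // y _; rewrite normr_nat.
  by move=> y [_].
apply: le_trans; rewrite SE mulr_suml; apply: ler_sum => k _.
under eq_Rintegral do rewrite normrM.
rewrite RintegralZl //; last by apply: (bint _ _ 1) => // y [Dy _]; rewrite normr_id psi1.
have [->|bk] := eqVneq (b k) 0; first by rewrite normr0 !mul0r.
by rewrite ler_wpM2l // lower.
Qed.

(** * Orthogonality of the trigonometric system *)

Section orthogonality.
Context {R : realType}.
Notation leb := (@lebesgue_measure R).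
Implicit Types (n m k : nat) (nu mu : bool).

Lemma periodic_integral0 (F f : R -> R) : continuous f ->
  (forall x : R, is_derive x 1 F (f x)) -> F pi = F (- pi) ->
  \int[leb]_(x in `[- pi, pi]) f x = 0.
Proof. by move=> cf dF e; rewrite (integral_derive_segment cf dF) e subrr. Qed.

Let I (f : R -> R) := \int[leb]_(x in `[- pi, pi]) f x.

Let IZ c (f : R -> R) : continuous f -> I (fun x => c * f x) = c * I f.
Proof.
move=> cf; rewrite /I RintegralZl //; exact: segment_integrable.
Qed.

Let ID (f g : R -> R) : continuous f -> continuous g -> I (fun x => f x + g x) = I f + I g.
Proof. by move=> cf cg; rewrite /I RintegralD //; exact: segment_integrable. Qed.

Let cM (f g : R -> R) : continuous f -> continuous g -> continuous (fun x => f x * g x).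
Proof. by move=> cf cg x; apply: cvgM; [exact: cf|exact: cg]. Qed.

(** For n different from k, (k^2 - n^2) times the product is the derivative of a Wronskian; for n =
    k and opposite parities, the primitive is half a square up to sign and the factor n. The norms
    follow from cos^2 + sin^2 = 1 and from n (cos^2 - sin^2) being the derivative of cos (n x) sin
    (n x). *)
Lemma Phi_orthogonal n nu k ka : admissible n nu -> admissible k ka ->
  I (fun x => Phi n nu x * Phi k ka x) =
  if (n == k) && (nu == ka) then Phi_sqnorm n else 0.
Proof.
move=> an ak.
have cP j b : continuous (Phi j b : R -> R) by exact: continuous_Phi.
have cd j b : continuous (dPhi j b : R -> R) by exact: continuous_dPhi.
have [nk|nk] := eqVneq n k; last first.
  have z : k%:R ^+ 2 - n%:R ^+ 2 != 0 :> R.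
    by rewrite subr_eq0 eqrXn2 ?ler0n // eqr_nat eq_sym.
  apply: (mulfI z); rewrite mulr0 -IZ; last exact: cM.
  apply: (@periodic_integral0 (fun x => dPhi n nu x * Phi k ka x - Phi n nu x * dPhi k ka x)).
  - by move=> x; apply: cvgM; [exact: cvg_cst|exact: cM].
  - move=> x; apply: is_derive_as (is_derive_add (is_derive_mul (is_derive_dPhi n nu x)
      (is_derive_Phi k ka x)) (is_derive_mull (-1) (is_derive_mul (is_derive_Phi n nu x)
      (is_derive_dPhi k ka x)))) _ _ => [y|]; first by rewrite mulN1r.
    ring.
  - by rewrite !Phi_pi !dPhi_pi.
subst k; have [->|nm] := eqVneq nu ka; last first.
  have [n0|n0] := eqVneq n 0%N.
    by move: an ak nm; rewrite n0 /admissible !orbF => -> ->.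
  have z : n%:R != 0 :> R by rewrite pnatr_eq0.
  apply: (mulfI z); rewrite mulr0 -IZ; last exact: cM.
  have kaE : ka = ~~ nu by move: nm; case: (nu) (ka) => -[].
  apply: (@periodic_integral0 (fun x => (if nu then - 2^-1 else 2^-1) * (Phi n nu x * Phi n nu x))).
  - by move=> x; apply: cvgM; [exact: cvg_cst|exact: cM].
  - move=> x; apply: is_derive_as (is_derive_mull _ (is_derive_mul (is_derive_Phi n nu x)
      (is_derive_Phi n nu x))) _ _ => //.
    by rewrite kaE /dPhi; case: (nu) => /=; field.
  - by rewrite !Phi_pi.
have sq : I (fun x => Phi n true x * Phi n true x) + I (fun x => Phi n false x * Phi n false x)
    = 2 * pi.
  rewrite -ID; [|exact: cM..].
  rewrite (_ : (fun x => _) = (fun=> 1 * 1)).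
    rewrite /I Rintegral_cst // mul1r [X in fine X]segment_measure ?pi_NltP //=; ring.
  by apply/funext => x; rewrite /Phi -!expr2 cos2Dsin2 expr1n.
have [n0|n0] := eqVneq n 0%N.
  have kaT : ka = true by move: ak; rewrite n0 /admissible orbF.
  rewrite kaT n0 /Phi_sqnorm /= -sq n0.
  have -> : I (fun x => Phi 0 false x * Phi 0 false x) = I (fun x => 0 * 0).
    by congr I; apply/funext => x; rewrite /Phi mul0r sin0.
  by rewrite IZ; [rewrite mul0r addr0|move=> x; exact: cvg_cst].
have df : I (fun x => Phi n true x * Phi n true x) = I (fun x => Phi n false x * Phi n false x).
  have z : n%:R != 0 :> R by rewrite pnatr_eq0.
  apply/eqP; rewrite -subr_eq0; apply/eqP; apply: (mulfI z); rewrite mulr0.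
  rewrite -mulN1r -IZ; last exact: cM.
  rewrite -ID; [|exact: cM|by move=> x; apply: cvgM; [exact: cvg_cst|exact: cM]].
  rewrite -IZ; last first.
    by move=> x; apply: cvgD; [exact: cM|apply: cvgM; [exact: cvg_cst|exact: cM]].
  apply: (@periodic_integral0 (fun x => Phi n true x * Phi n false x)).
  - move=> x; apply: cvgM; first exact: cvg_cst.
    by apply: cvgD; [exact: cM|apply: cvgM; [exact: cvg_cst|exact: cM]].
  - move=> x; apply: is_derive_as (is_derive_mul (is_derive_Phi n true x)
      (is_derive_Phi n false x)) _ _ => //.
    by rewrite /dPhi /=; ring.
  - by rewrite !Phi_pi.
rewrite /Phi_sqnorm (negbTE n0) /=.
move: sq df; case: ka {ak}; move: (I (fun x => Phi n true x * Phi n true x))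
  (I (fun x => Phi n false x * Phi n false x)) => x y; lra.
Qed.

Lemma angle_integral_tensor (f g : R -> R) : continuous f -> continuous g ->
  angle_integral (fun t p => f t * g p) = I f * I g.
Proof.
move=> cf cg; rewrite mulrC -IZ //; apply: eq_Rintegral => t _; rewrite mulrC; exact: IZ.
Qed.

Lemma PhiPhi_orthogonal n m nu mu k l ka la : admissible n nu -> admissible m mu ->
  admissible k ka -> admissible l la ->
  angle_integral (fun t p => (Phi k ka t * Phi l la p) * (Phi n nu t * Phi m mu p)) =
  if (k, l, ka, la) == (n, m, nu, mu) then Phi_sqnorm n * Phi_sqnorm m else 0 :> R.
Proof.
move=> an am ak al.
rewrite (eq_angle_integral (g2 := fun t p => (Phi k ka t * Phi n nu t) * (Phi l la p * Phi m mu p))).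
  rewrite angle_integral_tensor; [|by apply: cM; exact: continuous_Phi..].
  rewrite !Phi_orthogonal // !xpair_eqE.
  have [->|_] := eqVneq k n; last by rewrite mul0r.
  have [->|_] := eqVneq l m; last by rewrite mulr0.
  have [_|_] := eqVneq ka nu; last by rewrite mul0r.
  by have [_|_] := eqVneq la mu; rewrite ?mulr0.
by move=> t p; rewrite mulrACA.
Qed.

Lemma Phi_sqnorm_ge1 n : 1 <= Phi_sqnorm n :> R.
Proof.
have := @pi_ge2 R; rewrite /Phi_sqnorm => h; case: ifP => _; lra.
Qed.

End orthogonality.

(** * Series of bounded functions with absolutely summable coefficients *)

Section series_of_functions.
Context {R : realType}.
Variables (T : topologicalType) (c : nat -> R) (psi : nat -> T -> R) (g : T -> R) (B : R).
Hypothesis psi1 : forall k z, `|psi k z| <= 1.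
Hypothesis cB : forall N, \sum_(0 <= k < N) `|c k| <= B.
Hypothesis cg : forall z, \sum_(0 <= k < N) c k * psi k z @[N --> \oo] --> g z.

(** Weierstrass: the tail of the sum of |c k| bounds the remainder at every point. *)
Lemma uniform_series : exists r : nat -> R, (r N @[N --> \oo] --> 0) /\
  forall N z, `|g z - \sum_(0 <= k < N) c k * psi k z| <= r N.
Proof.
pose s N := \sum_(0 <= k < N) `|c k|.
have nd : nondecreasing_seq s.
  apply/nondecreasing_seqP => N; rewrite /s big_nat_recr //= lerDl //.
have cs : cvgn s.
  apply: nondecreasing_is_cvgn => //; exists B => _ [N _ <-]; exact: cB.
exists (fun N => limn s - s N); split.
  rewrite -[X in _ --> X](subrr (limn s)); apply: cvgB => //; exact: cvg_cst.
move=> N z.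
have h1 : `|\sum_(0 <= k < M) c k * psi k z - \sum_(0 <= k < N) c k * psi k z| @[M --> \oo] -->
    `|g z - \sum_(0 <= k < N) c k * psi k z|.
  by apply: cvg_norm; apply: cvgB => //; exact: cvg_cst.
apply: (ler_cvg_to h1 (cvg_cst _)).
near=> M.
have NM : (N <= M)%N by near: M; exact: nbhs_infty_ge.
rewrite (big_cat_nat (leq0n N) NM) //= addrAC subrr add0r.
apply: le_trans (ler_norm_sum _ _ _) _.
apply: (@le_trans _ _ (\sum_(N <= k < M) `|c k|)).
  by apply: ler_sum => k _; rewrite normrM ler_piMr.
have -> : \sum_(N <= k < M) `|c k| = s M - s N.
  by rewrite /s [X in _ = X - _](big_cat_nat (leq0n N) NM) //= addrAC subrr add0r.
by rewrite lerD2r; exact: nondecreasing_cvgn_le.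
Unshelve. all: by end_near. Qed.

Lemma uniform_series_continuous : (forall k, continuous (psi k)) -> continuous g.
Proof.
move=> cpsi z; have [r [r0 hr]] := uniform_series.
have cS N : continuous (fun z => \sum_(0 <= k < N) c k * psi k z).
  elim: N => [|N IH] w.
    by under eq_fun do rewrite big_geq //; exact: cvg_cst.
  under eq_fun do rewrite big_nat_recr //=.
  by apply: cvgD; [exact: IH|apply: cvgM; [exact: cvg_cst|exact: cpsi]].
apply/cvgrPdist_le => e e0.
have e3 : 0 < e / 3 by rewrite divr_gt0.
have /cvgrPdist_le /(_ _ e3) [N _ HN] := r0.
have rN : r N <= e / 3.
  by have := HN N (leqnn N); rewrite sub0r normrN => h; exact: le_trans (ler_norm _) h.
have /cvgrPdist_le /(_ _ e3) hS := cS N z.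
near=> w.
have h1 := hr N z; have h2 := hr N w.
have h3 : `|\sum_(0 <= k < N) c k * psi k z - \sum_(0 <= k < N) c k * psi k w| <= e / 3.
  by near: w.
move: h1 h2 h3; move: (\sum_(_ <= _ < _) _) (\sum_(_ <= _ < _) _) => x y.
rewrite !ler_norml; move: rN => /[swap] /andP[] ? ? /[swap] /andP[] ? ? /[swap] /andP[] ? ? ?.
apply/andP; split; lra.
Unshelve. all: by end_near. Qed.

End series_of_functions.

(** * Double trigonometric series, enumerated as simple series *)

Section double_series.
Context {R : realType}.
Notation mu2 := ((@lebesgue_measure R) \x (@lebesgue_measure R))%E.
Implicit Types (b : nat -> nat -> bool -> bool -> R) (x : Defs.index -> R) (k N : nat).

Let I4 : countType := (nat * nat * bool * bool)%type.

Definition index_adm (i : Defs.index) : bool :=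
  let '(n, m, nu, mu) := i in admissible n nu && admissible m mu.

(* [index_at k] is the index with code k when [index_ok k], and junk otherwise. *)
Definition index_ok k : bool :=
  if (pickle_inv k : option I4) is Some i then index_adm i else false.

Definition index_at k : Defs.index := odflt (0%N, 0%N, true, true) (pickle_inv k : option I4).

Definition index_code (i : Defs.index) : nat := pickle (i : I4).

Lemma index_codeK i : index_at (index_code i) = i.
Proof. by rewrite /index_at /index_code pickleK_inv. Qed.

Lemma index_code_ok i : index_ok (index_code i) = index_adm i.
Proof. by rewrite /index_ok /index_code pickleK_inv. Qed.

Lemma index_atK k : index_ok k -> index_code (index_at k) = k.
Proof.
rewrite /index_ok /index_at /index_code; have := @pickle_invK I4 k.
by case: pickle_inv => //= i.
Qed.

Lemma index_at_adm k : index_ok k -> index_adm (index_at k).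
Proof. by move=> h; rewrite -index_code_ok index_atK. Qed.

Lemma index_at_image : index_at @` [set` index_ok] = indices.
Proof.
apply/seteqP; split => [_ [k hk <-]|i hi].
  by have := index_at_adm hk; rewrite /index_adm /indices /=; case: index_at => [[[]]].
exists (index_code i); last exact: index_codeK.
by rewrite /= /in_mem /= index_code_ok; move: hi; rewrite /index_adm /indices /=; case: i => [[[]]].
Qed.

Lemma index_at_inj : set_inj [set` index_ok] index_at.
Proof.
move=> j k; rewrite !inE => hj hk e.
by rewrite -(index_atK hj) -(index_atK hk) e.
Qed.

Definition at_index x k : R := if index_ok k then x (index_at k) else 0.

Lemma esum_indices x : (forall i, 0 <= x i) ->
  (\esum_(i in indices) (x i)%:E = \sum_(k <oo) (at_index x k)%:E)%E.
Proof.
move=> x0; rewrite -index_at_image esum_pred_image; last exact: index_at_inj.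
  by rewrite eseries_mkcond; apply: eq_eseriesr => k _; rewrite /at_index;
    rewrite (_ : (k \in index_ok) = index_ok k) //; case: ifP.
by move=> k _; rewrite lee_fin.
Qed.

Lemma at_index_ge0 x k : (forall i, 0 <= x i) -> 0 <= at_index x k.
Proof. by move=> x0; rewrite /at_index; case: ifP. Qed.

Lemma partial_le_esum x N : (forall i, 0 <= x i) ->
  ((\sum_(0 <= k < N) at_index x k)%:E <= \esum_(i in indices) (x i)%:E)%E.
Proof.
move=> x0; rewrite esum_indices // -sumEFin; apply: nneseries_lim_ge => k _.
by rewrite lee_fin at_index_ge0.
Qed.

Lemma esum_indices_cvg x : (forall i, 0 <= x i) ->
  (\esum_(i in indices) (x i)%:E < +oo)%E ->
  \sum_(0 <= k < N) at_index x k @[N --> \oo] --> fine (\esum_(i in indices) (x i)%:E).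
Proof.
move=> x0 xoo.
have fin : (\esum_(i in indices) (x i)%:E)%E \is a fin_num.
  by rewrite ge0_fin_numE //; apply: esum_ge0 => i _; rewrite lee_fin.
have : (\sum_(0 <= k < N) (at_index x k)%:E)%E @[N --> \oo] -->
    (fine (\esum_(i in indices) (x i)%:E))%:E.
  rewrite fineK // esum_indices //; apply: is_cvg_nneseries => k _ _.
  by rewrite lee_fin at_index_ge0.
move=> /fine_cvg; apply: cvg_trans; apply: near_eq_cvg.
by near=> N; rewrite /= sumEFin.
Unshelve. all: by end_near. Qed.

Lemma summable_abs_lt x : summable indices (fun i => (x i)%:E) ->
  (\esum_(i in indices) (`|x i|)%:E < +oo)%E.
Proof. by rewrite /summable. Qed.

Definition index_fun (i : Defs.index) (z : R * R) : R :=
  let '(n, m, nu, mu) := i in Phi n nu z.1 * Phi m mu z.2.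

Definition index_coef b (i : Defs.index) : R := let '(n, m, nu, mu) := i in b n m nu mu.

Lemma trig_termE b z i : trig_term b z.1 z.2 i = index_coef b i * index_fun i z.
Proof. by case: i => [[[n m] nu] mu]; rewrite /trig_term /= mulrA. Qed.

Lemma index_fun_le1 i z : `|index_fun i z| <= 1.
Proof. by case: i => [[[n m] nu] mu]; rewrite /index_fun normrM mulr_ile1 // Phi_le1. Qed.

Lemma index_fun_continuous2 i : continuous2 (fun t p => index_fun i (t, p)).
Proof. by case: i => [[[n m] nu] mu]; exact: (@continuous2_PhiPhi R n m nu mu). Qed.

Lemma index_fun_continuous i : continuous (index_fun i).
Proof.
move=> z; have := @index_fun_continuous2 i z.
by case: i => [[[n m] nu] mu].
Qed.

Lemma partial_trig b z N : \sum_(0 <= k < N) at_index (trig_term b z.1 z.2) k =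
  \sum_(0 <= k < N) at_index (index_coef b) k * index_fun (index_at k) z.
Proof.
apply: eq_bigr => k _; rewrite /at_index; case: ifP => _; last by rewrite mul0r.
exact: trig_termE.
Qed.

Variable b : nat -> nat -> bool -> bool -> R.
Hypothesis hb : abs_convergent b.

(** The positive and negative parts are enumerated by the same codes, so their partial sums
    recombine term by term. *)
Lemma trig_sum_cvg z :
  \sum_(0 <= k < N) at_index (index_coef b) k * index_fun (index_at k) z @[N --> \oo] -->
  trig_sum b z.1 z.2.
Proof.
have xoo := summable_abs_lt (hb z.1 z.2).
have pos (x : Defs.index -> R) : (forall i, 0 <= x i) -> (forall i, x i <= `|trig_term b z.1 z.2 i|) ->
    (\esum_(i in indices) (x i)%:E < +oo)%E.
  move=> x0 xl; apply: le_lt_trans xoo; apply: le_esum => i _; by rewrite lee_fin.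
have h1 := esum_indices_cvg (x := fun i => Num.max (trig_term b z.1 z.2 i) 0)
  (fun i => _) (pos _ _ _).
have h2 := esum_indices_cvg (x := fun i => Num.max (- trig_term b z.1 z.2 i) 0)
  (fun i => _) (pos _ _ _).
have m0 (y : R) : 0 <= Num.max y 0 by rewrite le_max lexx orbT.
have ml (y : R) : Num.max y 0 <= `|y| by rewrite ge_max ler_norm /=.
have ml' (y : R) : Num.max (- y) 0 <= `|y| by rewrite ge_max normr_ge0 andbT -normrN ler_norm.
rewrite (_ : (fun N => _) = (fun N =>
    \sum_(0 <= k < N) at_index (fun i => Num.max (trig_term b z.1 z.2 i) 0) k
    - \sum_(0 <= k < N) at_index (fun i => Num.max (- trig_term b z.1 z.2 i) 0) k)).
  exact: cvgB (h1 (fun i => m0 _) (fun i => m0 _) (fun i => ml _))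
    (h2 (fun i => m0 _) (fun i => m0 _) (fun i => ml' _)).
apply/funext => N.
rewrite -partial_trig /= -sumrB; apply: eq_bigr => k _.
rewrite /at_index; case: ifP => _; last by rewrite subrr.
move: (trig_term _ _ _ _) => y; case: (lerP 0 y) => hy.
  by rewrite max_r ?subr0 // oppr_le0.
by rewrite max_l ?sub0r ?opprK // oppr_ge0 ltW.
Qed.

(** [denjoy_luzin] with c = 1: each basis function is bounded by 1, so the integral of its absolute
    value is at least that of its square, a product of two squared norms that are both at least
    1. *)
Lemma coef_bounded : exists B, forall N, \sum_(0 <= k < N) `|at_index (index_coef b) k| <= B.
Proof.
apply: (@denjoy_luzin _ _ R mu2 square ((2 * pi) ^+ 2) 1 (fun k => index_fun (index_at k))).
- exact: measurable_square.
- exact: square_measure.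
- by [].
- by move=> k; apply: measurable_funTS; apply: continuous_measurable_prod; exact: index_fun_continuous.
- by move=> k y _; exact: index_fun_le1.
- move=> k ck.
  have ok : index_ok k by move: ck; rewrite /at_index; case: ifP => //; rewrite eqxx.
  have := index_at_adm ok; case: (index_at k) (@index_fun_continuous (index_at k)) (@index_fun_le1 (index_at k)) => [[[n m] nu] mu].
  move=> cf f1 /andP[an am].
  have sq := PhiPhi_orthogonal an am an am; rewrite eqxx in sq.
  apply: (@le_trans _ _ (Phi_sqnorm n * Phi_sqnorm m)).
    by rewrite -[leLHS]mulr1; apply: ler_pM => //; exact: Phi_sqnorm_ge1.
  rewrite -sq angle_integralE; last first.
    by apply: continuous2M; exact: (@continuous2_PhiPhi R n m nu mu).
  have cabs : continuous (fun z => `|index_fun (n, m, nu, mu) z|).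
    by move=> z; apply: (@continuous_comp _ _ _ (index_fun (n, m, nu, mu)) (@Num.norm R R^o));
      [exact: cf|exact: norm_continuous].
  apply: le_Rintegral.
  + exact: measurable_square.
  + by apply: (@square_integrable R (fun z => index_fun (n, m, nu, mu) z * index_fun (n, m, nu, mu) z));
      move=> z; apply: cvgM; exact: cf.
  + exact: (square_integrable cabs).
  + move=> z _; rewrite -/(index_fun (n, m, nu, mu) z).
    apply: le_trans (ler_norm _) _; rewrite normrM ler_piMr //.
- move=> z _; have xoo := summable_abs_lt (hb z.1 z.2).
  exists (fine (\esum_(i in indices) (`|trig_term b z.1 z.2 i|)%:E)) => N.
  have E : \sum_(0 <= k < N) `|at_index (index_coef b) k * index_fun (index_at k) z| =
    \sum_(0 <= k < N) at_index (fun i => `|trig_term b z.1 z.2 i|) k.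
    apply: eq_bigr => k _; rewrite /at_index; case: ifP => _; last by rewrite mul0r normr0.
    by rewrite trig_termE.
  rewrite E -lee_fin fineK; first exact: partial_le_esum.
  by rewrite ge0_fin_numE //; apply: esum_ge0 => i _; rewrite lee_fin.
Qed.

(** One mode occupies distinct codes scattered in the enumeration; a finite part of it is contained
    in a long enough initial segment. *)
Lemma mode_coef_bounded m nu mu : admissible m mu -> exists B, forall N,
  \sum_(first_index nu <= n < N) `|b n m nu mu| <= B.
Proof.
move=> am; have [B HB] := coef_bounded.
have H (s : seq nat) : uniq s -> \sum_(k <- s) `|at_index (index_coef b) k| <= B.
  move=> us; pose N := (\max_(k <- s) k).+1.
  have sub : {subset s <= index_iota 0 N}.
    by move=> k ks; rewrite mem_index_iota /= ltnS; exact: leq_bigmax_seq.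
  apply: le_trans (HB N).
  rewrite [leRHS](bigID (fun k => k \in s)) /= -[leLHS]addr0; apply: lerD.
    rewrite -[leRHS]big_filter le_eqVlt; apply/orP; left; apply/eqP; apply: perm_big.
    apply: uniq_perm => //; first by rewrite filter_uniq // iota_uniq.
    move=> k; rewrite mem_filter; case ks: (k \in s) => //=; exact/esym/sub.
  by apply: sumr_ge0.
exists B => N.
pose s := [seq index_code (n, m, nu, mu) | n <- index_iota (first_index nu) N].
have us : uniq s.
  rewrite map_inj_uniq ?iota_uniq // => n1 n2 /(congr1 index_at).
  by rewrite !index_codeK => -[].
apply: le_trans (H s us); rewrite big_map le_eqVlt; apply/orP; left; apply/eqP.
apply: eq_big_nat => n /andP[hn _].
rewrite /at_index index_code_ok index_codeK /index_adm am andbT /=.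
by rewrite (_ : admissible n nu) // /admissible; move: hn; case: (nu).
Qed.

Lemma trig_sum_continuous : continuous (fun z : R * R => trig_sum b z.1 z.2).
Proof.
have [B HB] := coef_bounded.
apply: (uniform_series_continuous (psi := fun k => index_fun (index_at k)) _ HB).
- by move=> k z; exact: index_fun_le1.
- exact: trig_sum_cvg.
- by move=> k; exact: index_fun_continuous.
Qed.

(** By orthogonality the integral of a partial sum is exact as soon as the code of the index has
    been passed; uniform convergence leaves an error below any e. *)
Lemma trig_sum_fourier n m nu mu : admissible n nu -> admissible m mu ->
  angle_integral (fun t p => trig_sum b t p * (Phi n nu t * Phi m mu p)) =
  Phi_sqnorm n * Phi_sqnorm m * b n m nu mu.
Proof.
move=> an am; have [B HB] := coef_bounded.
have cPP := @continuous2_PhiPhi R n m nu mu.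
have cts : continuous2 (trig_sum b) by exact: trig_sum_continuous.
have [r [r0 hr]] := uniform_series (psi := fun k => index_fun (index_at k))
  (fun k z => index_fun_le1 _ z) HB trig_sum_cvg.
pose S N t p := \sum_(0 <= k < N) at_index (index_coef b) k * index_fun (index_at k) (t, p).
pose k0 := index_code (n, m, nu, mu).
pose L := Phi_sqnorm n * Phi_sqnorm m * b n m nu mu.
have ok0 : index_ok k0 by rewrite index_code_ok /= an am.
have hS N : continuous2 (S N) /\ angle_integral (fun t p => S N t p * (Phi n nu t * Phi m mu p)) =
    if (k0 < N)%N then L else 0.
  elim: N => [|N [IH1 IH2]].
    have E : S 0%N = fun _ _ => 0.
      by apply/funext => t; apply/funext => p; rewrite /S big_geq.
    rewrite E; split; first exact: continuous2_cst.
    by rewrite angle_integralZ // mul0r.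
  have E : S N.+1 = fun t p => S N t p + at_index (index_coef b) N * index_fun (index_at N) (t, p).
    by apply/funext => t; apply/funext => p; rewrite /S big_nat_recr.
  have cF := @index_fun_continuous2 (index_at N).
  have cT : continuous2 (fun t p => at_index (index_coef b) N * index_fun (index_at N) (t, p)).
    by apply: continuous2M => //; exact: continuous2_cst.
  rewrite E; split; first exact: continuous2D.
  rewrite (eq_angle_integral (g2 := fun t p => S N t p * (Phi n nu t * Phi m mu p) +
     at_index (index_coef b) N * (index_fun (index_at N) (t, p) * (Phi n nu t * Phi m mu p)))); last first.
    by move=> t p; rewrite mulrDl -mulrA.
  rewrite angle_integralD; last 2 first.
  - exact: continuous2M.
  - by apply: continuous2M; [exact: continuous2_cst|exact: continuous2M].
  rewrite angle_integralZ; last exact: continuous2M.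
  rewrite IH2 ltnS [in RHS]leq_eqVlt.
  have [e|ne] := eqVneq k0 N.
    rewrite -e ltnn add0r /= /at_index ok0 /k0 index_codeK /=.
    by rewrite PhiPhi_orthogonal // eqxx mulrC.
  rewrite /= -[RHS]addr0; congr (_ + _).
  rewrite /at_index; case: ifP => okN; last by rewrite mul0r.
  have := index_atK okN; have := index_at_adm okN.
  case: (index_at N) => [[[n' m'] nu'] mu'] /andP[an' am'] eN.
  rewrite /index_fun PhiPhi_orthogonal // ifN ?mulr0 //.
  by apply: contra_neq ne => e; rewrite /k0 -eN e.
apply/eqP; rewrite -subr_eq0 -normr_le0; apply/ler_addgt0Pl => e e0; rewrite addr0.
have D0 : 0 < e / (2 * pi) ^+ 2.
  by rewrite divr_gt0 // exprn_gt0 // mulr_gt0 // pi_gt0.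
have /cvgrPdist_le /(_ _ D0) [N1 _ HN1] := r0.
pose N := maxn N1 k0.+1.
have rN : r N <= e / (2 * pi) ^+ 2.
  have := HN1 N (leq_maxl _ _); rewrite sub0r normrN => h; exact: le_trans (ler_norm _) h.
have [cS IS] := hS N; rewrite (_ : (k0 < N)%N) in IS; last by rewrite leq_maxr.
rewrite -/L -IS -mulN1r -angle_integralZ; last exact: continuous2M.
rewrite -angle_integralD; last 2 first.
- exact: continuous2M.
- by apply: continuous2M; [exact: continuous2_cst|exact: continuous2M].
apply: le_trans (angle_integral_le (C := e / (2 * pi) ^+ 2) _ _) _.
- apply: continuous2D; first exact: continuous2M.
  by apply: continuous2M; [exact: continuous2_cst|exact: continuous2M].
- move=> t p _; rewrite mulN1r -mulrBl normrM.
  apply: le_trans (le_trans (hr N (t, p)) rN); rewrite ler_piMr //.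
  exact: PhiPhi_le1.
- by rewrite divfK // expf_neq0 // mulf_neq0 ?pnatr_eq0 // gt_eqF // pi_gt0.
Qed.

End double_series.

(** * The algebraic Neumann problem *)

Section coefficients.
Context {R : realType}.
Variable eta0 : R.
Hypothesis heta0 : 0 < eta0.
Implicit Types (n m N : nat) (nu mu : bool).

Lemma torL_pos n m : 0 < torL n m eta0.
Proof.
case: m => [|m]; first exact: torL_gt0.
by apply: lt_trans (torL_lt n heta0 (ltn0Sn m)); exact: torL_gt0.
Qed.

Lemma torL_formula n m : torL n m eta0 = (sinh eta0)^-1 * ((n%:R + 2^-1) * cosh eta0
  - (n%:R - m%:R + 2^-1) * (qv eta0 n.+1 m / qv eta0 n m)).
Proof.
have Q0 := torQ_neq0 n m heta0; have s0 : sinh eta0 != 0 by rewrite gt_eqF // sinh_gt0.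
have E k : qv eta0 k m = torQ k m eta0 by rewrite torQ.unlock.
rewrite /torL /dtorQ !E; move: (torQ _ _ _) Q0 (torQ _ _ _) (sinh _) s0 (cosh _).
by move=> q q0 q' s s0 c; field; rewrite q0 s0.
Qed.

Lemma sigmaE n m : sigma eta0 n m = sinh eta0 / 2 - cosh eta0 * torL n m eta0.
Proof.
have s0 : sinh eta0 != 0 by rewrite gt_eqF // sinh_gt0.
rewrite /sigma torL_formula; have cs : sinh eta0 ^+ 2 = cosh eta0 ^+ 2 - 1.
  by rewrite -(cosh2B eta0) opprB addrC subrK.
move: (qv _ _ _ / qv _ _ _) (sinh eta0) (cosh eta0) s0 cs => r s c s0 cs.
by field: cs.
Qed.

Lemma tauE n m : tau eta0 n m = torL n.+1 m eta0 / 2.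
Proof.
have s0 : sinh eta0 != 0 by rewrite gt_eqF // sinh_gt0.
rewrite /tau torL_formula -natr1.
by move: (qv _ _ _ / qv _ _ _) (sinh eta0) (cosh eta0) s0 => r s c s0; field.
Qed.

Lemma rhoE n m : rho eta0 n.+1 m = neumann_weight R n * torL n m eta0 / 2.
Proof.
have s0 : sinh eta0 != 0 by rewrite gt_eqF // sinh_gt0.
case: n => [|n]; rewrite /rho /neumann_weight torL_formula /= -?natr1.
  by move: (qv _ _ _ / qv _ _ _) (sinh eta0) (cosh eta0) s0 => r s c s0; field.
by move: (qv _ _ _ / qv _ _ _) (sinh eta0) (cosh eta0) s0 => r s c s0; field.
Qed.

Lemma algebraic_three_term m nu (b a : nat -> R) : algebraic_solution eta0 m nu b a <->
  three_term (cosh eta0) (sinh eta0) (fun n => torL n m eta0) (first_index nu) b a.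
Proof.
have E1 n : sigma eta0 n m * a n + tau eta0 n m * a n.+1 = sinh eta0 / 2 * a n
    - cosh eta0 * (torL n m eta0 * a n) + torL n.+1 m eta0 * a n.+1 / 2.
  by rewrite sigmaE tauE; move: (sinh _) (cosh _) (torL _ _ _) (torL _ _ _) => *; ring.
have E2 n : rho eta0 n.+1 m * a n + sigma eta0 n.+1 m * a n.+1 + tau eta0 n.+1 m * a n.+2 =
    sinh eta0 / 2 * a n.+1 - cosh eta0 * (torL n.+1 m eta0 * a n.+1)
    + (neumann_weight R n * (torL n m eta0 * a n) + torL n.+2 m eta0 * a n.+2) / 2.
  rewrite rhoE sigmaE tauE; move: (sinh _) (cosh _) (torL _ _ _) (torL _ _ _) (torL _ _ _) => *.
  ring.
split=> -[h1 h2]; split.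
- by rewrite h1 E1.
- by move=> [|n] hn //; rewrite (h2 _ hn) E2.
- by rewrite h1 E1.
- by move=> [|n] hn //; rewrite (h2 _ hn) E2.
Qed.

(* The coefficients, up to a factor, of 1 / sqrt (cosh eta0 - cos t) as a cosine series:
   the kernel of the system for m = 0, which is the freedom of a constant in f. *)
Definition null_solution n : R := if n is 0%N then torQ 0 0 eta0 else 2 * torQ n 0 eta0.

Lemma torQ0_pos n : 0 < torQ n 0 eta0.
Proof. by have := torQ_sign n 0 heta0; rewrite expr0 mul1r. Qed.

Lemma null_solution_pos n : 0 < null_solution n.
Proof. by case: n => [|n] /=; [|apply: mulr_gt0 => //]; exact: torQ0_pos. Qed.

(** The raising and the lowering relation give two expressions of the derivative at degree n + 1. *)
Lemma torQ0_recurrence n :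
  (n%:R + 3 / 2) * torQ n.+2 0 eta0 =
  2 * n.+1%:R * cosh eta0 * torQ n.+1 0 eta0 - (n%:R + 2^-1) * torQ n 0 eta0.
Proof.
have := dtorQ_succ n 0 heta0; have s0 : sinh eta0 != 0 by rewrite gt_eqF // sinh_gt0.
rewrite /dtorQ mulrC divfK // -natr1 => h; apply/eqP; rewrite -subr_eq0; apply/eqP.
move: h; rewrite subr0 addr0.
move: (torQ _ _ _) (torQ _ _ _) (torQ _ _ _) (cosh _) => x y z c h.
transitivity ((n%:R + 1 + 2^-1) * z - (n%:R + 1 + 2^-1) * c * y -
  ((n%:R + 2^-1) * c * y - (n%:R + 2^-1) * x)).
  by field.
by rewrite h subrr.
Qed.

Lemma null_solution_three_term :
  three_term (cosh eta0) (sinh eta0) (fun n => torL n 0 eta0) 0 (fun=> 0) null_solution.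
Proof.
have s0 : sinh eta0 != 0 by rewrite gt_eqF // sinh_gt0.
have cs : cosh eta0 ^+ 2 = 1 + sinh eta0 ^+ 2 by rewrite -(cosh2B eta0) subrK.
have LQ n : torL n 0 eta0 * torQ n 0 eta0 = - dtorQ n 0 eta0.
  by rewrite /torL mulNr divfK // torQ_neq0.
have up n : dtorQ n.+1 0 eta0 = cosh eta0 * dtorQ n 0 eta0 + (n%:R + 2^-1) * sinh eta0 * torQ n 0 eta0.
  apply: (mulfI s0); rewrite dtorQ_succ // /dtorQ.
  move: (torQ _ _ _) (torQ _ _ _) (sinh _) (cosh _) s0 cs => x y s c s0 cs.
  by field: cs.
have down n : dtorQ n 0 eta0 = cosh eta0 * dtorQ n.+1 0 eta0 - (n%:R + 2^-1) * sinh eta0 * torQ n.+1 0 eta0.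
  have h := dtorQ_succ n 0 heta0.
  have h' : dtorQ n.+1 0 eta0 = ((n%:R + 2^-1) * cosh eta0 * torQ n.+1 0 eta0
      - (n%:R + 0%:R + 2^-1) * torQ n 0 eta0) / sinh eta0 by rewrite -h mulrC mulKf.
  rewrite h' /dtorQ; move: (torQ _ _ _) (torQ _ _ _) (sinh _) (cosh _) s0 cs => x y s c s0 cs.
  by field: cs.
have L2 n : torL n 0 eta0 * (2 * torQ n 0 eta0) = - 2 * dtorQ n 0 eta0.
  by rewrite mulrCA LQ mulrN mulNr.
split=> /=.
  rewrite L2 LQ up add0r.
  by move: (torQ _ _ _) (dtorQ _ _ _) (sinh _) (cosh _) => *; field.
move=> [|n] // _ /=; rewrite !L2.
(* The weight 2 at n = 0 makes up for the factor 2 missing in [null_solution] there. *)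
have -> : neumann_weight R n * (torL n 0 eta0 * null_solution n) = - 2 * dtorQ n 0 eta0.
  by case: n => [|n] /=; rewrite ?L2 ?LQ; ring.
rewrite (up n.+1) (down n) -natr1.
move: (torQ _ _ _) (dtorQ _ _ _) (sinh _) (cosh _) => *; by field.
Qed.

Lemma geometric_cubic (k : R) : 0 < k < 1 -> exists K, forall n, n.+1%:R ^+ 3 * k ^+ n <= K.
Proof.
move=> /andP[k0 k1]; pose d := - ln k.
have d0 : 0 < d by rewrite oppr_gt0 ln_lt0 // k0.
have kE : k = expR (- d) by rewrite opprK lnK // posrE.
exists (expR d * 6 / d ^+ 3) => n.
rewrite ler_pdivlMr ?exprn_gt0 // kE -expRM_natl mulrAC -exprMn.
have x0 : 0 <= n.+1%:R * d by rewrite mulr_ge0 // ltW.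
have := expR_ge1Dxn 2 x0.
have e0 : 0 < expR (n.+1%:R * d) by exact: expR_gt0.
rewrite (_ : (3`!)%:R = 6) // => h.
have h' : (n.+1%:R * d) ^+ 3 <= 6 * expR (n.+1%:R * d).
  by move: h; move: ((n.+1%:R * d) ^+ 3) => y; lra.
apply: le_trans (ler_wpM2r (expR_ge0 _) h') _.
rewrite le_eqVlt; apply/orP; left; apply/eqP.
rewrite -mulrA -expRD mulrC; congr (expR _ * _).
by rewrite -natr1; ring.
Qed.

Lemma torQ0_decay : exists K, forall n, n.+1%:R ^+ 3 * torQ n 0 eta0 <= K.
Proof.
have c1 := cosh_gt1 heta0; pose k := 2 / (cosh eta0 + 1).
have k01 : 0 < k < 1.
  by rewrite /k ltr_pdivrMr ?divr_gt0 //; move: c1; move: (cosh eta0) => c; lra.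
have [K HK] := geometric_cubic k01.
exists (K * torQ 0 0 eta0) => n.
have q0 := torQ0_pos 0.
have geo : torQ n 0 eta0 <= k ^+ n * torQ 0 0 eta0.
  elim: n => [|n IH]; first by rewrite expr0 mul1r.
  apply: le_trans (torQ0_contract n heta0) _.
  by rewrite -/k exprS -[leRHS]mulrA ler_wpM2l // ltW //; case/andP: k01.
apply: le_trans (ler_wpM2l _ geo) _; first by rewrite exprn_ge0.
by rewrite mulrA ler_wpM2r // ltW.
Qed.

(** Supplies the bound [K] of [homogeneous_growth]: two factors of linear growth against the
    geometric decay of Q. *)
Lemma null_solution_decay m : exists K, forall n,
  torL n.+1 m eta0 * (torL n 0 eta0 * null_solution n) <= K.
Proof.
have [K HK] := torQ0_decay; have c1 := cosh_gt1 heta0.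
have s0 := sinh_gt0 heta0.
pose r := sinh eta0 / (cosh eta0 - 1).
have r0 : 0 < r by rewrite divr_gt0 // subr_gt0.
pose M := (m%:R + 2) * r.
have M0 : 0 <= M by rewrite mulr_ge0 ?(ltW r0) // addr_ge0.
have L n j : (j <= m)%N -> torL n j eta0 <= M * n.+1%:R.
  move=> jm; apply: le_trans (torL_le n j heta0) _.
  rewrite -/r /M mulrAC ler_wpM2r ?(ltW r0) //.
  have : (j%:R : R) <= m%:R by rewrite ler_nat.
  have n0 : (0 : R) <= n%:R by []. have m0 : (0 : R) <= m%:R by [].
  have nm : (0 : R) <= m%:R * n%:R by rewrite mulr_ge0.
  rewrite -(natr1 n) (_ : (m%:R + 2) * (n%:R + 1) = m%:R * n%:R + m%:R + 2 * n%:R + 2 :> R); last by ring.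
  by move: nm; move: (m%:R * n%:R) => nm; lra.
exists (M * 2 * M * 2 * K) => n.
have N1 : 1 <= n.+1%:R :> R by rewrite ler1n.
have Eb : null_solution n <= 2 * torQ n 0 eta0.
  by case: n {N1} => [|n] //=; rewrite ler_peMl // ?ler1n // ltW // torQ0_pos.
have L1 : torL n.+1 m eta0 <= M * 2 * n.+1%:R.
  apply: le_trans (L n.+1 m (leqnn m)) _; rewrite -mulrA ler_wpM2l //.
  by rewrite -natr1; lra.
have L0 := L n 0%N (leq0n m).
apply: le_trans (ler_pM _ _ L1 (ler_pM _ _ L0 Eb)) _.
- exact: ltW (torL_pos _ _).
- by apply: mulr_ge0; apply: ltW; [exact: torL_pos|exact: null_solution_pos].
- exact: ltW (torL_pos _ _).
- exact: ltW (null_solution_pos _).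
rewrite -[leRHS]mulrA -[leRHS]mulrA.
have -> : M * 2 * n.+1%:R * (M * n.+1%:R * (2 * torQ n 0 eta0)) =
  M * 2 * (M * (2 * (n.+1%:R ^+ 2 * torQ n 0 eta0))) by ring.
apply: ler_wpM2l; first exact: mulr_ge0.
apply: ler_wpM2l => //; apply: ler_wpM2l => //.
apply: le_trans (HK n); rewrite exprS -[leRHS]mulrA ler_peMl //.
by rewrite mulr_ge0 ?exprn_ge0 // ltW // torQ0_pos.
Qed.

Lemma three_term_coef_summable m nu (b a : nat -> R) (M B : R) :
  (forall n, `|a n| <= M) ->
  three_term (cosh eta0) (sinh eta0) (fun n => torL n m eta0) (first_index nu) b a ->
  (forall N, \sum_(first_index nu <= n < N) `|b n| <= B) ->
  exists K, forall N, \sum_(first_index nu <= n < N) `|a n| <= K.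
Proof.
move=> aM h bB; have c1 := cosh_gt1 heta0; have s0 := sinh_gt0 heta0.
pose c := sinh eta0 / (cosh eta0 + 1).
have c0 : 0 < c by rewrite divr_gt0 // addr_gt0 // (lt_trans _ c1).
pose r := sinh eta0 / (cosh eta0 - 1).
have r0 : 0 < r by rewrite divr_gt0 // subr_gt0.
pose M1 := `|M| + m%:R * (cosh eta0 / sinh eta0).
have M10 : 0 <= m%:R * (cosh eta0 / sinh eta0).
  by apply: mulr_ge0 => //; apply: divr_ge0; [exact: ltW (cosh_gt0 _)|exact: ltW].
apply: (@three_term_summable R (cosh eta0) (sinh eta0) (fun n => torL n m eta0) b a (first_index nu)
  ((m%:R + 1) * r) c M1 B) => //.
- by move=> n; exact: torL_pos.
- move=> n; apply: le_trans (torL_le n m heta0) _; rewrite -/r mulrAC ler_wpM2r ?(ltW r0) //.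
  have n0 : (0 : R) <= n%:R by []. have m0 : (0 : R) <= m%:R by [].
  have nm : (0 : R) <= m%:R * n%:R by rewrite mulr_ge0.
  rewrite -(natr1 n) (_ : (m%:R + 1) * (n%:R + 1) = m%:R * n%:R + m%:R + n%:R + 1 :> R); last by ring.
  by move: nm; move: (m%:R * n%:R) => nm; lra.
- move=> n; apply: le_trans _ (torL_ge n m heta0); rewrite -/c /M1.
  have := normr_ge0 M; have m0 : (0 : R) <= m%:R by [].
  have mc := mulr_ge0 m0 (ltW c0).
  rewrite (_ : (n%:R + m%:R + 2^-1) * c = c * n%:R + m%:R * c + c / 2); last by field.
  by move: (m%:R * c) (m%:R * _) (`|M|) (c * n%:R) mc c0 => x y z w; lra.
- move=> n; apply: le_trans (aM n) _; apply: le_trans (ler_norm M) _.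
  by rewrite /M1 lerDl.
Qed.

End coefficients.

(** * Convergence of the series of a single mode *)

Section mode_series.
Context {R : realType}.
Variable eta0 : R.
Hypothesis heta0 : 0 < eta0.
Implicit Types (n m N : nat) (nu mu : bool) (a : nat -> R) (t p : R).

Lemma mode_termE m nu mu a t p n : mode_term eta0 m nu mu a t p n =
  Num.sqrt (den eta0 t) * Phi m mu p * (a n * Phi n nu t).
Proof.
rewrite /mode_term /toroidal_harmonic -/(den eta0 t).
have q0 : legendreQ (n%:R - 2^-1) m (cosh eta0) != 0.
  by have := torQ_neq0 n m heta0; rewrite torQ.unlock.
by rewrite divff // mulr1; ring.
Qed.

Lemma sum_from (F : nat -> R) n0 N :
  \sum_(n0 <= n < N) F n = series (fun n => if (n0 <= n)%N then F n else 0) N.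
Proof. by rewrite /series /= (big_nat_widenl _ 0%N) // big_mkcond. Qed.

Definition coef_summable nu a : Prop :=
  exists K, forall N, \sum_(first_index nu <= n < N) `|a n| <= K.

Lemma mode_abs_cvg m nu mu a t p : coef_summable nu a ->
  cvgn (mode_abs_series eta0 m nu mu a t p) /\ cvgn (mode_series eta0 m nu mu a t p).
Proof.
move=> [K HK].
have abs : cvgn (mode_abs_series eta0 m nu mu a t p).
  apply: nondecreasing_is_cvgn.
    apply/nondecreasing_seqP => N; rewrite /mode_abs_series !sum_from seriesSr lerDl.
    by case: ifP.
  exists (`|Num.sqrt (den eta0 t) * Phi m mu p| * K) => _ [N _ <-].
  apply: le_trans (ler_wpM2l (normr_ge0 _) (HK N)).
  rewrite /mode_abs_series mulr_sumr; apply: ler_sum => n _.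
  by rewrite mode_termE normrM ler_wpM2l // normrM ler_piMr // Phi_le1.
split=> //.
have -> : mode_series eta0 m nu mu a t p =
    series (fun n => if (first_index nu <= n)%N then mode_term eta0 m nu mu a t p n else 0).
  by apply/funext => N; rewrite /mode_series sum_from.
apply: normed_cvg; rewrite /normed_series_of /=.
have E : mode_abs_series eta0 m nu mu a t p =
    series (fun n => if (first_index nu <= n)%N then `|mode_term eta0 m nu mu a t p n| else 0).
  by apply/funext => N; rewrite /mode_abs_series sum_from.
rewrite E in abs; rewrite (_ : (fun n => `| _ |) = (fun n => if (first_index nu <= n)%N
  then `|mode_term eta0 m nu mu a t p n| else 0)) //.
by apply/funext => n; case: ifP => _; rewrite ?normr0.
Qed.

Lemma mode_term_cvg0 m nu mu a t p : cvgn (mode_series eta0 m nu mu a t p) ->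
  mode_term eta0 m nu mu a t p n @[n --> \oo] --> 0.
Proof.
have -> : mode_series eta0 m nu mu a t p =
    series (fun n => if (first_index nu <= n)%N then mode_term eta0 m nu mu a t p n else 0).
  by apply/funext => N; rewrite /mode_series sum_from.
move=> /cvg_series_cvg_0; apply: cvg_trans; apply: near_eq_cvg.
near=> n; rewrite ifT //; near: n; exact: nbhs_infty_ge.
Unshelve. all: by end_near. Qed.

Lemma eq_mode_series m nu mu a a' t p : (forall n, (first_index nu <= n)%N -> a n = a' n) ->
  mode_series eta0 m nu mu a t p = mode_series eta0 m nu mu a' t p.
Proof.
move=> e; apply/funext => N; apply: eq_big_nat => n /andP[hn _].
by rewrite /mode_term e.
Qed.

Lemma mode_series_lin m nu mu a a' d t p : mode_series eta0 m nu mu (fun n => a n + d * a' n) t p =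
  (fun N => mode_series eta0 m nu mu a t p N + d * mode_series eta0 m nu mu a' t p N).
Proof.
apply/funext => N; rewrite /mode_series mulr_sumr -big_split /=; apply: eq_bigr => n _.
by rewrite /mode_term mulrDl mulrA.
Qed.

(* The three-term recurrence makes the derivative of the partial sums telescope. *)
Lemma null_partial_derivative t N :
  sin t / 2 * (\sum_(0 <= n < N.+1) null_solution eta0 n * cos (n%:R * t)) +
  den eta0 t * (\sum_(0 <= n < N.+1) null_solution eta0 n * (- n%:R * sin (n%:R * t))) =
  (N%:R + 2^-1) * (torQ N 0 eta0 * sin (N.+1%:R * t) - torQ N.+1 0 eta0 * sin (N%:R * t)).
Proof.
elim: N => [|N IH].
  rewrite !big_nat1 /= mul0r cos0 sin0 oppr0 mul1r add0r mulr1 !mulr0 addr0 subr0; ring.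
rewrite !(big_nat_recr N.+1) //= [X in X + _ = _]mulrDr [X in _ + X = _]mulrDr addrACA IH.
have rec := torQ0_recurrence heta0 N.
have s2 : sin (N.+2%:R * t) = sin (N.+1%:R * t) * cos t + cos (N.+1%:R * t) * sin t.
  by rewrite -sinD; congr sin; rewrite -(natr1 N.+1); ring.
have s0 : sin (N%:R * t) = sin (N.+1%:R * t) * cos t - cos (N.+1%:R * t) * sin t.
  by rewrite -sinB; congr sin; rewrite -(natr1 N); ring.
rewrite s2 s0 /den.
have E : (N.+1%:R + 2^-1) * torQ N.+2 0 eta0 = 2 * N.+1%:R * cosh eta0 * torQ N.+1 0 eta0 -
    (N%:R + 2^-1) * torQ N 0 eta0.
  by rewrite -rec -(natr1 N); field.
transitivity ((N.+1%:R + 2^-1) * (torQ N.+1 0 eta0 * (sin (N.+1%:R * t) * cos t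
    + cos (N.+1%:R * t) * sin t)) - ((N.+1%:R + 2^-1) * torQ N.+2 0 eta0) * sin (N.+1%:R * t));
  last by rewrite [RHS]mulrBr [X in _ = _ - X]mulrA.
rewrite E -(natr1 N); move: ((N%:R + 1) * t) => z.
move: (torQ N.+1 0 eta0) (torQ N 0 eta0) (cosh eta0) (cos t) (sin t)
  (cos z) (sin z) (N%:R) => *.
by field.
Qed.

Lemma null_solution_summable : coef_summable true (null_solution eta0).
Proof.
have [K HK] := torQ0_decay heta0.
apply: (@three_term_coef_summable R eta0 heta0 0 true (fun=> 0) (null_solution eta0) (2 * K) 0);
  [move=> n|exact: null_solution_three_term|move=> N]; last by rewrite big1 // => n _; rewrite normr0.
have q0 := ltW (torQ0_pos heta0 n).
have h : torQ n 0 eta0 <= K.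
  apply: le_trans (HK n); rewrite ler_peMl // -natrX ler1n expn_gt0 //.
rewrite ger0_norm ?(ltW (null_solution_pos heta0 n)) //.
by case: n q0 h => [|n] /= q0 h; move: q0 h; move: (torQ _ _ _) => q; lra.
Qed.

(** The derivative of the partial sums is O(1 / N) uniformly in t, by the decay of Q. Hence the
    limits at t and at 0 agree, and the constant need not be known. *)
Lemma null_series_constant : exists k : R, forall t p,
  mode_series eta0 0 true true (null_solution eta0) t p N @[N --> \oo] --> k.
Proof.
pose H N t := Num.sqrt (den eta0 t) * \sum_(0 <= n < N) null_solution eta0 n * cos (n%:R * t).
have HE t p : mode_series eta0 0 true true (null_solution eta0) t p = H^~ t.
  apply/funext => N; rewrite /mode_series /H mulr_sumr; apply: eq_bigr => n _.
  by rewrite mode_termE /= mul0r cos0 mulr1.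
have cH t : cvgn (H^~ t) by rewrite -(HE t 0); exact: (mode_abs_cvg 0 true t 0 null_solution_summable).2.
have dH N t : is_derive t 1 (H N.+1) (wt eta0 t * ((N%:R + 2^-1) *
    (torQ N 0 eta0 * sin (N.+1%:R * t) - torQ N.+1 0 eta0 * sin (N%:R * t)))).
  have hS M : is_derive t 1 (fun t => \sum_(0 <= n < M) null_solution eta0 n * cos (n%:R * t))
      (\sum_(0 <= n < M) null_solution eta0 n * (- n%:R * sin (n%:R * t))).
    elim: M => [|M IH].
      rewrite big_geq //; apply: is_derive_as (is_derive_cst (0 : R) t 1) _ _ => // y.
      by rewrite big_geq.
    rewrite big_nat_recr //=.
    apply: is_derive_as (is_derive_add IH (is_derive_mull (null_solution eta0 M)
      (is_derive_Phi M true t))) _ _ => // y.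
    by rewrite big_nat_recr.
  have d0 := den_gt0 t heta0; have w0 := wt_gt0 t heta0.
  have h := is_derive1_sqrt d0.
  have hs := @is_derive1_comp R Num.sqrt (den eta0) t _ _ h (is_derive_den_t eta0 t).
  rewrite -null_partial_derivative.
  apply: is_derive_as (is_derive_mul hs (hS N.+1)) _ _ => //.
  rewrite invfM -/(wt eta0 t) /= (sqrt_denE t heta0).
  move: (\sum_(_ <= _ < _) _) (\sum_(_ <= _ < _) _) (wt _ _) (den _ _) (sin t) => *; by field.
have [K HK] := torQ0_decay heta0.
have W0 : 0 <= (Num.sqrt (cosh eta0 - 1))^-1 by rewrite invr_ge0 sqrtr_ge0.
have bH N t : `|H N.+1 t - H N.+1 0| <= (Num.sqrt (cosh eta0 - 1))^-1 * (2 * K) * `|t| * harmonic N.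
  have h : `|H N.+1 t - H N.+1 0 - 0 * (t - 0)| <=
     ((Num.sqrt (cosh eta0 - 1))^-1 * (2 * K) * harmonic N) * `|t - 0|.
    apply: (mvt_dist (fun x _ => dH N x)) => x _; rewrite subr0 normrM -mulrA.
    apply: ler_pM => //.
      by rewrite ger0_norm ?wt_le // ltW // wt_gt0.
    have q0 n := torQ0_pos heta0 n.
    have N1 : 0 < N.+1%:R :> R by [].
    have sn z : `|sin z : R| <= 1 by rewrite ler_norml sin_geN1 sin_le1.
    rewrite normrM ger0_norm; last by rewrite addr_ge0.
    apply: (@le_trans _ _ (N.+1%:R * (torQ N 0 eta0 + torQ N.+1 0 eta0))).
      apply: ler_pM; [by rewrite addr_ge0|exact: normr_ge0|by rewrite -(natr1 N); lra|].
      apply: le_trans (ler_normB _ _) _; apply: lerD; rewrite normrM ger0_norm ?(ltW (q0 _)) //;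
        by rewrite ler_piMr // ltW.
    rewrite /harmonic /= ler_pdivlMr // mulrC mulrA -expr2 mulrDr mulr_natl mulr2n.
    have E n k : n.+1%:R <= k.+1%:R :> R -> n.+1%:R ^+ 2 * torQ k 0 eta0 <= K.
      move=> nk; apply: le_trans (HK k); rewrite ler_wpM2r ?(ltW (q0 _)) //.
      apply: (@le_trans _ _ (k.+1%:R ^+ 2)); first by rewrite lerXn2r // nnegrE.
      by rewrite [leRHS]exprS ler_peMl ?exprn_ge0 // ler1n.
    by apply: lerD; apply: E; rewrite // ler_nat.
  move: h; rewrite mul0r !subr0 => h; apply: le_trans h _.
  by rewrite le_eqVlt; apply/orP; left; apply/eqP; ring.
exists (limn (H^~ 0)) => t p; rewrite HE.
suff -> : limn (H^~ 0) = limn (H^~ t) by exact: cH.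
have c1 : H N.+1 t - H N.+1 0 @[N --> \oo] --> limn (H^~ t) - limn (H^~ 0).
  by apply: cvgB; rewrite (cvg_shiftS (H^~ _)); exact: cH.
have c2 : H N.+1 t - H N.+1 0 @[N --> \oo] --> (0 : R).
  apply/cvgr0Pnorm_le => e e0.
  pose C := (Num.sqrt (cosh eta0 - 1))^-1 * (2 * K) * `|t|.
  have c3 : C * harmonic N @[N --> \oo] --> (0 : R).
    by rewrite -[X in _ --> X](mulr0 C); apply: cvgM; [exact: cvg_cst|exact: cvg_harmonic].
  move/cvgr0Pnorm_le: c3 => /(_ _ e0); apply: filterS => N h.
  by apply: le_trans (bH N t) _; apply: le_trans (ler_norm _) h.
by apply/eqP; rewrite eq_sym -subr_eq0; apply/eqP; exact: cvg_unique c1 c2.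
Qed.

(* By [homogeneous_growth], y stays away from zero, and so does Phi n nu at t for odd n. *)
Lemma homogeneous_not_convergent m nu mu (y : nat -> R) : admissible m mu ->
  (m, nu, mu) <> (0%N, true, true) ->
  three_term (cosh eta0) (sinh eta0) (fun n => torL n m eta0) (first_index nu) (fun=> 0) y ->
  0 < y (first_index nu) -> mode_convergent eta0 m nu mu y -> False.
Proof.
move=> am ne hy y0 cy.
have [K HK] := null_solution_decay heta0 m.
have L0L n : torL n 0 eta0 <= torL n m eta0.
  by case: m {am ne hy cy HK} => [|m] //; rewrite ltW // torL_lt.
have strict : first_index nu = 1%N \/ torL 0 0 eta0 < torL 0 m eta0.
  case: nu ne {hy y0 cy} => ne; [right|by left].
  case: m am ne {HK L0L} => [|m] am ne; last exact: torL_lt.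
  by move: am ne; rewrite /admissible orbF => ->.
have n1 : (first_index nu <= 1)%N by case: (nu).
have [c c0 hc] := homogeneous_growth (sinh_gt0 heta0) n1
  (fun n => torL_pos heta0 n 0) L0L strict (null_solution_pos heta0)
  (null_solution_three_term heta0) hy y0 HK.
have [p hp] : exists p, Phi m mu p = 1 :> R.
  case: mu am {ne cy} => am; first by exists 0; rewrite /Phi mulr0 cos0.
  exists (pi / 2 / m%:R); rewrite /Phi mulrC divfK ?sin_pihalf // pnatr_eq0.
  by move: am; rewrite /admissible /= lt0n.
pose t : R := if nu then 0 else pi / 2.
have ht n : `|Phi n.*2.+1 nu t| = 1 :> R.
  rewrite /Phi /t; case: (nu); first by rewrite mulr0 cos0 normr1.
  have -> : n.*2.+1%:R * (pi / 2) = pi *+ n + pi / 2 :> R.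
    by rewrite -muln2 -natr1 natrM -mulr_natl; field.
  rewrite sinDpihalf; elim: n => [|n IH]; first by rewrite mulr0n cos0 normr1.
  by rewrite mulrSr cosDpi normrN.
have d0 : 0 < Num.sqrt (den eta0 t) by rewrite sqrtr_gt0 den_gt0.
have := mode_term_cvg0 (cy t p).
move=> /cvgr0Pnorm_lt /(_ (Num.sqrt (den eta0 t) * c)) [|N _ hN]; first exact: mulr_gt0.
have h : `|mode_term eta0 m nu mu y t p N.+1.*2.+1| < Num.sqrt (den eta0 t) * c.
  by apply: hN; rewrite /= -addnn; lia.
move: h; rewrite mode_termE hp mulr1 !normrM ht mulr1 gtr0_norm // ltr_pM2l // ltNge.
move/negP; apply; apply: le_trans (ler_norm _); apply: hc.
by rewrite -addnn; lia.
Qed.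

End mode_series.

(** * The coefficients of f solve the algebraic system *)

Section neumann.
Context {R : realType}.
Variables (eta0 : R) (f h : 'rV[R]_3 -> R) (b : nat -> nat -> bool -> bool -> R).
Hypothesis heta0 : 0 < eta0.
Hypothesis hb : abs_convergent b.
Hypothesis hh : forall t p, h (toroidal eta0 t p) =
  Num.sqrt (cosh eta0 - cos t) * trig_sum b t p.
Hypothesis hf : DtN eta0 f h.
Implicit Types (n m : nat) (nu mu : bool).

Lemma Phi_sqnorm_gt0 n : 0 < Phi_sqnorm n :> R.
Proof. exact: lt_le_trans (Phi_sqnorm_ge1 n). Qed.

Lemma boundary_mode_alpha m nu mu n : boundary_mode eta0 f m nu mu n =
  Phi_sqnorm n * Phi_sqnorm m * alpha eta0 f n m nu mu.
Proof.
rewrite /alpha /fourier_coef mulrC divfK; last first.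
  by rewrite mulf_neq0 // gt_eqF // Phi_sqnorm_gt0.
by apply: eq_angle_integral => t p; rewrite -/(den eta0 t) -/(wt eta0 t) mulrA.
Qed.

(** Continuity of f, as boundary value of u, bounds f / sqrt (cosh eta0 - cos theta) on the square
    of angles; this is the a priori bound from which summability is derived. *)
Lemma alpha_bounded m nu mu : exists M, forall n, `|alpha eta0 f n m nu mu| <= M.
Proof.
have [u [hu ucont uf hn]] := hf.
have cf := boundary_continuous2 heta0 ucont uf.
have cF : continuous2 (fun t p => f (toroidal eta0 t p) * wt eta0 t).
  by apply: continuous2M => //; apply: continuous2_fst; exact: continuous_wt.
have [C C0 HC] := continuous_bounded_compact (@compact_square R) (fun z _ => cF z).
exists (C * (2 * pi) ^+ 2) => n.
have B : `|boundary_mode eta0 f m nu mu n| <= C * (2 * pi) ^+ 2.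
  apply: angle_integral_le.
    by apply: continuous2M; [exact: cF|exact: (@continuous2_PhiPhi R n m nu mu)].
  move=> t p st; rewrite normrM -[leRHS]mulr1; apply: ler_pM => //; last exact: PhiPhi_le1.
  exact: (HC (t, p)).
apply: (le_trans _ B); rewrite boundary_mode_alpha; move: (alpha _ _ _ _ _ _) => y.
rewrite normrM ler_peMl //.
have [n1 m1] := (@Phi_sqnorm_ge1 R n, @Phi_sqnorm_ge1 R m).
rewrite ger0_norm; last by apply: mulr_ge0; exact: ltW (Phi_sqnorm_gt0 _).
by rewrite -[leLHS]mulr1; apply: ler_pM.
Qed.

(** [boundary_relation] concerns unnormalised integrals; division by the squared norms, which differ
    for the constant mode, produces [neumann_weight]. *)
Lemma alpha_three_term m nu mu : admissible m mu ->
  three_term (cosh eta0) (sinh eta0) (fun n => torL n m eta0) (first_index nu)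
    (fun n => b n m nu mu) (fun n => alpha eta0 f n m nu mu).
Proof.
move=> am; have [u [hu ucont uf hn]] := hf.
have rel n : admissible n nu ->
    Phi_sqnorm n * b n m nu mu = Phi_sqnorm n * (sinh eta0 / 2 * alpha eta0 f n m nu mu
      - cosh eta0 * (torL n m eta0 * alpha eta0 f n m nu mu))
      + cos_shift (fun j => Phi_sqnorm j * (torL j m eta0 * alpha eta0 f j m nu mu)) n.
  move=> an.
  have := boundary_relation heta0 hu ucont uf an (@normal_mode_limit _ _ heta0 _ _ _ hu hn hh n m nu mu).
  rewrite trig_sum_fourier //.
  under [X in _ = _ + cos_shift X n -> _]eq_fun.
    move=> j; rewrite boundary_mode_alpha.
    rewrite (_ : torL j m eta0 * _ = Phi_sqnorm m * (Phi_sqnorm j * (torL j m eta0 * alpha eta0 f j m nu mu))).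
      over.
    by move: (torL _ _ _) (alpha _ _ _ _ _ _) => *; ring.
  rewrite cos_shiftZ boundary_mode_alpha => E.
  have z : Phi_sqnorm m != 0 :> R by rewrite gt_eqF // Phi_sqnorm_gt0.
  apply: (mulfI z); rewrite mulrDr.
  transitivity (Phi_sqnorm n * Phi_sqnorm m * b n m nu mu); first by ring.
  rewrite E; congr (_ + _).
  move: (torL _ _ _) (alpha _ _ _ _ _ _) (cosh _) (sinh _) => *; ring.
have pi0 : pi != 0 :> R by rewrite gt_eqF // pi_gt0.
have adm n : (first_index nu <= n)%N -> admissible n nu.
  by rewrite /admissible; case: (nu).
(* The general step at n = 1 involves index 0; for the sine modes this term must vanish for it to
   become the initial equation. *)
have a0 : nu = false -> alpha eta0 f 0 m nu mu = 0.
  move=> ->; have := boundary_mode_alpha m false mu 0.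
  have -> : boundary_mode eta0 f m false mu 0 = angle_integral (fun _ _ : R => 0 * 0).
    by apply: eq_angle_integral => t p; rewrite /Phi mul0r sin0 mul0r mulr0 mul0r.
  rewrite angle_integralZ ?mul0r; last exact: continuous2_cst.
  move: (alpha _ _ _ _ _ _) => y /esym/eqP.
  by rewrite mulf_eq0 mulf_eq0 !(gt_eqF (Phi_sqnorm_gt0 _)) /= => /eqP.
have step n : (0 < n)%N -> (first_index nu <= n)%N -> b n m nu mu =
    sinh eta0 / 2 * alpha eta0 f n m nu mu - cosh eta0 * (torL n m eta0 * alpha eta0 f n m nu mu)
    + (neumann_weight R n.-1 * (torL n.-1 m eta0 * alpha eta0 f n.-1 m nu mu)
      + torL n.+1 m eta0 * alpha eta0 f n.+1 m nu mu) / 2.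
  case: n => // n _ hn1; apply: (mulfI pi0); have := rel _ (adm _ hn1).
  rewrite /cos_shift /Phi_sqnorm /= => ->.
  have -> : (if n == 0%N then 2 * pi else pi) = neumann_weight R n * pi.
    by case: n {hn1} => [|n] //=; rewrite mul1r.
  move: (sinh _) (cosh _) (torL _ _ _) (torL _ _ _) (torL _ _ _) (neumann_weight _ _)
    (alpha _ _ _ _ _ _) (alpha _ _ _ _ _ _) (alpha _ _ _ _ _ _) => *; by field.
split; last by move=> n hn0; apply: step; [exact: leq_ltn_trans hn0|exact: ltnW].
case nuE : nu.
  rewrite /=; have z : 2 * pi != 0 :> R by rewrite mulf_neq0 // pnatr_eq0.
  apply: (mulfI z); have := rel 0%N; rewrite nuE /cos_shift /Phi_sqnorm /= => -> //.
  move: (sinh _) (cosh _) (torL _ _ _) (torL _ _ _) (alpha _ _ _ _ _ _) (alpha _ _ _ _ _ _) => *.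
  by field.
have := step 1%N isT; rewrite nuE /= => -> //; have := a0 nuE; rewrite nuE => ->.
by rewrite !mulr0 add0r.
Qed.

Lemma alpha_summable m nu mu : admissible m mu ->
  coef_summable nu (fun n => alpha eta0 f n m nu mu).
Proof.
move=> am; have [M HM] := alpha_bounded m nu mu.
have [B HB] := mode_coef_bounded hb nu am.
exact: (three_term_coef_summable heta0 HM (alpha_three_term nu am) HB).
Qed.

End neumann.

Theorem proposition4p6 (R : realType) (eta0 : R) (heta0 : 0 < eta0)
  (b : nat -> nat -> bool -> bool -> R)
  (hb : abs_convergent b)
  (h : 'rV[R]_3 -> R)
  (hh : forall theta phi, h (toroidal eta0 theta phi) =
          Num.sqrt (cosh eta0 - cos theta) * trig_sum b theta phi)
  (hcompat : surface_integral eta0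
               (fun theta phi => h (toroidal eta0 theta phi)) = 0)
  (f : 'rV[R]_3 -> R)
  (fcont : {within torus eta0, continuous f})
  (hf : DtN eta0 f h)
  (fabs : abs_convergent
            (fourier_coef (fun theta phi => f (toroidal eta0 theta phi)))) :
  (forall c : R,
     (exists a : nat -> R,
        resulting_solution eta0 0 true (fun n => b n 0%N true true) c a) /\
     (forall a : nat -> R,
        resulting_solution eta0 0 true (fun n => b n 0%N true true) c a ->
        (forall theta phi,
           cvgn (mode_abs_series eta0 0 true true a theta phi)) /\
        exists k : R, forall theta phi,
          limn (mode_series eta0 0 true true a theta phi) =
          mode eta0 f 0 true true theta phi + k))
  /\
  (forall (m : nat) (nu mu : bool),
     admissible m mu -> (m, nu, mu) <> (0%N, true, true) ->
     (exists! c : R, exists a : nat -> R,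
        resulting_solution eta0 m nu (fun n => b n m nu mu) c a /\
        mode_convergent eta0 m nu mu a) /\
     (forall (c : R) (a : nat -> R),
        resulting_solution eta0 m nu (fun n => b n m nu mu) c a ->
        mode_convergent eta0 m nu mu a ->
        forall theta phi,
          limn (mode_series eta0 m nu mu a theta phi) =
          mode eta0 f m nu mu theta phi)).
Proof.
have Lpos m n : 0 < torL n m eta0 by exact: torL_pos.
split=> [c|m nu mu am ne].
  pose al n := alpha eta0 f n 0 true true; pose E := null_solution eta0.
  have hal := alpha_three_term heta0 hb hh hf true (isT : admissible 0 true).
  have sal := alpha_summable heta0 hb hh hf true (isT : admissible 0 true).
  have E0 := null_solution_pos heta0 0.
  (* The multiple of the null solution that moves the initial value from that of f to c. *)
  pose d := (c - al 0%N) / E 0%N; pose a0 n := al n + d * E n.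
  have ha0 : three_term (cosh eta0) (sinh eta0) (fun n => torL n 0 eta0) 0
      (fun n => b n 0%N true true) a0.
    have := three_term_lin d hal (null_solution_three_term heta0).
    by rewrite (_ : (fun n => _ + _ * 0) = (fun n => b n 0%N true true)) //;
      apply/funext => n; rewrite mulr0 addr0.
  have a00 : a0 0%N = c by rewrite /a0 /d divfK ?gt_eqF // addrC subrK.
  split; first by exists a0; split => //; apply/(algebraic_three_term heta0).
  move=> a [ac /(algebraic_three_term heta0) ha].
  have aE n : (first_index true <= n)%N -> a n = a0 n.
    by apply: (three_term_unique (Lpos 0%N) ha ha0); rewrite ac a00.
  have sa : coef_summable true a.
    have [K HK] := sal; have [K' HK'] := null_solution_summable heta0.
    exists (K + `|d| * K') => N.
    apply: (@le_trans _ _ (\sum_(first_index true <= n < N) (`|al n| + `|d| * `|E n|))).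
      apply: ler_sum => n _; rewrite aE // /a0 -normrM; exact: ler_normD.
    rewrite big_split /= -mulr_sumr; apply: lerD; first exact: HK.
    by apply: ler_wpM2l => //; exact: HK'.
  split=> [t p|]; first exact: (mode_abs_cvg heta0 0 true t p sa).1.
  have [k hk] := null_series_constant heta0; exists (d * k) => t p.
  rewrite (eq_mode_series _ _ _ _ _ aE) mode_series_lin /mode.
  apply/cvg_lim => //; apply: cvgD; first exact: (mode_abs_cvg heta0 0 true t p sal).2.
  by apply: cvgM; [exact: cvg_cst|exact: hk].
pose al n := alpha eta0 f n m nu mu.
have hal := alpha_three_term heta0 hb hh hf nu am.
have sal := alpha_summable heta0 hb hh hf nu am.
have cal : mode_convergent eta0 m nu mu al by move=> t p; exact: (mode_abs_cvg heta0 m mu t p sal).2.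
(* Symmetric in a and a', so it gives equality. If a started above a', the difference would be a
   homogeneous solution with positive initial value and a convergent series. *)
have initial a a' : three_term (cosh eta0) (sinh eta0) (fun n => torL n m eta0) (first_index nu)
      (fun n => b n m nu mu) a ->
    three_term (cosh eta0) (sinh eta0) (fun n => torL n m eta0) (first_index nu)
      (fun n => b n m nu mu) a' ->
    mode_convergent eta0 m nu mu a -> mode_convergent eta0 m nu mu a' ->
    a (first_index nu) <= a' (first_index nu).
  move=> ha ha' ca ca'; rewrite leNgt; apply/negP => lt.
  apply: (@homogeneous_not_convergent R eta0 heta0 m nu mu (fun n => a n + -1 * a' n)) => //.
  - have := three_term_lin (-1) ha ha'.
    rewrite (_ : (fun n => _ + _ * b _ _ _ _) = (fun=> 0)) //.
    by apply/funext => n; rewrite mulN1r subrr.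
  - by rewrite mulN1r subr_gt0.
  - move=> t p; rewrite mode_series_lin; apply: is_cvgD; first exact: ca.
    by apply: is_cvgM; [exact: is_cvg_cst|exact: ca'].
have alphaE a : algebraic_solution eta0 m nu (fun n => b n m nu mu) a ->
    mode_convergent eta0 m nu mu a -> a (first_index nu) = al (first_index nu).
  by move=> /(algebraic_three_term heta0) ha ca; apply/eqP; rewrite eq_le !initial.
split.
  exists (al (first_index nu)); split.
    by exists al; split => //; split => //; apply/(algebraic_three_term heta0).
  by move=> c' [a [[<- ha] ca]]; rewrite alphaE.
move=> c a [_ ha] ca t p; have e := alphaE _ ha ca; move: ha => /(algebraic_three_term heta0) ha.
by rewrite (eq_mode_series _ _ _ _ _ (three_term_unique (Lpos m) ha hal e)).
Qed.
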